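(* For every integer $k\geq 3$, $\Sigma_{k,4}$ is $C$-positive; that is, when $\Sigma_{k,4}$ is written as a polynomial in $C_2,C_3,\ldots$ (with rational coefficients), all its nonzero coefficients are positive.
   Context: Kerov's character polynomials. For $k\ge1$, $\Sigma_k$ denotes Kerov's character polynomial: the universal polynomial with integer coefficients in indeterminates $R_2,R_3,\ldots,R_{k+1}$ such that $\widehat{\chi}_\omega(k1^{n-k})=\Sigma_k(R_2(\omega),\ldots,R_{k+1}(\omega))$ for all partitions $\omega\vdash n$ and all $n\geq k$. Here $\widehat{\chi}_\omega(k1^{n-k})=n(n-1)\cdots(n-k+1)\,\chi_\omega(k1^{n-k})/\chi_\omega(1^n)$, where $\chi_\omega(\lambda)$ is the character of the irreducible representation of the symmetric group $\mathfrak{S}_n$ indexed by $\omega$ on the class of cycle type $\lambda$. The free cumulants $R_i(\omega)$ are defined by $z^{-1}+\sum_{i\ge1}R_i(\omega)z^{i-1}=H_\omega^{\langle -1\rangle}(z)$ (compositional inverse, $H_\omega$ being expanded in powers of $1/z$ at infinity), where $H_\omega(z)=\prod_{i=1}^{m-1}(z-y_i)/\prod_{i=1}^{m}(z-x_i)$, with $x_1,\ldots,x_m$ the local minima and $y_1,\ldots,y_{m-1}$ the local maxima of the boundary curve of the Young diagram of $\omega$ (French convention) rotated counterclockwise by $45^\circ$, scaled so that these are integers (i.e. the $x_i$ are the contents, column minus row, of the addable boxes of $\omega$, and the $y_i$ the contents of the removable boxes). Equivalently, by a known theorem (Okounkov, Biane, Stanley): with $R(x)=1+\sum_{i\ge2}R_ix^i$,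 $F(x)=x/R(x)$, $G(x)=1/F^{\langle-1\rangle}(x^{-1})$, where $\langle -1\rangle$ is compositional inverse, one has $\Sigma_k=-\frac1k[x^{-1}]_\infty\prod_{j=0}^{k-1}G(x-j)$, where $[x^{-1}]_\infty$ is the coefficient of $x^{-1}$ in the expansion at $x=\infty$ (in descending powers of $x$). Graded pieces: $\Sigma_{k,2n}=[u^{k+1-2n}]\,\Sigma_k(R_2u^2,R_3u^3,\ldots,R_{k+1}u^{k+1})$; in particular $\Sigma_{k,4}$ is the sum of all terms of weight $k-3$ in $\Sigma_k$, where $R_{j_1}\cdots R_{j_i}$ has weight $j_1+\cdots+j_i$. The polynomials $C_m$ in the $R_i$'s are defined by $C_0=1$, $C_1=0$, and for $m\ge2$ $$C_m=\sum_{\substack{j_2,j_3,\ldots\geq0\\2j_2+3j_3+\cdots=m}}(j_2+j_3+\cdots)!\prod_{i\ge2}\frac{((i-1)R_i)^{j_i}}{j_i!};$$ equivalently $\sum_{m\ge0}C_mt^m=\bigl(1-\sum_{i\ge2}(i-1)R_it^i\bigr)^{-1}$. Each $R_i$ ($i\ge2$) is a polynomial with rational coefficients in $C_2,C_3,\ldots$, and the $C_m$, $m\ge2$, are algebraically independent, so every polynomial in the $R_i$'s has a unique expression (its C-expansion) as a polynomial in $C_2,C_3,\ldots$. *)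

(* Defs.v *)
From HB Require Import structures.
From mathcomp Require Import all_boot all_order all_algebra all_fingroup.
From mathcomp Require Import all_solvable all_field all_character.
From mathcomp Require Import mpoly.

Set Implicit Arguments.
Unset Strict Implicit.
Unset Printing Implicit Defensive.

Import Order.TTheory GRing.Theory Num.Theory.

Local Open Scope group_scope.
Local Open Scope ring_scope.

Definition is_partition (n : nat) (w : seq nat) : bool :=
  [&& sorted geq w, 0%N \notin w & sumn w == n].

(* Boxes are indexed by (row, column) from 0, so the first row is the longest
   one (the bottom one in the French convention), and the content of a box is
   its column minus its row. *)
Definition addable_contents (w : seq nat) : seq int :=
  [seq (nth 0%N w r)%:Z - r%:Z
  | r <- iota 0 (size w).+1 & (r == 0%N) || (nth 0%N w r < nth 0%N w r.-1)%N].

Definition removable_contents (w : seq nat) : seq int :=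
  [seq (nth 0%N w r)%:Z - 1 - r%:Z
  | r <- iota 0 (size w) & (nth 0%N w r.+1 < nth 0%N w r)%N].

(* With x_1..x_m the addable and y_1..y_(m-1) the removable contents, put
   H(v) = \prod_i (v - y_i) / \prod_i (v - x_i) and
   K(z) = z^-1 + \sum_(i >= 1) R_i z^(i-1).  The R_i are the free cumulants of w
   iff H(K(z)) = z as Laurent series in z.  Multiplying this identity by
   z^(m-1) \prod_i (K(z) - x_i) turns it into the identity of power series
     \prod_i (z K(z) - y_i z) = \prod_i (z K(z) - x_i z),
   whose coefficient of z^N only involves R_1, ..., R_N.  R 0 is not used. *)
Definition free_cumulants (w : seq nat) (R : nat -> rat) : Prop :=
  forall N : nat,
    let zK : {poly rat} := 1 + \sum_(1 <= i < N.+1) R i *: 'X^i in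
    (\prod_(y <- removable_contents w) (zK - y%:~R *: 'X))`_N =
    (\prod_(x <- addable_contents w) (zK - x%:~R *: 'X))`_N.

Section YoungSubgroups.

Variable n : nat.

Definition fiber_stab (f : nat -> nat) : {set 'S_n} :=
  [set s : 'S_n | [forall i : 'I_n, f (s i) == f i]].

Fact fiber_stab_group_set f : group_set (fiber_stab f).
Proof.
apply/group_setP; split=> [|s t].
  by rewrite inE; apply/forallP=> i; rewrite perm1.
rewrite !inE => /forallP hs /forallP ht; apply/forallP=> i.
by rewrite permM (eqP (ht _)).
Qed.

Canonical fiber_stab_group f := Group (fiber_stab_group_set f).

(* The diagram of w is filled with 0, 1, ..., n - 1 row after row; the entry i
   is then in row [reshape_index w i] and column [reshape_offset w i]. *)
Definition row_stab (w : seq nat) : {group 'S_n} :=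
  [group of fiber_stab (reshape_index w)].

Definition col_stab (w : seq nat) : {group 'S_n} :=
  [group of fiber_stab (reshape_offset w)].

Fact cfSign_subproof (G : {group 'S_n}) :
  is_class_fun <<G>> [ffun s : 'S_n => (-1) ^+ odd_perm s *+ (s \in G)].
Proof.
rewrite genGid; apply: intro_class_fun => [s t sG tG|s /negPf->] //.
by rewrite groupJ // sG odd_permJ.
Qed.

Definition cfSign (G : {group 'S_n}) : 'CF(G) := Cfun 1 (cfSign_subproof G).

(* ['chi_i] is the irreducible character indexed by the partition w of n: the
   irreducible constituent common to the trivial character induced from the
   row stabilizer and the sign character induced from the column stabilizer
   (so that w = [:: n] gives the trivial character). *)
Definition partition_Iirr (w : seq nat) (i : Iirr [set: 'S_n]) : bool :=
  (i \in irr_constt ('Ind[[set: 'S_n]] (1 : 'CF(row_stab w)))) &&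
  (i \in irr_constt ('Ind[[set: 'S_n]] (cfSign (col_stab w)))).

Definition has_cycle_type (s : 'S_n) (mu : seq nat) : bool :=
  perm_eq [seq #|pred_of_set X| | X <- enum (porbits s)] mu.

End YoungSubgroups.

(* In all the polynomials below, the variable 'X_i, i < k, stands for R_(i+2)
   (in C_positive, P is a polynomial in C_2, ..., C_(k+1) and its i-th
   variable stands for C_(i+2)). *)

Definition kerov_polynomial (k : nat) (S : {mpoly int[k]}) : Prop :=
  forall (n : nat) (w : seq nat) (R : nat -> rat) (i : Iirr [set: 'S_n])
         (s : 'S_n),
    (k <= n)%N -> is_partition n w -> free_cumulants w R ->
    partition_Iirr w i -> has_cycle_type s (k :: nseq (n - k) 1%N) ->
    (n ^_ k)%:R * 'chi_i s / 'chi_i 1%g =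
    ratr (map_mpoly intr S).@[fun j : 'I_k => R j.+2] :> algC.

(* [u^(k + 1 - d)] S(R_2 u^2, ..., R_(k+1) u^(k+1)); only meaningful for
   d <= k + 1. *)
Definition kerov_part (k d : nat) (S : {mpoly int[k]}) : {mpoly rat[k]} :=
  (mmap (fun c : int => (c%:~R : {mpoly rat[k]})%:P)
        (fun i : 'I_k => ('X_i : {mpoly rat[k]}) *: 'X^(i.+2)) S)`_(k.+1 - d).

(* C_m in terms of R_2, R_3, ... in a rational algebra; the variables j_2, ...,
   j_m of the sum are the values j 0, ..., j (m - 2), and j_i <= m since
   i j_i <= m.  This gives C_0 = 1 and C_1 = 0. *)
Definition kerov_C (A : algType rat) (R : nat -> A) (m : nat) : A :=
  \sum_(j : {ffun 'I_m.-1 -> 'I_m.+1} | (\sum_(i < m.-1) i.+2 * j i == m)%N)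
    ((\sum_(i < m.-1) j i)`!)%:R *
    \prod_(i < m.-1) ((((j i)`!)%:R : rat)^-1 *: (i.+1%:R * R i.+2) ^+ j i).

Definition mpoly_R (k i : nat) : {mpoly rat[k]} :=
  if i is i'.+2 then oapp (fun j : 'I_k => 'X_j) 0 (insub i') else 0.

(* For m >= 2, C_m is (m - 1) R_m plus a polynomial in R_2, ..., R_(m-2); hence every
   polynomial in R_2, ..., R_(k+1) is a polynomial P in C_2, ..., C_(k+1), the
   expansion P is unique, and it involves no other C_m. *)
Definition C_positive (k : nat) (p : {mpoly rat[k]}) : Prop :=
  exists2 P : {mpoly rat[k]},
    p = P \mPo [tuple kerov_C (mpoly_R k) i.+2 | i < k]
    & forall m : 'X_{1..k}, P@_m != 0 -> 0 < P@_m.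

(* Main.v *)
Require Import Defs.
From HB Require Import structures.
From mathcomp Require Import all_boot all_order all_algebra all_fingroup.
From mathcomp Require Import all_field all_character.
From mathcomp Require Import mpoly ring lra zify.

(** A partition with L rows is encoded by its beta-numbers, the strictly increasing
    sequence l_i of its row lengths in increasing order plus the staircase
    0, 1, ..., L - 1.  The proof computes Kerov's polynomial from Frobenius' formula,
    isolates its component of weight k - 3, and reads off the coefficients.

    Characters.  The class function [frobenius_cf] is the alternating sum, over the
    permutations s of the rows, of the permutation characters of the symmetric group
    on the words of content l - s (the Jacobi-Trudi determinant).  Its inner products
    with permutation characters on words are signed Kostka numbers; a sign-reversing
    involution ([pieri]) reduces them to chains of horizontal strips, and when the
    shape is dominated by the content at most one chain is left ([kostka_dominated]).
    Hence [frobenius_cf] has norm 1, and it is plus or minus the irreducible character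
    of the partition, because the character induced from the sign of the column group
    meets only the term s = 1 ([frobenius_cf_partition]).  Its value at a k-cycle
    counts fixed words, hence is a signed sum of multinomial coefficients, which
    collapses to a Vandermonde determinant ([signed_wordsE]); this gives Frobenius'
    formula ([frobenius_long_cycle]), a sum over the beta-numbers of products of
    differences.

    Free cumulants.  Put v = R(z) + L z, where R is the series of the free cumulants,
    let D = z d/dz, and let A_t be the product over i of v - (l_i + t) z.  The
    definition of the free cumulants says A_0 = v A_1, once the equal factors of the
    two sides, which come from the rows that are not corners, are cancelled.  With
    C = 1/(R - D R), the series whose coefficients are the C_m, the change of variable
    x = v/z turns d/dx into - z C D.
    Hence the flow exp(t z C D) shifts x by - t; it is multiplicative ([flowM]), and
    applied to A_0 = v A_1 it gives g_t A_t = (v - t z) A_(t+1), where g_t / z is the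
    image of 1/z.  In other words 1/z is the function G(x), and g_t / z is G(x - t).
    Multiplying these equations for t = 0, ..., k - 1 identifies the product of the
    G(x - j) with a rational function of x, and Frobenius' sum is, up to the factor
    - 1/k, the sum of its residues at the beta-numbers, that is, the coefficient of 1/x
    at infinity ([residue_sum]).  The outcome is [kerov_series]: - 1/k times the
    coefficient of z^(k+1) in the product of 1/C and g_0, ..., g_(k-1).

    Uniqueness.  Kerov's polynomial agrees with this series at the cumulants of all
    partitions with k rows.  These are Zariski dense ([cumulants_dense]): the cumulants
    are polynomials in the beta-numbers, and over an algebraically closed field any k
    values of R_2, ..., R_(k+1) are attained, because the equation A_0 = v A_1 can be
    solved successively for the elementary symmetric functions of the beta-numbers.
    So the polynomial is the series ([kerov_polynomialE]).

    Positivity.  Expand g_j = 1 - sum_(m >= 0) j^(m+1)/(m+1)! z^(m+1) P_m, with P_0 = C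
    and P_(m+1) = C (D + m) P_m.  The weight of a term is its degree in z minus the
    number of factors z produced by the flow, so the component of weight k - 3 takes
    the terms of degree 4 in the flow ([kerov_series_graded]).  Each of them contains
    four factors C, one of which cancels 1/C: the component is a cubic form in the
    coefficients of C.  Its coefficients are polynomials in power sums of 0, ..., k - 1,
    and after symmetrization the one attached to (a, b, c), with a + b + c = k - 3, is
      (k-1) k (k+1) / 51840
        (k^2 (k^2 - 9) + 4 (2 k^2 - 3) (a^2 + b^2 + c^2 - a b - b c - c a)),
    which is nonnegative for k >= 3 ([weight4_symmetrize], [weight4_coef_ge0]). *)

Set Implicit Arguments.
Unset Strict Implicit.
Unset Printing Implicit Defensive.

Import Order.TTheory GRing.Theory Num.Theory.

Local Open Scope group_scope.
Local Open Scope ring_scope.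

(** * Words and multinomial coefficients *)

Definition ffun_cons (T : finType) n (v : T) (f : {ffun 'I_n -> T}) :
  {ffun 'I_n.+1 -> T} := [ffun i => oapp f v (unlift ord0 i)].

Lemma ffun_cons0 (T : finType) n v (f : {ffun 'I_n -> T}) :
  ffun_cons v f ord0 = v.
Proof. by rewrite ffunE unlift_none. Qed.

Lemma ffun_consS (T : finType) n v (f : {ffun 'I_n -> T}) i :
  ffun_cons v f (lift ord0 i) = f i.
Proof. by rewrite ffunE liftK. Qed.

Lemma big_ffun_cons (R : Type) (idx : R) (op : Monoid.com_law idx)
    (T : finType) n (F : {ffun 'I_n.+1 -> T} -> R) :
  \big[op/idx]_f F f =
  \big[op/idx]_(v : T) \big[op/idx]_(f : {ffun 'I_n -> T}) F (ffun_cons v f).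
Proof.
rewrite pair_big /=.
pose h (f : {ffun 'I_n.+1 -> T}) := (f ord0, [ffun i => f (lift ord0 i)]).
rewrite (reindex (fun p : T * {ffun 'I_n -> T} => ffun_cons p.1 p.2)) //.
exists h => [[v f]|f] _ /=.
  rewrite /h ffun_cons0; congr pair.
  by apply/ffunP => i; rewrite ffunE ffun_consS.
apply/ffunP => i; rewrite ffunE /h /=.
by case: unliftP => [j|] -> //=; rewrite ffunE.
Qed.

Definition content (I T : finType) (f : {ffun I -> T}) (t : T) : nat :=
  \sum_x (f x == t).

Definition has_content (I T : finType) (a : T -> nat) (f : {ffun I -> T}) :=
  [forall t, content f t == a t].

Lemma has_contentP (I T : finType) (a : T -> nat) (f : {ffun I -> T}) :
  reflect (content f =1 a) (has_content a f).
Proof. exact: 'forall_eqP. Qed.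

Lemma sum_content (I T : finType) (f : {ffun I -> T}) :
  (\sum_t content f t = #|I|)%N.
Proof.
rewrite exchange_big /= -sum1_card; apply: eq_bigr => x _.
by rewrite (bigD1 (f x)) //= eqxx big1 // => t /negPf; rewrite eq_sym => ->.
Qed.

Lemma content_cons (T : finType) n v (f : {ffun 'I_n -> T}) t :
  content (ffun_cons v f) t = ((v == t) + content f t)%N.
Proof.
rewrite /content big_ord_recl ffun_cons0; congr addn.
by apply: eq_bigr => i _; rewrite ffun_consS.
Qed.

(** By induction on the length: the first letter v of a word removes one occurrence of
    v from the content, and the factor n of n! is the sum of the a_v. *)
Lemma multinomial_count (T : finType) n (a : T -> nat) :
  (\sum_t a t = n)%N ->
  (#|[set f : {ffun 'I_n -> T} | has_content a f]| * \prod_t (a t)`! = n`!)%N.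
Proof.
elim: n a => [|n IHn] a sum_a.
  have a0 t : a t = 0%N by apply/eqP; move/eqP: sum_a; rewrite sum_nat_eq0 => /forallP/(_ t).
  rewrite big1 => [|t _]; last by rewrite a0.
  rewrite muln1 fact0 (eq_card (B := predT)) ?card_ffun ?card_ord ?expn0 // => f.
  by rewrite !inE; apply/has_contentP => t; rewrite a0 /content big_ord0.
rewrite -sum1dep_card big_mkcond big_ffun_cons /= big_distrl /= factS -[X in (X * _)%N]sum_a [RHS]big_distrl /=.
apply: eq_bigr => v _.
have [av0|] := posnP (a v).
  rewrite big1 ?av0 ?mul0n // => f _.
  by case: has_contentP => // /(_ v); rewrite content_cons eqxx av0.
case av: (a v) => [|m] // _.
pose b t := if t == v then m else a t.
have sum_b : (\sum_t b t = n)%N.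
  apply/eqP; rewrite -eqSS -sum_a (bigD1 v) //= [in X in _ == X](bigD1 v) //= av.
  rewrite -addSn /b eqxx; apply/eqP; congr addn; apply: eq_bigr => t /negPf tv.
  by rewrite tv.
rewrite -(IHn b sum_b) [RHS]mulnCA -sum1dep_card.
congr muln; last first.
  rewrite (bigD1 v) //= [in RHS](bigD1 v) //= av factS /b eqxx -mulnA; congr (_ * (_ * _))%N.
  by apply: eq_bigr => t /negPf ->.
rewrite [RHS]big_mkcond; apply: eq_bigr => f _; congr (if _ then _ else _).
apply/has_contentP/has_contentP => cf t.
  have := cf t; rewrite content_cons /b [t == v]eq_sym; case: eqP => [<-|_] //.
  by rewrite av => -[].
rewrite content_cons cf /b [t == v]eq_sym; case: eqP => [<-|_] //.
Qed.

(** * Signed counts of words and the Vandermonde determinant *)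

Definition vdm (R : comNzRingType) L (x : 'I_L -> R) : R :=
  \prod_(i < L) \prod_(j < L | (i < j)%N) (x j - x i).

(** Monic polynomials of degrees 0, 1, 2, ... differ from the powers of X by a
    unitriangular change of basis, so they give the Vandermonde determinant. *)
Lemma det_monic_horner (R : comNzRingType) L (p : nat -> {poly R}) (x : 'I_L -> R) :
  (forall j, p j \is monic) -> (forall j, size (p j) = j.+1) ->
  \det (\matrix_(i < L, j < L) (p j).[x i]) = vdm x.
Proof.
move=> p_monic size_p.
pose V := (Vandermonde L (\row_i x i))^T; pose U := \matrix_(m < L, j < L) (p j)`_m.
have -> : \matrix_(i < L, j < L) (p j).[x i] = V *m U.
  apply/matrixP => i j; rewrite !mxE (@horner_coef_wide _ L) ?size_p //.
  by apply: eq_bigr => m _; rewrite !mxE mulrC.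
rewrite det_mulmx det_tr det_Vandermonde -[\det U]det_tr det_trig; last first.
  apply/is_trig_mxP => i j ij; rewrite !mxE nth_default // size_p //.
rewrite [X in _ * X]big1 => [|i _]; last first.
  by rewrite !mxE; have := p_monic i; rewrite monicE lead_coefE size_p => /eqP.
by rewrite mulr1; apply: eq_bigr => i _; apply: eq_bigr => j _; rewrite !mxE.
Qed.

Definition ffact_poly (R : comNzRingType) k : {poly R} :=
  \prod_(t < k) ('X - t%:R%:P).

Lemma monic_ffact_poly (R : comNzRingType) k : ffact_poly R k \is monic.
Proof. exact: monic_prod_XsubC. Qed.

Lemma size_ffact_poly (R : comNzRingType) k : size (ffact_poly R k) = k.+1.
Proof. by rewrite size_prod_XsubC /index_enum -enumT size_enum_ord. Qed.

Lemma horner_ffact_poly (R : comNzRingType) k n :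
  (ffact_poly R k).[n%:R] = (n ^_ k)%:R.
Proof.
elim: k => [|k IHk]; first by rewrite /ffact_poly big_ord0 hornerC.
rewrite /ffact_poly big_ord_recr /= hornerM IHk hornerXsubC ffactnSr natrM.
have [nk|kn] := ltnP n k; first by rewrite ffact_small // !mul0r.
by rewrite natrB.
Qed.

(** When the sizes match, m! times the determinant of the 1/(l_i - j)!: for increasing
    l, the number of standard tableaux of the shape with beta-numbers l. *)
Definition signed_words L m (l : 'I_L -> nat) : rat :=
  \sum_(s : 'S_L) (-1) ^+ s *
    #|[set f : {ffun 'I_m -> 'I_L} | [forall i, content f i + s i == l i]%N]|%:R.

(** The number of words of content l - s is m! / prod_i (l_i - s_i)!.  Multiplied by
    prod_i l_i!, it becomes a product of falling factorials l_i (l_i - 1) ... of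
    lengths s_i, and the alternating sum over s is the determinant of monic
    polynomials of degrees 0, ..., L - 1 at the l_i. *)
Lemma signed_wordsE L m (l : 'I_L -> nat) :
  (\sum_i l i = m + \sum_(i < L) i)%N ->
  \prod_i (l i)`!%:R * signed_words m l = m`!%:R * vdm (fun i => (l i)%:R).
Proof.
move=> sum_l; rewrite -(@det_monic_horner _ _ (ffact_poly rat)); last first.
- exact: size_ffact_poly.
- exact: monic_ffact_poly.
rewrite /determinant !mulr_sumr; apply: eq_bigr => s _.
rewrite mulrCA [RHS]mulrCA; congr (_ * _).
rewrite [in RHS](eq_bigr (fun i => (l i ^_ s i)%:R)) => [|i _]; last first.
  by rewrite mxE horner_ffact_poly.
rewrite -!(big_morph _ (@natrM rat) (erefl 1%:R)) -!natrM; congr (_%:R).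
have [/forallP le_sl|/forallPn[i]] := boolP [forall i, s i <= l i]%N; last first.
  rewrite -ltnNge => lt_ls; rewrite [X in (_ * X)%N = _](_ : _ = 0%N); last first.
    apply/eqP; rewrite cards_eq0; apply/eqP/setP => f; rewrite !inE.
    apply/negP => /forallP/(_ i)/eqP; lia.
  by rewrite [in RHS](bigD1 i) //= ffact_small // mul0n !muln0.
rewrite -(@multinomial_count _ m (fun i => l i - s i)%N); last first.
  apply/eqP; rewrite -(eqn_add2r (\sum_(i < L) i)) -sum_l.
  rewrite [X in (_ + X)%N](reindex_inj (@perm_inj _ s)) /=.
  by rewrite -big_split /=; apply/eqP/eq_bigr => i _; rewrite subnK.
rewrite -mulnA mulnC; congr muln.
  apply: eq_card => f; rewrite !inE; apply: eq_forallb => i.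
  by have := le_sl i; lia.
rewrite -big_split /=; apply: eq_bigr => i _.
by rewrite mulnC ffact_fact.
Qed.

(** * Permutation characters on words *)

Section Words.

Variables (n : nat) (T : finType).
Implicit Types (f g : {ffun 'I_n -> T}) (s y : 'S_n) (a : T -> nat).

Definition perm_word y f : {ffun 'I_n -> T} := [ffun i => f (y i)].

Definition fixed_word s f : bool := [forall i, f (s i) == f i].

Definition fixed_words a s : nat :=
  #|[set f | fixed_word s f && has_content a f]|.

Lemma fixed_wordP s f : reflect (forall i, f (s i) = f i) (fixed_word s f).
Proof. exact: 'forall_eqP. Qed.

Lemma content_perm_word y f : content (perm_word y f) =1 content f.
Proof.
move=> t; rewrite /content [RHS](reindex_inj (@perm_inj _ y)) /=.
by apply: eq_bigr => i _; rewrite ffunE.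
Qed.

Lemma perm_wordM y z f : perm_word y (perm_word z f) = perm_word (y * z)%g f.
Proof. by apply/ffunP => i; rewrite !ffunE permM. Qed.

Lemma perm_word1 f : perm_word 1%g f = f.
Proof. by apply/ffunP => i; rewrite !ffunE perm1. Qed.

Lemma fixed_wordJ s y f :
  fixed_word s (perm_word y f) = fixed_word (s ^ y)%g f.
Proof.
apply/fixed_wordP/fixed_wordP => fix_f i.
  by have := fix_f (y^-1%g i); rewrite !ffunE conjgE !permM permKV.
by rewrite !ffunE; have := fix_f (y i); rewrite conjgE !permM permK.
Qed.

(** Words of the same content form a single orbit of the symmetric group. *)
Lemma content_inj_perm f g :
  content f =1 content g -> exists y, f = perm_word y g.
Proof.
move=> eq_fg.
have /tuple_permP[y eq_y] : perm_eq [tuple f i | i < n] [tuple g i | i < n].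
  apply/allP => t _ /=; apply/eqP; rewrite !count_map -!sum1_count.
  have ct (h : {ffun 'I_n -> T}) : (\sum_(i | h i == t) 1)%N = content h t.
    by rewrite /content big_mkcond; apply: eq_bigr => i _; case: eqP.
  exact: (etrans (ct f) (etrans (eq_fg t) (esym (ct g)))).
exists y; apply/ffunP => i; have /(congr1 (fun u => nth (f i) u i)) := eq_y.
by rewrite !nth_mktuple /= !tnth_mktuple ffunE.
Qed.

Fact cfWords_subproof a :
  is_class_fun <<[set: 'S_n]>>%g [ffun s : 'S_n => (fixed_words a s)%:R].
Proof.
rewrite genGid; apply: intro_class_fun => [s y _ _|s]; last by rewrite inE.
congr (_%:R); rewrite /fixed_words.
have inj_y : injective (perm_word y).
  by move=> f g /(congr1 (perm_word y^-1%g)); rewrite !perm_wordM mulVg !perm_word1.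
rewrite -(card_imset _ inj_y); apply: eq_card => f; rewrite [RHS]inE.
have [g ->] : exists g, f = perm_word y g.
  by exists (perm_word y^-1%g f); rewrite perm_wordM mulgV perm_word1.
rewrite (mem_imset _ _ inj_y) inE fixed_wordJ; congr (_ && _).
by apply: eq_forallb => t; rewrite content_perm_word.
Qed.

Definition cfWords a : 'CF([set: 'S_n]) := Cfun 0 (cfWords_subproof a).

Lemma cfWordsE a s : cfWords a s = (fixed_words a s)%:R.
Proof. by rewrite /cfWords cfunE. Qed.

Lemma eq_cfWords a b : a =1 b -> cfWords a = cfWords b.
Proof.
move=> eq_ab; apply/cfunP => s; rewrite !cfWordsE; congr _%:R; apply: eq_card => f.
by rewrite !inE; congr (_ && _); apply: eq_forallb => t; rewrite eq_ab.
Qed.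

Lemma card_perm_word (H : {group 'S_n}) f g :
    (forall y, (y \in H) = fixed_word y g) -> content f =1 content g ->
  #|[set y | perm_word y g == f]| = #|H|.
Proof.
move=> defH /content_inj_perm[y0 ->]; rewrite -(card_lcoset H y0); apply: eq_card => y.
rewrite inE mem_lcoset defH; apply/eqP/fixed_wordP => [eq_y i|fix_g].
  by have /ffunP/(_ (y0^-1%g i)) := eq_y; rewrite !ffunE permM permKV.
by apply/ffunP => i; rewrite !ffunE -[RHS]fix_g permM permK.
Qed.

(** The words of a given content form one orbit, with stabilizer a Young subgroup; the
    permutation character is induced from the trivial character of the stabilizer. *)
Lemma cfWords_Ind (H : {group 'S_n}) g :
  (forall y, (y \in H) = fixed_word y g) ->
  cfWords (content g) = 'Ind[[set: 'S_n]] (1 : 'CF(H)).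
Proof.
move=> defH; apply/cfunP => s; rewrite cfWordsE cfIndE ?subsetT //.
under eq_bigr do rewrite cfun1E defH -fixed_wordJ.
rewrite -natr_sum; apply: (canRL (mulKf (neq0CG H))); rewrite -natrM; congr (_%:R).
rewrite (partition_big (fun y => perm_word y g) (has_content (content g))) /=; last first.
  by move=> y _; apply/has_contentP/content_perm_word.
rewrite /fixed_words -sum1dep_card big_distrr /= big_mkcondl /=.
apply: eq_bigr => f /has_contentP cf.
rewrite (eq_bigr (fun=> nat_of_bool (fixed_word s f))) => [|y /andP[_ /eqP->]//].
rewrite sum_nat_const mulnC -(card_perm_word defH cf).
rewrite (eq_card (B := [set y | perm_word y g == f])) => [|y]; last first.
  by rewrite [RHS]inE unfold_in /= in_setT.
by case: ifP => _; rewrite ?muln0 ?mul0n ?muln1 ?mul1n.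
Qed.

Definition word_stab g : {set 'S_n} := [set y | fixed_word y g].

Fact word_stab_group_set g : group_set (word_stab g).
Proof.
apply/group_setP; split=> [|s t].
  by rewrite inE; apply/fixed_wordP => i; rewrite perm1.
rewrite !inE => /fixed_wordP fix_s /fixed_wordP fix_t.
by apply/fixed_wordP => i; rewrite permM fix_t.
Qed.

Canonical word_stab_group g := Group (word_stab_group_set g).

Lemma content_surj a : (\sum_t a t = n)%N -> exists g, content g =1 a.
Proof.
move=> /multinomial_count; case: (set_0Vmem [set f : {ffun 'I_n -> T} | has_content a f]).
  by move=> ->; rewrite cards0 mul0n => /esym/eqP; rewrite eqn0Ngt fact_gt0.
by case=> g; rewrite inE => /has_contentP; exists g.
Qed.

Lemma cfWords_eq0 a : (\sum_t a t)%N != n -> cfWords a = 0.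
Proof.
move=> neq; apply/cfunP => s; rewrite cfWordsE cfunE /fixed_words.
rewrite [X in X%:R](_ : _ = 0%N) //; apply/eqP; rewrite cards_eq0.
apply/eqP/setP => f; rewrite !inE; apply/negP => /andP[_ /has_contentP cf].
case/eqP: neq; rewrite -[RHS]card_ord -(sum_content f).
by apply: eq_bigr => t _; rewrite cf.
Qed.

Lemma cfWords_char a : cfWords a \is a character.
Proof.
have [sum_a|/cfWords_eq0->] := eqVneq (\sum_t a t)%N n; last exact: rpred0.
have [g cg] := content_surj sum_a; rewrite -(eq_cfWords cg).
by rewrite (@cfWords_Ind (word_stab_group g)) => [|y]; rewrite ?inE // cfInd_char ?cfun1_char.
Qed.

(** Frobenius reciprocity: a transitive action contains the trivial character once. *)
Lemma cfWords_dot1 a : (\sum_t a t = n)%N -> '[cfWords a, 1] = 1.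
Proof.
move=> sum_a; have [g cg] := content_surj sum_a; rewrite -(eq_cfWords cg).
rewrite (@cfWords_Ind (word_stab_group g)) => [|y]; last by rewrite inE.
by rewrite -Frobenius_reciprocity cfRes_cfun1 ?subsetT // cfnorm1.
Qed.

End Words.

(** * Inner products of the word characters *)

Section WordPairs.

Variables (n : nat) (T : finType) (r : nat).

Lemma content_fst (F : {ffun 'I_n -> T * 'I_r}) t :
  content [ffun i => (F i).1] t = (\sum_(j < r) content F (t, j))%N.
Proof.
rewrite exchange_big; apply: eq_bigr => i _ /=; rewrite ffunE.
case: (F i) => t' j' /=; rewrite (bigD1 j') //= big1 => [|j /negPf jj'].
  by rewrite addn0 xpair_eqE eqxx andbT.
by rewrite xpair_eqE [j' == j]eq_sym jj' andbF.
Qed.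

Lemma content_snd (F : {ffun 'I_n -> T * 'I_r}) j :
  content [ffun i => (F i).2] j = (\sum_t content F (t, j))%N.
Proof.
rewrite exchange_big; apply: eq_bigr => i _ /=; rewrite ffunE.
case: (F i) => t' j' /=; rewrite (bigD1 t') //= big1 => [|t /negPf tt'].
  by rewrite addn0 xpair_eqE eqxx.
by rewrite xpair_eqE [t' == t]eq_sym tt'.
Qed.

Definition margins N (a : T -> nat) (b : 'I_r -> nat)
    (A : {ffun 'I_r -> {ffun T -> 'I_N}}) : bool :=
  [forall t, (\sum_j A j t == a t)%N] && [forall j, (\sum_t A j t == b j)%N].

Lemma content_le (I X : finType) (f : {ffun I -> X}) t : (content f t <= #|I|)%N.
Proof. by rewrite -(sum_content f) (bigD1 t) //= leq_addr. Qed.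

(** A pair of words of contents a and b is a word in pairs of letters; its content is
    a matrix with margins a and b. *)
Lemma fixed_wordsM N (a : T -> nat) (b : 'I_r -> nat) (s : 'S_n) : (n <= N)%N ->
  (fixed_words a s * fixed_words b s =
   \sum_(A : {ffun 'I_r -> {ffun T -> 'I_N.+1}} | margins a b A)
      fixed_words (fun p => A p.2 p.1) s)%N.
Proof.
move=> le_nN; rewrite /fixed_words -cardsX.
pose j (F : {ffun 'I_n -> T * 'I_r}) := ([ffun i => (F i).1], [ffun i => (F i).2]).
have inj_j : injective j.
  move=> F F' [/ffunP e1 /ffunP e2]; apply/ffunP => i.
  by have := e1 i; have := e2 i; rewrite !ffunE; case: (F i) => ? ?; case: (F' i) => ? ? /= -> ->.
pose m (F : {ffun 'I_n -> T * 'I_r}) : {ffun 'I_r -> {ffun T -> 'I_N.+1}} :=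
  [ffun j => [ffun t => inord (content F (t, j))]].
have mE F t i : m F i t = content F (t, i) :> nat.
  by rewrite !ffunE inordK // ltnS (leq_trans (content_le _ _)) // card_ord.
transitivity #|[set F : {ffun 'I_n -> T * 'I_r} | fixed_word s F && margins a b (m F)]|.
  rewrite -(card_imset _ inj_j); apply: eq_card => -[f g]; rewrite inE.
  have [F ->] : exists F, (f, g) = j F.
    exists [ffun i => (f i, g i)]; rewrite /j; congr pair; apply/ffunP => i; by rewrite !ffunE.
  rewrite (mem_imset _ _ inj_j) !inE /= -!andbA.
  have -> : fixed_word s F = fixed_word s (j F).1 && fixed_word s (j F).2.
    apply/fixed_wordP/andP => [fF|[/fixed_wordP f1 /fixed_wordP f2] i].
      by split; apply/fixed_wordP => i; rewrite !ffunE fF.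
    by have := f1 i; have := f2 i; rewrite !ffunE; case: (F (s i)) => ? ?; case: (F i) => ? ? /= -> ->.
  rewrite -andbA; congr (_ && _); rewrite andbCA; congr (_ && _).
  congr (_ && _); apply: eq_forallb => t /=; first by rewrite content_fst; under [in RHS]eq_bigr do rewrite mE.
  by rewrite content_snd; under [in RHS]eq_bigr do rewrite mE.
rewrite -sum1dep_card (partition_big m (margins a b)) => [|F /andP[]//].
apply: eq_bigr => A mA; rewrite -sum1dep_card; apply: eq_bigl => F.
rewrite -andbA; congr (_ && _); apply/andP/has_contentP => [[_ /eqP <-] [t i]|cF].
  by rewrite mE.
have -> : m F = A; last by rewrite eqxx.
by apply/ffunP => i; apply/ffunP => t; apply: val_inj; rewrite [LHS]mE cF.
Qed.

(** The product of two permutation characters splits over the orbits on pairs of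
    words, which are the matrices with nonnegative entries and the given margins. *)
Lemma cfWords_dot N (a : T -> nat) (b : 'I_r -> nat) : (n <= N)%N ->
  (\sum_t a t = n)%N ->
  '[cfWords n a, cfWords n b] =
  #|[set A : {ffun 'I_r -> {ffun T -> 'I_N.+1}} | margins a b A]|%:R.
Proof.
move=> le_nN sum_a.
transitivity (\sum_(A : {ffun 'I_r -> {ffun T -> 'I_N.+1}} | margins a b A)
   '[cfWords n (fun p => A p.2 p.1), 1]).
  rewrite -cfdot_suml !cfdotE; congr (_ * _); apply: eq_bigr => s _.
  rewrite cfun1E in_setT rmorph1 mulr1 !cfWordsE sum_cfunE.
  rewrite rmorph_nat -natrM (fixed_wordsM _ _ _ le_nN) natr_sum.
  by apply: eq_bigr => A _; rewrite cfWordsE.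
rewrite -sum1dep_card natr_sum; apply: eq_bigr => A /andP[/forallP mA _].
apply: cfWords_dot1; rewrite -sum_a -(pair_bigA _ (fun t j => nat_of_ord (A j t))) /=.
by apply: eq_bigr => t _; rewrite (eqP (mA t)).
Qed.

End WordPairs.

(** * Pieri's rule and signed Kostka numbers *)

Lemma eq_of_leq_sum (I : finType) (P : pred I) (E1 E2 : I -> nat) :
    (forall i, P i -> E1 i <= E2 i)%N ->
    (\sum_(i | P i) E2 i <= \sum_(i | P i) E1 i)%N ->
  forall i, P i -> E1 i = E2 i.
Proof.
move=> le12 le21 i Pi.
have [_] := leqif_sum (fun i Pi => leqif_geq (le12 i Pi)).
rewrite eqn_leq le21 leq_sum // => /esym/forall_inP/(_ i Pi) ge12.
by apply/eqP; rewrite eqn_leq le12.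
Qed.

Section Pieri.

Variables (L N : nat).
Implicit Types (l : 'I_L -> nat) (m : {ffun 'I_L -> 'I_N.+1}).

Definition increasing l : Prop := forall i j : 'I_L, (i < j)%N -> (l i < l j)%N.

Definition permute (t : 'S_L) m : {ffun 'I_L -> 'I_N.+1} := [ffun i => m (t i)].

Lemma permute_inj t : injective (permute t).
Proof.
move=> m m' /ffunP e; apply/ffunP => i; have := e (t^-1%g i).
by rewrite !ffunE permKV.
Qed.

Definition antisymmetric_on (G : {ffun 'I_L -> 'I_N.+1} -> int) : Prop :=
  forall t m, G (permute t m) = (-1) ^+ t * G m.

Definition below l m : bool := [forall i, m i <= l i]%N.

(** For increasing l and m below l, the absence of crossings is the interlacing
    l_(j-1) < m_j <= l_j: the boxes between the shapes form a horizontal strip. *)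
Definition crossing l m (j : 'I_L) : bool :=
  [exists i : 'I_L, (i.+1 == j)%N && (m j <= l i)%N].

Definition last_crossing l m (j : 'I_L) : bool :=
  crossing l m j && [forall j' : 'I_L, (j < j')%N ==> ~~ crossing l m j'].

Lemma last_crossing_uniq l m j j' :
  last_crossing l m j -> last_crossing l m j' -> j = j'.
Proof.
move=> /andP[cj /forallP nj] /andP[cj' /forallP nj']; apply: val_inj => /=.
have [jj'|j'j|//] := ltngtP j j'.
  by have := nj j'; rewrite jj' cj'.
by have := nj' j; rewrite j'j cj.
Qed.

(** At a crossing, m_(j-1) and m_j are both at most l_(j-1), so exchanging them
    respects all the constraints and changes the sign.  Taking the last crossing makes
    this an involution, since the crossings to the right of j are not affected. *)
Lemma sum_last_crossing l (Q : pred nat) (G : {ffun 'I_L -> 'I_N.+1} -> int) j :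
  increasing l -> antisymmetric_on G ->
  \sum_(m | (below l m && Q (\sum_i m i)%N) && last_crossing l m j) G m = 0.
Proof.
move=> inc_l antiG.
have [/existsP[i /eqP ij]|/existsPn no_i] := boolP [exists i : 'I_L, i.+1 == j]%N; last first.
  by apply: big1 => m /andP[_ /andP[/existsP[i /andP[ij _]]]]; have := no_i i; rewrite ij.
set X := (X in X = _).
(* Exchanging m_i and m_j, where j = i + 1, maps the sum to its opposite. *)
have : X = - X; last by move=> ?; lia.
have lij : (i < j)%N by rewrite -ij.
have neq_ij : i != j by rewrite -val_eqE /= neq_ltn lij.
rewrite {1}/X (reindex_inj (@permute_inj (tperm i j))) -sumrN /=.
apply: eq_big => [m|m _]; last by rewrite antiG odd_tperm neq_ij expr1 mulN1r.
have imp m1 : (below l m1 && Q (\sum_i m1 i)%N) && last_crossing l m1 j ->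
    (below l (permute (tperm i j) m1) && Q (\sum_h permute (tperm i j) m1 h)%N) &&
    last_crossing l (permute (tperm i j) m1) j.
  set m2 := permute _ _.
  case/andP=> /andP[/forallP bm sm] /andP[/existsP[i' /andP[/eqP i'j mj]] /forallP nc].
  have ei : i' = i by apply: val_inj => /=; lia.
  have {i' i'j ei}mj : (m1 j <= l i)%N by rewrite -ei.
  have m2i : m2 i = m1 j by rewrite ffunE tpermL.
  have m2j : m2 j = m1 i by rewrite ffunE tpermR.
  have m2D k : k != i -> k != j -> m2 k = m1 k.
    by move=> ki kj; rewrite ffunE tpermD // eq_sym.
  apply/andP; split; first apply/andP; first split.
  - apply/forallP => k; have [->|ki] := eqVneq k i; first by rewrite m2i.
    have [->|kj] := eqVneq k j; last by rewrite m2D.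
    by rewrite m2j (leq_trans (bm i)) // ltnW // inc_l.
  - rewrite (_ : (\sum_h m2 h = \sum_h m1 h)%N) // [RHS](reindex_inj (@perm_inj _ (tperm i j))) /=.
    by apply: eq_bigr => k _; rewrite ffunE.
  apply/andP; split; first by apply/existsP; exists i; rewrite ij eqxx m2j bm.
  apply/forallP => j'; apply/implyP => jj'; have := nc j'; rewrite jj' /= => nc'.
  apply: contra nc' => /existsP[k /andP[kj' mk]]; apply/existsP; exists k; rewrite kj'.
  by rewrite -m2D // -val_eqE /=; lia.
apply/idP/idP => [/imp|/imp//].
have -> // : permute (tperm i j) (permute (tperm i j) m) = m.
by apply/ffunP => k; rewrite !ffunE tpermK.
Qed.

(** Pieri's rule: exchanging the two entries that meet at the last crossing cancels
    all the terms other than the horizontal strips. *)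
Lemma pieri l (Q : pred nat) (G : {ffun 'I_L -> 'I_N.+1} -> int) :
  increasing l -> antisymmetric_on G ->
  \sum_(m | below l m && Q (\sum_i m i)%N) G m =
  \sum_(m | (below l m && Q (\sum_i m i)%N) && [forall j, ~~ crossing l m j]) G m.
Proof.
move=> inc_l antiG; rewrite (bigID (fun m => [forall j, ~~ crossing l m j])) /=.
rewrite [X in _ + X](_ : _ = 0) ?addr0 //.
rewrite (partition_big (fun m => [pick j | last_crossing l m j]) predT) //=.
rewrite big1 // => -[j|] _; last first.
  apply: big1 => m /andP[/andP[_ /forallPn[j0]]]; rewrite negbK => cj0.
  case: pickP => // no _; have := no [arg max_(j > j0 | crossing l m j) (j : nat)].
  case: arg_maxnP => // j cj maxj; rewrite /last_crossing cj /= => /negbT/forallPn[j'].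
  by rewrite negb_imply negbK => /andP[jj' /maxj]; rewrite /= leqNgt jj'.
rewrite -[RHS](sum_last_crossing Q j inc_l antiG); apply: eq_bigl => m.
rewrite -andbA; congr (_ && _); apply/andP/idP => [[_]|cj].
  by case: pickP => // j' cj' /eqP[<-].
split; first by apply/forallPn; exists j; rewrite negbK; case/andP: cj.
by case: pickP => [j' cj'|/(_ j)]; rewrite ?cj // (last_crossing_uniq cj cj').
Qed.

(** The signed count of the ways to reach the staircase from l by removing b_0, then
    b_1, ... boxes, the intermediate sequences being arbitrary.  At depth r the
    letters 0, ..., L - r - 1 are already removed, whence the index of b.  At depth 0
    the remaining sequence is a permutation of the staircase, counted with its sign.
    By Pieri's rule, for increasing l and r = L this is the Kostka number. *)
Fixpoint kostka (b : nat -> nat) r l : int :=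
  if r is r'.+1 then
    \sum_(m | below l m && (\sum_i m i + b (L - r'.+1) == \sum_i l i)%N)
       kostka b r' (fun i => m i)
  else \sum_(s : 'S_L) (-1) ^+ s * [forall i, s i == l i :> nat]%:R.

Lemma kostka_antisym b r : antisymmetric_on (fun m => kostka b r (fun i => m i)).
Proof.
elim: r => [|r IHr] t m /=.
  rewrite (reindex_inj (mulgI t)) mulr_sumr; apply: eq_bigr => s _ /=.
  rewrite odd_permM signr_addb mulrA; congr (_ * _%:R); congr nat_of_bool.
  apply/forallP/forallP => e i; last by rewrite permM ffunE; exact: e.
  by have := e (t^-1%g i); rewrite permM ffunE permKV.
rewrite (reindex_inj (@permute_inj t)) mulr_sumr /=.
apply: eq_big => [m'|m' _]; last exact: IHr.
congr (_ && _).
  apply/forallP/forallP => e i; last by rewrite !ffunE; exact: e.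
  by have := e (t^-1%g i); rewrite !ffunE permKV.
congr (_ + _ == _)%N.
  by rewrite [RHS](reindex_inj (@perm_inj _ t)); apply: eq_bigr => i _; rewrite ffunE.
by rewrite [RHS](reindex_inj (@perm_inj _ t)); apply: eq_bigr => i _; rewrite ffunE.
Qed.

Lemma increasing_ge l : increasing l -> forall i : 'I_L, (i <= l i)%N.
Proof.
move=> inc_l [k kL] /=; elim: k kL => // k IHk kL.
have := IHk (ltnW kL); have := inc_l (Ordinal (ltnW kL)) (Ordinal kL) (leqnn _).
by move=> /= lt_l le_k; apply: leq_ltn_trans lt_l.
Qed.

Lemma noncrossing_increasing l m :
  increasing l -> below l m -> [forall j, ~~ crossing l m j] -> increasing (fun i => m i).
Proof.
move=> inc_l /forallP bm /forallP nc i j ij.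
have lt_j'L : (j.-1 < L)%N by have := ltn_ord j; lia.
have := nc j; apply: contraR => mji; apply/existsP; exists (Ordinal lt_j'L) => /=.
have : (l i <= l (Ordinal lt_j'L))%N.
  have [e|ne] := eqVneq (i : nat) j.-1; first by rewrite (_ : i = Ordinal lt_j'L) //; apply: val_inj.
  by apply/ltnW/inc_l => /=; lia.
by have := bm i; lia.
Qed.

(** Only the filling of row i by the letter i survives when the shape is dominated
    by the content. *)
Lemma kostka_dominated (b : nat -> nat) r l : (r <= L)%N ->
    increasing l -> (forall i, l i <= N)%N ->
    (forall u, (L - r <= u)%N ->
       \sum_(i < L | (u <= i)%N) l i <= \sum_(i < L | (u <= i)%N) (i + b i))%N ->
  kostka b r l = [forall i : 'I_L, l i == (if i < L - r then i : nat else i + b i)]%N%:R.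
Proof.
elim: r l => [|r IHr] l le_rL inc_l le_lN dom /=.
  have ->: [forall i : 'I_L, l i == (if i < L - 0 then i : nat else i + b i)]%N =
           [forall i : 'I_L, (1%g : 'S_L) i == l i :> nat].
    by apply: eq_forallb => i; rewrite subn0 ltn_ord perm1 eq_sym.
  rewrite (bigD1 1%g) //= odd_perm1 expr0 mul1r big1 ?addr0 // => s s1.
  case: forallP => [e|_]; last by rewrite mulr0.
  case/eqP: s1; apply/permP => i; rewrite perm1.
  have inc_s : increasing (fun j => s j).
    by move=> j k jk; rewrite (eqP (e j)) (eqP (e k)); apply: inc_l.
  have inc_s' : increasing (fun j => (s^-1)%g j).
    move=> j k jk; rewrite ltnNge; apply: contraL jk; rewrite -leqNgt leq_eqVlt.
    case/orP=> [/eqP/val_inj/perm_inj-> //|/inc_s]; rewrite !permKV; exact: ltnW.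
  apply/val_inj/eqP; rewrite eqn_leq (increasing_ge inc_s i) andbT.
  by have := increasing_ge inc_s' (s i); rewrite permK.
(* Removing the b_t letters t from a dominated shape leaves a shape to which the
   induction applies: only the candidate m0 can contribute. *)
set t := (L - r.+1)%N.
rewrite (@pieri l (fun c => c + b t == \sum_i l i)%N) //; last exact: kostka_antisym.
pose cand m := [forall i : 'I_L, m i == (if i < t.+1 then i : nat else i + b i)%N :> nat].
have tE : (L - r = t.+1)%N by rewrite /t; lia.
rewrite (eq_bigr (fun m => (cand m)%:R)); last first.
  move=> m /andP[/andP[bm sm] nc]; rewrite /cand -tE; apply: IHr; first exact: ltnW.
  - exact: noncrossing_increasing nc.
  - by move=> i; rewrite -ltnS.
  move=> u le_tu; apply: (leq_trans (leq_sum _ _)) (dom u _) => [i _|]; last lia.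
  exact: (forallP bm).
have lt_tL : (t < L)%N by rewrite /t; lia.
have [/forallP/= lE|/negP nlE] := boolP [forall i : 'I_L, l i == (if i < t then i : nat else i + b i)%N]; last first.
  apply: big1 => m /andP[/andP[/forallP bm /eqP sm] /forallP nc].
  rewrite /cand; case: forallP => // mE; case: nlE.
  have eq_lm (i : 'I_L) : (t < i)%N -> l i = m i.
    move=> ti; apply/esym; apply: (@eq_of_leq_sum _ (fun i : 'I_L => t < i)%N (fun i => m i) l) => //.
    apply: leq_trans (dom t.+1 (leqnSn _)) _; apply/eq_leq/eq_bigr => j tj.
    by rewrite (eqP (mE j)) ltnS leqNgt tj.
  have l_small (i : 'I_L) : (i < t)%N -> l i = i.
    move=> it; have lt_jL : (i.+1 < L)%N by lia.
    have := nc (Ordinal lt_jL); rewrite negb_exists => /forallP/(_ i).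
    rewrite eqxx /= -ltnNge (eqP (mE _)) /= ltnS it => le_li.
    by have := bm i; rewrite (eqP (mE _)) ltnS (ltnW it) => le_il; lia.
  pose it := Ordinal lt_tL.
  have l_t : l it = (t + b t)%N.
    move: sm; rewrite (bigD1 it) //= [in RHS](bigD1 it) //= (eqP (mE it)) /= ltnSn.
    rewrite (eq_bigr l) => [|i ne_it]; first lia.
    have [lt_it|] := ltnP i t; first by rewrite l_small // (eqP (mE i)) ltnS ltnW.
    by move=> le_ti; rewrite eq_lm // ltn_neqAle le_ti andbT eq_sym.
  apply/forallP => i; have [lt_it|gt_it|eq_it] := ltngtP i t.
  - by rewrite l_small.
  - by rewrite eq_lm // (eqP (mE i)) ltnS leqNgt gt_it.
  - by rewrite (_ : i = it) ?l_t //; apply: val_inj.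
pose m0 : {ffun 'I_L -> 'I_N.+1} := [ffun i : 'I_L => inord (if i < t.+1 then i : nat else i + b i)%N].
have le_m0 (i : 'I_L) : ((if i < t.+1 then i : nat else i + b i) <= l i)%N.
  by have /eqP-> := lE i; case: ifP; case: ifP; lia.
have m0E (i : 'I_L) : m0 i = (if i < t.+1 then i : nat else i + b i)%N :> nat.
  by rewrite ffunE inordK // ltnS (leq_trans (le_m0 i)).
rewrite (bigD1 m0) /=; last first.
  apply/andP; split; first (apply/andP; split).
  - by apply/forallP => i; rewrite m0E.
  - rewrite (bigD1 (Ordinal lt_tL)) //= [in X in _ == X](bigD1 (Ordinal lt_tL)) //=.
    have /eqP-> := lE (Ordinal lt_tL); rewrite m0E /= ltnSn ltnn addnAC.
    apply/eqP; congr addn; apply: eq_bigr => i; rewrite -val_eqE /= => ne_it.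
    have /eqP-> := lE i; rewrite m0E.
    by have [lt_it|gt_it|eq_it] := ltngtP i t; [rewrite ltnW | rewrite ltnS leqNgt gt_it | lia].
  apply/forallP => j; apply/existsP => -[i /andP[/eqP ij]].
  rewrite m0E leqNgt => /negP; apply.
  have lt_ij : (i < j)%N by rewrite ij.
  case: ifP => jt; last by apply: leq_trans (inc_l _ _ lt_ij) _; have /eqP-> := lE j; case: ifP => //; lia.
  by have /eqP-> := lE i; case: ifP; lia.
have -> : cand m0 by apply/forallP => i; rewrite m0E.
rewrite big1 ?addr0 //.
move=> m /andP[_ ne_m]; rewrite /cand; case: forallP => // mE; case/eqP: ne_m.
by apply/ffunP => i; apply: val_inj; rewrite [RHS]m0E; exact: (eqP (mE i)).
Qed.

End Pieri.

(** * The Frobenius class function *)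

(** The successive differences of a chain from l to a permuted staircase are the
    columns of a matrix with row sums l - s and column sums b_(L-r), ..., b_(L-1). *)
Lemma kostka_matrices L N (b : nat -> nat) r (l : 'I_L -> nat) :
    (r <= L)%N -> (forall i, l i <= N)%N ->
  kostka N b r l =
  \sum_(A : {ffun 'I_r -> {ffun 'I_L -> 'I_N.+1}} |
          [forall j, \sum_t A j t == b (L - r + j)]%N)
     \sum_(s : 'S_L) (-1) ^+ s * [forall t, \sum_j A j t + s t == l t]%N%:R.
Proof.
elim: r l => [|r IHr] l le_rL le_lN /=.
  rewrite (big_pred1 [ffun i => [ffun=> ord0]]) => [|A] /=; last first.
    transitivity true; first by apply/forallP; case.
    by apply/esym/eqP/ffunP; case.
  apply: eq_bigr => s _; congr (_ * _%:R); congr nat_of_bool.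
  by apply: eq_forallb => i; rewrite big_ord0.
set t := (L - r.+1)%N; have tE : (L - r = t.+1)%N by rewrite /t; lia.
pose below_word (v : {ffun 'I_L -> 'I_N.+1}) := [forall i, v i <= l i]%N.
(* The first column v of the matrix is the difference l - m. *)
pose h (v : {ffun 'I_L -> 'I_N.+1}) : {ffun 'I_L -> 'I_N.+1} :=
  [ffun i => inord (l i - v i)].
have hE v i : h v i = (l i - v i)%N :> nat.
  by rewrite ffunE inordK // ltnS (leq_trans (leq_subr _ _)).
have hK v : below l v -> h (h v) = v.
  move=> /forallP bv; apply/ffunP => i; apply: val_inj; rewrite [LHS]hE hE subKn //.
have below_h v : below l (h v) by apply/forallP => i; rewrite hE leq_subr.
transitivity (\sum_(v | below l v && (\sum_i v i == b t)%N) kostka N b r (fun i => h v i)).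
  rewrite (reindex_onto h h) /=; last by move=> m /andP[/hK].
  apply: eq_big => [v|//]; rewrite below_h /=; apply/andP/andP.
    case=> /eqP sv /eqP hv; rewrite -hv below_h; split=> //.
    have : (\sum_i h v i + \sum_i h (h v) i = \sum_i l i)%N.
      by rewrite -big_split; apply: eq_bigr => i _ /=; rewrite [X in (_ + X)%N]hE subnKC ?(forallP (below_h v)).
    by rewrite -sv => /addnI ->.
  case=> bv /eqP <-; rewrite hK //; split=> //; rewrite -big_split; apply/eqP.
  by apply: eq_bigr => i _ /=; rewrite hE subnK ?(forallP bv).
rewrite [RHS]big_mkcond big_ffun_cons /= [LHS]big_mkcond /=; apply: eq_bigr => v _.
have cols A : [forall j, \sum_i ffun_cons v A j i == b (t + j)]%N =
    (\sum_i v i == b t)%N && [forall j : 'I_r, \sum_i A j i == b (L - r + j)]%N.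
  apply/forallP/andP => [e|[e0 /forallP e] j].
    have := e ord0; rewrite ffun_cons0 addn0 => ->; split=> //; apply/forallP => j.
    by have := e (lift ord0 j); rewrite ffun_consS lift0 tE addSnnS.
  case: (unliftP ord0 j) => [j'|] ->; last by rewrite ffun_cons0 addn0.
  by rewrite ffun_consS lift0 -addSnnS -tE.
have rows A i : (\sum_j ffun_cons v A j i = v i + \sum_j A j i)%N.
  by rewrite big_ord_recl ffun_cons0; congr addn; apply: eq_bigr => j _; rewrite ffun_consS.
case: ifPn => [/andP[bv sv]|nbv].
  rewrite (IHr _ (ltnW le_rL)); last by move=> i; rewrite -ltnS.
  rewrite [LHS]big_mkcond; apply: eq_bigr => A _; rewrite cols sv /=.
  case: ifP => // _; apply: eq_bigr => s _; congr (_ * _%:R); congr nat_of_bool.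
  apply: eq_forallb => i; rewrite rows hE.
  by rewrite -addnA -(eqn_add2l (v i)) subnKC ?(forallP bv).
rewrite big1 // => A _; case: ifP => //; rewrite cols => /andP[sv _].
rewrite sv andbT negb_forall in nbv; case/existsP: nbv => i nbi.
apply: big1 => s _; case: forallP => [/(_ i)|_]; last by rewrite mulr0.
by rewrite rows => e; case/negP: nbi; lia.
Qed.

Section FrobeniusCharacter.

Variables (L n : nat).
Implicit Types (l : 'I_L -> nat).

Definition shifted_words (l : 'I_L -> nat) (s : 'S_L) : 'CF([set: 'S_n]) :=
  if [forall i, s i <= l i]%N then cfWords n (fun i => l i - s i)%N else 0.

(** The Jacobi-Trudi determinant of h_(l_i - j), with products of complete symmetric
    functions read as permutation characters on words. *)
Definition frobenius_cf (l : 'I_L -> nat) : 'CF([set: 'S_n]) :=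
  \sum_(s : 'S_L) (-1) ^+ s *: shifted_words l s.

Lemma shifted_words_char l s : shifted_words l s \is a character.
Proof. by rewrite /shifted_words; case: ifP => _; rewrite ?cfWords_char ?rpred0. Qed.

Lemma frobenius_cf_vchar l : frobenius_cf l \in 'Z[irr [set: 'S_n]].
Proof.
apply: rpred_sum => s _; rewrite rpredZsign; exact/char_vchar/shifted_words_char.
Qed.

Lemma sum_perm (s : 'S_L) : (\sum_i s i = \sum_(i < L) i)%N.
Proof. by rewrite [RHS](reindex_inj (@perm_inj _ s)). Qed.

Lemma sum_shifted l (s : 'S_L) :
  (\sum_i l i = n + \sum_(i < L) i)%N -> [forall i, s i <= l i]%N ->
  (\sum_i (l i - s i) = n)%N.
Proof.
move=> sum_l /forallP le_sl; apply/eqP; rewrite -(eqn_add2r (\sum_(i < L) i)) -sum_l.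
rewrite -{1}(sum_perm s) -big_split /=; apply/eqP/eq_bigr => i _; exact: subnK.
Qed.

(** Both sides count the same signed matrices: those with margins l - s and b. *)
Lemma frobenius_cf_dot N l (b : nat -> nat) :
    (\sum_i l i = n + \sum_(i < L) i)%N -> (n <= N)%N -> (forall i, l i <= N)%N ->
  '[frobenius_cf l, cfWords n (fun i : 'I_L => b i)] = (kostka N b L l)%:~R.
Proof.
move=> sum_l le_nN le_lN; rewrite kostka_matrices // exchange_big /= rmorph_sum cfdot_suml.
apply: eq_bigr => s _; rewrite cfdotZl.
rewrite -mulr_sumr rmorphM /= rmorphXn rmorphN1.
congr (_ * _); rewrite /shifted_words; case: ifPn => [sl|/forallPn[i nsl]]; last first.
  rewrite cfdot0l big1 // => A _; case: forallP => // /(_ i) e; exfalso; lia.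
rewrite (@cfWords_dot _ _ _ N) ?sum_shifted //.
rewrite -natr_sum /= -big_mkcondr sum1dep_card /= rmorph_nat; congr (_%:R).
apply: eq_card => A; rewrite !inE subnn andbC; congr (_ && _).
by apply: eq_forallb => i; rewrite -(eqn_add2r (s i)) subnK ?(forallP sl).
Qed.

End FrobeniusCharacter.

(** * Irreducibility of the Frobenius class function *)

(** A value s_i is at most u + (s_i - u)_+; the positive parts (x - u)_+ have the same
    sum over all the s_i as over all the i, and they vanish at the i below u. *)
Lemma sum_perm_tail L (s : 'S_L) u :
  (\sum_(i < L | (u <= i)%N) s i <= \sum_(i < L | (u <= i)%N) i)%N.
Proof.
have le_tail : (\sum_(i < L | (u <= i)%N) s i <=
                \sum_(i < L | (u <= i)%N) u + \sum_(i < L) (s i - u))%N.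
  rewrite [X in (_ <= _ + X)%N](bigID (fun i : 'I_L => (u <= i)%N)) /= addnA -big_split /=.
  by apply: leq_trans (leq_addr _ _); apply: leq_sum => i _; lia.
apply: leq_trans le_tail _.
have -> : (\sum_(i < L) (s i - u) = \sum_(i < L) (i - u))%N.
  by rewrite [RHS](reindex_inj (@perm_inj _ s)).
rewrite [X in (_ + X <= _)%N](bigID (fun i : 'I_L => (u <= i)%N)) /= addnA -big_split /=.
rewrite [X in (_ + X <= _)%N]big1 ?addn0 => [|i]; last by lia.
by apply: leq_sum => i; lia.
Qed.

Lemma perm_tail_eq1 L (s : 'S_L) :
  (forall u, \sum_(i < L | (u <= i)%N) i <= \sum_(i < L | (u <= i)%N) s i)%N ->
  s = 1%g.
Proof.
move=> le_tail.
have inc_s : forall k : 'I_L, s k = k :> nat.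
  move=> k; have eq_tail u : (\sum_(i < L | (u <= i)%N) i = \sum_(i < L | (u <= i)%N) s i)%N.
    by apply/eqP; rewrite eqn_leq le_tail sum_perm_tail.
  have := eq_tail k; rewrite (bigD1 k) //= [in RHS](bigD1 k) //=.
  have tailE (F : 'I_L -> nat) :
      (\sum_(i < L | (k <= i)%N && (i != k)) F i = \sum_(i < L | (k.+1 <= i)%N) F i)%N.
    by apply: eq_bigl => i; rewrite -val_eqE /=; lia.
  by rewrite !tailE eq_tail => /addIn.
by apply/permP => k; apply: val_inj; rewrite perm1 [LHS]inc_s.
Qed.

Section FrobeniusIrreducible.

Variables (L n : nat) (l : 'I_L -> nat).
Hypothesis inc_l : increasing l.
Hypothesis sum_l : (\sum_i l i = n + \sum_(i < L) i)%N.

(** The content l - s of a nontrivial s dominates the shape strictly, so the Kostka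
    number vanishes. *)
Lemma frobenius_cf_dot_shifted (s : 'S_L) :
  '[frobenius_cf n l, shifted_words n l s] = (s == 1%g)%:R.
Proof.
rewrite /shifted_words; case: ifPn => [/forallP sl|/forallPn[i nsl]]; last first.
  rewrite cfdot0r; case: eqP => // s1; case/negP: nsl.
  by rewrite s1 perm1 increasing_ge.
pose b j := oapp (fun i : 'I_L => l i - s i)%N 0%N (insub j).
have bE (i : 'I_L) : b i = (l i - s i)%N by rewrite /b valK.
rewrite -(eq_cfWords _ bE) (@frobenius_cf_dot _ _ (\sum_i l i)%N) //; last 2 first.
- by rewrite sum_l leq_addr.
- by move=> i; rewrite (bigD1 i) // leq_addr.
rewrite kostka_dominated //; last 2 first.
- by move=> i; rewrite (bigD1 i) // leq_addr.
- move=> u _; rewrite -(leq_add2r (\sum_(i < L | (u <= i)%N) s i)) -!big_split /=.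
  rewrite [X in (_ <= X)%N](eq_bigr (fun i : 'I_L => (l i + i)%N)); last first.
    by move=> i _; rewrite bE -addnA subnK // addnC.
  by rewrite !big_split /= leq_add2l sum_perm_tail.
rewrite subnn rmorph_nat; congr (_%:R); congr nat_of_bool.
apply/forallP/eqP => [e|s1 i]; last by rewrite bE s1 perm1 subnKC // increasing_ge.
apply/permP => i; apply: val_inj; rewrite perm1; have := e i.
by rewrite ltn0 bE; have := sl i => /=; lia.
Qed.

(** Only the term s = 1 pairs nontrivially with the whole sum. *)
Lemma frobenius_cf_norm : '[frobenius_cf n l] = 1.
Proof.
rewrite {2}/frobenius_cf cfdot_sumr (bigD1 1%g) //= big1 => [|s s1]; last first.
  by rewrite cfdotZr frobenius_cf_dot_shifted (negPf s1) mulr0.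
by rewrite cfdotZr frobenius_cf_dot_shifted eqxx odd_perm1 expr0 rmorph1 mulr1 addr0.
Qed.

(** The common constituent of psi and of the term s = 1 occurs in no other term, so it
    occurs in the Frobenius class function, which is irreducible up to sign. *)
Lemma frobenius_cf_constt (psi : 'CF([set: 'S_n])) :
    psi \is a character ->
    '[shifted_words n l 1, psi] != 0 ->
    (forall s : 'S_L, s != 1%g -> '[shifted_words n l s, psi] = 0) ->
  exists i, [/\ i \in irr_constt (shifted_words n l 1), i \in irr_constt psi &
     exists e : bool, frobenius_cf n l = (-1) ^+ e *: 'chi_i].
Proof.
move=> psi_char psi1 psiD; have words_char := shifted_words_char n l.
have [i i1 i2] : exists2 i, i \in irr_constt (shifted_words n l 1) & i \in irr_constt psi.
  apply/exists_inP; apply: contraNT psi1 => /exists_inPn none.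
  rewrite cfdot_sum_irr big1 // => i _.
  have [/none/=|] := boolP (i \in irr_constt (shifted_words n l 1)).
    by rewrite irr_consttE negbK => /eqP->; rewrite conjC0 mulr0.
  by rewrite irr_consttE negbK => /eqP->; rewrite mul0r.
exists i; split=> //.
have [e [j fE]] := vchar_norm1P (frobenius_cf_vchar n l) frobenius_cf_norm.
exists e; suff -> : i = j by [].
have : '[frobenius_cf n l, 'chi_i] != 0.
  rewrite /frobenius_cf cfdot_suml (bigD1 1%g) //= big1 ?addr0 => [|s s1].
    by rewrite odd_perm1 scale1r -irr_consttE.
  rewrite cfdotZl; apply/eqP; rewrite mulf_eq0; apply/orP; right.
  apply: contraTT isT => is_s.
  have := constt_ortho_char (shifted_words_char n l s) psi_char is_s i2 (psiD s s1).
  by rewrite cfnorm_irr => /eqP; rewrite oner_eq0.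
rewrite fE cfdotZl cfdot_irr mulf_eq0 negb_or => /andP[_].
by case: (j =P i) => [->|_] //; rewrite eqxx.
Qed.

End FrobeniusIrreducible.

(** * The irreducible character of a partition *)

Lemma cfSignE n (G : {group 'S_n}) s :
  cfSign G s = (-1) ^+ odd_perm s *+ (s \in G).
Proof. by rewrite /cfSign cfunElock. Qed.

Fact sign_repr_subproof n (G : {group 'S_n}) :
  mx_repr G (fun s : 'S_n => ((-1) ^+ odd_perm s)%:M : 'M[algC]_1).
Proof.
split=> [|s t _ _]; first by rewrite odd_perm1.
by rewrite odd_permM signr_addb scalar_mxM.
Qed.

(** The representation that affords the sign, from which it is known to be a
    character. *)
Definition sign_repr n (G : {group 'S_n}) := MxRepresentation (sign_repr_subproof G).

Lemma cfSign_char n (G : {group 'S_n}) : cfSign G \is a character.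
Proof.
have -> : cfSign G = cfRepr (sign_repr G); last exact: cfRepr_char.
by apply/cfunP => s; rewrite cfSignE cfunE mxtrace_scalar mulr1n.
Qed.

Section ColumnSign.

Variables (n : nat) (T : finType) (col : 'I_n -> nat) (C : {group 'S_n}).
Hypothesis defC : forall y, (y \in C) = [forall i, col (y i) == col i].

Definition injective_on_columns (f : {ffun 'I_n -> T}) : bool :=
  [forall x, forall y, (col x == col y) && (f x == f y) ==> (x == y)].

(** If two entries of a column agree, multiplication by their transposition is
    a sign-reversing involution; otherwise only the identity fixes the word. *)
Lemma sum_sign_fixed (f : {ffun 'I_n -> T}) :
  \sum_(y in C | fixed_word y f) (-1) ^+ odd_perm y =
  (injective_on_columns f)%:R :> algC.
Proof.
have [inj_f|] := boolP (injective_on_columns f).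
  rewrite (big_pred1 1%g) => [|y]; first by rewrite odd_perm1.
  rewrite /= defC; apply/andP/eqP => [[/forallP cy /fixed_wordP fy]|->]; last first.
    by split; [apply/forallP|apply/fixed_wordP] => x; rewrite perm1.
  apply/permP => x; rewrite perm1; apply/eqP.
  by have /forallP/(_ (y x))/forallP/(_ x) := inj_f; rewrite cy fy eqxx.
case/forallPn=> x /forallPn[y]; rewrite negb_imply => /andP[/andP[/eqP cxy /eqP fxy] nxy].
set X := (LHS); have : X = - X.
  rewrite {1}/X (reindex_inj (mulgI (tperm x y))) /= -sumrN.
  have tC : tperm x y \in C.
    by rewrite defC; apply/forallP => z; case: tpermP => // ->; rewrite cxy.
  have tf : forall z, f (tperm x y z) = f z by move=> z; case: tpermP => // ->.
  apply: eq_big => [s|s _]; last by rewrite odd_mul_tperm nxy signr_addb mulN1r.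
  rewrite groupMl //; congr (_ && _); apply/fixed_wordP/fixed_wordP => fs z.
    by have := fs (tperm x y z); rewrite permM tpermK tf.
  by rewrite permM fs tf.
by move/eqP; rewrite -addr_eq0 -mulr2n mulrn_eq0 /= => /eqP.
Qed.

(** The column group acts freely on the words counted on the right, and its orbits are
    the column-strict fillings. *)
Lemma cfWords_dot_sign (a : T -> nat) :
  '[cfWords n a, 'Ind[[set: 'S_n]] (cfSign C)] =
  #|C|%:R^-1 * #|[set f : {ffun 'I_n -> T} | injective_on_columns f && has_content a f]|%:R.
Proof.
rewrite -cfdot_Res_l cfdotE; congr (_ * _).
transitivity (\sum_(y in C) \sum_(f : {ffun 'I_n -> T} | has_content a f && fixed_word y f)
   ((-1) ^+ odd_perm y : algC)).
  apply: eq_bigr => y Cy; rewrite cfResE ?subsetT // cfWordsE cfSignE Cy rmorph_sign.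
  rewrite mulr_natl sumr_const; congr (_ *+ _); apply: eq_card => f.
  by rewrite inE andbC.
under eq_bigr do rewrite big_mkcondr; rewrite exchange_big /= -sum1dep_card big_mkcondl /=.
rewrite natr_sum [LHS]big_mkcond [RHS]big_mkcond /=; apply: eq_bigr => f _.
by case: ifP => // _; rewrite -big_mkcondr sum_sign_fixed; case: injective_on_columns.
Qed.

End ColumnSign.

Section PartitionCharacter.

Variables (n : nat) (w : seq nat).
Hypothesis w_part : is_partition n w.

Local Notation L := (size w).

(** The rows are listed from the shortest one, so that beta-numbers increase. *)
Definition row_beta (i : 'I_L) : nat := (nth 0 w (rev_ord i) + i)%N.

Lemma sum_w : sumn w = n.
Proof. by case/and3P: w_part => _ _ /eqP. Qed.

Lemma part_nonincreasing r r' : (r <= r')%N -> (nth 0 w r' <= nth 0 w r)%N.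
Proof.
case/and3P: w_part => w_sorted _ _ le_rr'.
have [lt_r'L|le_Lr'] := ltnP r' L; last by rewrite nth_default.
have geq_trans : transitive geq by move=> x y z xy yz; apply: leq_trans yz xy.
exact: (sorted_leq_nth geq_trans leqnn 0%N w_sorted) (leq_ltn_trans le_rr' lt_r'L) lt_r'L le_rr'.
Qed.

Lemma row_beta_increasing : increasing row_beta.
Proof.
move=> i j ij; rewrite /row_beta.
have le_ji : (rev_ord j <= rev_ord i)%N by rewrite leq_sub2l // ltnS ltnW.
by rewrite -addnS leq_add // part_nonincreasing.
Qed.

Lemma sum_row_beta : (\sum_i row_beta i = n + \sum_(i < L) i)%N.
Proof.
rewrite big_split /= -sum_w sumnE (big_nth 0%N) big_mkord (reindex_inj rev_ord_inj) /=.
by congr addn; apply: eq_bigr => i _ /=; congr nth; have := ltn_ord i; lia.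
Qed.

Fact row_ord_subproof (x : 'I_n) : (reshape_index w x < L)%N.
Proof. by apply: reshape_indexP; rewrite sum_w. Qed.

(** The letter of a box is the index of its row, counted from the shortest row. *)
Definition row_word : {ffun 'I_n -> 'I_L} :=
  [ffun x => rev_ord (Ordinal (row_ord_subproof x))].

Lemma row_wordE x : row_word x = (L - (reshape_index w x).+1)%N :> nat.
Proof. by rewrite ffunE. Qed.

Lemma box_subproof r c : (c < nth 0 w r)%N -> (flatten_index w r c < n)%N.
Proof. by move=> /flatten_indexP; rewrite sum_w. Qed.

Lemma row_word_box r c (lt_c : (c < nth 0 w r)%N) :
  row_word (Ordinal (box_subproof lt_c)) = (L - r.+1)%N :> nat.
Proof. by rewrite row_wordE /= flatten_indexKl. Qed.

Lemma reshape_index_row_word (x : 'I_n) : reshape_index w x = (L - (row_word x).+1)%N.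
Proof. by rewrite row_wordE; have := row_ord_subproof x; lia. Qed.

Lemma content_row_word (i : 'I_L) : content row_word i = nth 0%N w (rev_ord i).
Proof.
rewrite /content -big_mkcond sum1_card /=.
rewrite -[RHS]card_ord.
pose h (c : 'I_(nth 0%N w (rev_ord i))) : 'I_n := Ordinal (box_subproof (ltn_ord c)).
have inj_h : injective h.
  move=> c c' /(congr1 val)/= e; apply: val_inj => /=.
  by rewrite -(flatten_indexKr (ltn_ord c)) e flatten_indexKr.
rewrite -[RHS](card_imset _ inj_h); apply: eq_card => x; rewrite [LHS]unfold_in.
apply/eqP/imsetP => [xi|[c _ ->]]; last first.
  by rewrite row_word_box /=; have := ltn_ord i; lia.
have rx : reshape_index w x = rev_ord i by rewrite reshape_index_row_word xi.
have lt_c : (reshape_offset w x < nth 0%N w (rev_ord i))%N.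
  by rewrite -rx; apply: reshape_offsetP; rewrite sum_w.
exists (Ordinal lt_c) => //; apply: val_inj => /=.
by rewrite -[LHS](reshape_indexK w x) rx.
Qed.

Lemma row_stabE y : (y \in @row_stab n w) = fixed_word y row_word.
Proof.
rewrite inE; apply: eq_forallb => x; rewrite -val_eqE /= !row_wordE.
by have := row_ord_subproof (y x); have := row_ord_subproof x; lia.
Qed.

Definition box_column (x : 'I_n) : nat := reshape_offset w x.

Lemma col_stabE y : (y \in @col_stab n w) = [forall x, box_column (y x) == box_column x].
Proof. by rewrite inE. Qed.

Lemma row_word_injective : injective_on_columns box_column row_word.
Proof.
apply/forallP => x; apply/forallP => y; apply/implyP => /andP[/eqP cxy /eqP rxy].
apply/eqP/val_inj => /=; rewrite -[LHS](reshape_indexK w x) -[RHS](reshape_indexK w y).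
by rewrite !reshape_index_row_word rxy; congr flatten_index.
Qed.

Lemma tail_content (f : {ffun 'I_n -> 'I_L}) u :
  (\sum_(i < L | (u <= i)%N) content f i = #|[set x | (u <= f x)%N]|)%N.
Proof.
rewrite exchange_big /= -sum1dep_card [RHS]big_mkcond; apply: eq_bigr => x _.
rewrite -big_mkcondr /=; case: ifP => ux.
  rewrite (big_pred1 (f x)) // => i /=; rewrite eq_sym.
  by case: eqP => [->|]; rewrite ?ux ?andbF.
by rewrite big1 // => i /andP[ui /eqP e]; move: ui; rewrite -e ux.
Qed.

(** In each column the letters that are at least u are distinct, and the row word uses
    all of them before any smaller one. *)
Lemma injective_on_columns_dominated (f : {ffun 'I_n -> 'I_L}) u :
    injective_on_columns box_column f ->
  (\sum_(i < L | (u <= i)%N) content f i <=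
   \sum_(i < L | (u <= i)%N) nth 0 w (rev_ord i))%N.
Proof.
move=> inj_f; rewrite tail_content -(eq_bigr _ (fun i _ => content_row_word i)) tail_content.
have lt_col (x : 'I_n) : (box_column x < n)%N.
  by apply: leq_ltn_trans (leq_subr _ _) (ltn_ord x).
have byCols (P : pred 'I_n) : (#|[set x | P x]| =
    \sum_(c < n) #|[set x | (box_column x == c) && P x]|)%N.
  rewrite -sum1dep_card (partition_big (fun x => Ordinal (lt_col x)) predT) //=.
  apply: eq_bigr => c _; rewrite -sum1dep_card; apply: eq_bigl => x.
  by rewrite andbC -val_eqE.
rewrite !byCols; apply: leq_sum => c _.
have [/existsP[x0 /andP[/eqP cx0 lt_x0u]]|/existsPn all_u] :=
  boolP [exists x, (box_column x == c) && (row_word x < u)%N]; last first.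
  apply: subset_leq_card; apply/subsetP => x; rewrite !inE => /andP[cx _].
  by have := all_u x; rewrite cx /= -leqNgt.
apply: (@leq_trans #|[set i : 'I_L | (u <= i)%N]|).
  have inj_fc : {in [set x | (box_column x == c) && (u <= f x)%N] &, injective f}.
    move=> x y; rewrite !inE => /andP[/eqP cx _] /andP[/eqP cy _] fxy.
    by have /forallP/(_ x)/forallP/(_ y) := inj_f; rewrite cx cy fxy !eqxx => /eqP.
  rewrite -(card_in_imset inj_fc); apply: subset_leq_card; apply/subsetP => i.
  by case/imsetP=> x; rewrite !inE => /andP[_ ux] ->.
apply: leq_trans (leq_imset_card row_word _); apply: subset_leq_card; apply/subsetP => i.
rewrite inE => ui.
have lt_c : (c < nth 0 w (rev_ord i))%N.
  have := part_nonincreasing (r := rev_ord i) (r' := reshape_index w x0).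
  rewrite reshape_index_row_word -cx0 /= => /(_ ltac:(lia)); apply: leq_trans.
  by rewrite -reshape_index_row_word; apply: reshape_offsetP; rewrite sum_w.
apply/imsetP; exists (Ordinal (box_subproof lt_c)).
  by rewrite inE row_word_box /box_column /= flatten_indexKr // eqxx /=; have := ltn_ord i; lia.
by apply: ord_inj; rewrite row_word_box /=; have := ltn_ord i; lia.
Qed.

(** A word injective on the columns has content dominated by the partition, whereas
    the content l - s of a nontrivial s is not: the character induced from the columns
    meets only the term s = 1, which is induced from the rows. *)
Lemma frobenius_cf_partition :
  exists i (e : bool),
    partition_Iirr w i /\ frobenius_cf n row_beta = (-1) ^+ e *: 'chi_i.
Proof.
have words1 : shifted_words n row_beta 1 = cfWords n (content row_word).
  rewrite /shifted_words; case: ifPn => [_|/forallPn[i]]; last first.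
    by rewrite perm1 /row_beta leq_addl.
  by apply: eq_cfWords => i; rewrite perm1 /row_beta addnK content_row_word.
have col_char := cfInd_char [set: 'S_n] (cfSign_char (@col_stab n w)).
have [||i [i1 i2 [e fE]]] :=
    frobenius_cf_constt row_beta_increasing sum_row_beta col_char.
- rewrite words1 (cfWords_dot_sign col_stabE) mulf_neq0 ?invr_eq0 ?neq0CG //.
  rewrite pnatr_eq0 cards_eq0; apply/set0Pn; exists row_word.
  by rewrite inE row_word_injective; apply/has_contentP.
- move=> s s1; rewrite /shifted_words; case: ifPn => [/forallP sl|_]; last exact: cfdot0l.
  rewrite (cfWords_dot_sign col_stabE) [X in _ * X%:R](_ : _ = 0%N) ?mulr0 //.
  apply/eqP; rewrite cards_eq0; apply/eqP/setP => f; rewrite !inE.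
  apply/negP => /andP[/injective_on_columns_dominated dom /has_contentP cf].
  case/eqP: s1; apply: perm_tail_eq1 => u; have := dom u.
  rewrite (eq_bigr _ (fun i _ => cf i)).
  rewrite -(leq_add2r (\sum_(i < L | (u <= i)%N) s i)) -big_split /=.
  rewrite (eq_bigr row_beta) => [|i _]; last by rewrite subnK.
  by rewrite big_split /= leq_add2l.
exists i, e; split=> //; rewrite /partition_Iirr i2 andbT.
by rewrite -(cfWords_Ind row_stabE) -words1.
Qed.

End PartitionCharacter.

(** * A cycle of length k *)

Section LongCycle.

Variables (k m : nat).

Definition long_cycle_fun (x : 'I_(k + m)) : 'I_(k + m) :=
  match split x with inl i => lshift m (ordS i) | inr j => rshift k j end.

Lemma long_cycle_fun_l i : long_cycle_fun (lshift m i) = lshift m (ordS i).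
Proof. by rewrite /long_cycle_fun (unsplitK (inl _ i)). Qed.

Lemma long_cycle_fun_r j : long_cycle_fun (rshift k j) = rshift k j.
Proof. by rewrite /long_cycle_fun (unsplitK (inr _ j)). Qed.

Lemma long_cycle_fun_inj : injective long_cycle_fun.
Proof.
move=> x y; case: (split_ordP x) => i ->; case: (split_ordP y) => j ->;
  rewrite ?(long_cycle_fun_l, long_cycle_fun_r) // => /eqP.
- by rewrite eq_lshift => /eqP/ordS_inj->.
- by rewrite eq_lrshift.
- by rewrite eq_rlshift.
Qed.

Definition long_cycle : 'S_(k + m) := perm long_cycle_fun_inj.

Lemma long_cycle_l i : long_cycle (lshift m i) = lshift m (ordS i).
Proof. by rewrite permE long_cycle_fun_l. Qed.

Lemma long_cycle_r j : long_cycle (rshift k j) = rshift k j.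
Proof. by rewrite permE long_cycle_fun_r. Qed.

Lemma long_cycleX_l e i :
  (long_cycle ^+ e)%g (lshift m i) = ((i + e) %% k)%N :> nat.
Proof.
elim: e => [|e IHe]; first by rewrite expg0 perm1 addn0 /= modn_small.
rewrite expgSr permM.
have [j Ej] : exists j, (long_cycle ^+ e)%g (lshift m i) = lshift m j.
  have lt_k : ((i + e) %% k < k)%N by rewrite ltn_mod (leq_ltn_trans _ (ltn_ord i)).
  by exists (Ordinal lt_k); apply: ord_inj; rewrite IHe.
rewrite Ej long_cycle_l /=; have <- : ((i + e) %% k)%N = j by rewrite -IHe Ej.
by rewrite -addn1 modnDml addn1 addnS.
Qed.

Lemma long_cycleX_r e j : (long_cycle ^+ e)%g (rshift k j) = rshift k j.
Proof.
elim: e => [|e IHe]; first by rewrite expg0 perm1.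
by rewrite expgSr permM IHe long_cycle_r.
Qed.

Hypothesis k_gt0 : (0 < k)%N.

Lemma porbit_long_cycle_l i :
  porbit long_cycle (lshift m i) = [set lshift m j | j in 'I_k].
Proof.
apply/setP => x; apply/porbitP/imsetP => [[e ->]|[j _ ->]].
  have lt_k : ((i + e) %% k < k)%N by rewrite ltn_mod.
  by exists (Ordinal lt_k) => //; apply: ord_inj; rewrite long_cycleX_l.
exists (j + (k - i))%N; apply: ord_inj; rewrite long_cycleX_l.
have -> : (i + (j + (k - i)) = j + k)%N by have := ltn_ord i; lia.
by rewrite modnDr modn_small.
Qed.

Lemma porbit_long_cycle_r j : porbit long_cycle (rshift k j) = [set rshift k j].
Proof.
apply/setP => x; rewrite inE; apply/porbitP/eqP => [[e ->]|->].
  by rewrite long_cycleX_r.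
by exists 0%N; rewrite expg0 perm1.
Qed.

Lemma long_cycle_type : has_cycle_type long_cycle (k :: nseq (k + m - k) 1%N).
Proof.
rewrite /has_cycle_type addKn.
pose orbs := [set lshift m i | i in 'I_k] :: [seq [set rshift k j] | j <- enum 'I_m].
have -> : k :: nseq m 1%N = [seq #|pred_of_set X| | X <- orbs].
  rewrite /= card_imset; last exact: lshift_inj.
  rewrite card_ord -map_comp; congr cons; rewrite (eq_map (g := fun=> 1%N)).
    by rewrite -[in LHS](size_enum_ord m); elim: (enum _) => //= j s ->.
  by move=> j /=; rewrite cards1.
apply: perm_map; apply: uniq_perm; first exact: enum_uniq.
  rewrite /orbs /= map_inj_uniq ?enum_uniq ?andbT; last first.
    by move=> j j' /set1_inj/rshift_inj.
  apply/mapP => -[j _ /setP/(_ (rshift k j))]; rewrite set11.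
  by move/imsetP => [i _ /eqP]; rewrite eq_rlshift.
move=> X; rewrite mem_enum inE; apply/imsetP/orP.
  case=> x _ ->; case: (split_ordP x) => i ->; [left|right].
    by rewrite porbit_long_cycle_l.
  by rewrite porbit_long_cycle_r; apply: map_f; rewrite mem_enum.
case=> [/eqP->|/mapP[j _ ->]].
  by exists (lshift m (Ordinal k_gt0)) => //; rewrite porbit_long_cycle_l.
by exists (rshift k j) => //; rewrite porbit_long_cycle_r.
Qed.

Lemma iter_ordS_const (T : Type) (f : 'I_k -> T) :
  (forall i, f (ordS i) = f i) -> forall i, f i = f (Ordinal k_gt0).
Proof.
move=> fS [i lt_ik]; elim: i lt_ik => [|i IHi] lt_ik; first by congr f; apply: ord_inj.
rewrite -(IHi (ltnW lt_ik)) -[RHS]fS; congr f; apply: ord_inj => /=.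
by rewrite modn_small.
Qed.

(** A fixed word is constant on the first k positions and arbitrary on the others. *)
Lemma card_fixed_long_cycle (T : finType) (P : (T -> nat) -> bool) :
    (forall a b, a =1 b -> P a = P b) ->
  #|[set f : {ffun 'I_(k + m) -> T} | fixed_word long_cycle f && P (content f)]| =
  (\sum_(c : T) #|[set g : {ffun 'I_m -> T} |
                    P (fun t => content g t + k * (c == t))%N]|)%N.
Proof.
move=> P_ext.
pose glue (p : T * {ffun 'I_m -> T}) : {ffun 'I_(k + m) -> T} :=
  [ffun x => match split x with inl _ => p.1 | inr j => p.2 j end].
have glue_l p i : glue p (lshift m i) = p.1.
  by rewrite ffunE (unsplitK (inl _ i)).
have glue_r p j : glue p (rshift k j) = p.2 j.
  by rewrite ffunE (unsplitK (inr _ j)).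
have glue_inj : injective glue.
  move=> [c g] [c' g'] e; congr pair.
    by have := congr1 (fun f : {ffun _ -> _} => f (lshift m (Ordinal k_gt0))) e; rewrite !glue_l.
  apply/ffunP => j.
  by have := congr1 (fun f : {ffun _ -> _} => f (rshift k j)) e; rewrite !glue_r.
have content_glue p t : content (glue p) t = (content p.2 t + k * (p.1 == t))%N.
  rewrite /content big_split_ord /= addnC; congr addn.
    by apply: eq_bigr => j _; rewrite glue_r.
  by under eq_bigr do rewrite glue_l; rewrite sum_nat_const card_ord.
transitivity #|[set p : T * {ffun 'I_m -> T} | P (content (glue p))]|.
  rewrite -(card_imset _ glue_inj); apply: eq_card => f; rewrite inE.
  apply/andP/imsetP => [[/fixed_wordP ff Pf]|[p]]; last first.
    rewrite inE => Pp ->; split=> //; apply/fixed_wordP => x.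
    by case: (split_ordP x) => i ->; rewrite ?long_cycle_l ?long_cycle_r ?glue_l ?glue_r.
  pose p : T * {ffun 'I_m -> T} :=
    (f (lshift m (Ordinal k_gt0)), [ffun j => f (rshift k j)]).
  have fp : f = glue p.
    apply/ffunP => x; case: (split_ordP x) => i ->; rewrite ?glue_l ?glue_r /= ?ffunE //.
    by apply: (iter_ordS_const (f := fun i => f (lshift m i))) => j; rewrite -long_cycle_l ff.
  by exists p; rewrite ?inE -?fp.
rewrite -sum1dep_card big_mkcond /=.
rewrite -(pair_bigA _ (fun c g => if P (content (glue (c, g))) then 1%N else 0%N)) /=.
apply: eq_bigr => c _; rewrite -sum1dep_card [RHS]big_mkcond; apply: eq_bigr => g _.
by congr (if _ then _ else _); apply: P_ext => t; rewrite content_glue.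
Qed.

End LongCycle.

(** * Frobenius' formula for a cycle *)

Lemma frobenius_cfE L n (l : 'I_L -> nat) (y : 'S_n) :
  frobenius_cf n l y =
  \sum_(s : 'S_L) (-1) ^+ s *
    #|[set f : {ffun 'I_n -> 'I_L} | fixed_word y f &&
        [forall i, content f i + s i == l i]%N]|%:R.
Proof.
rewrite /frobenius_cf sum_cfunE; apply: eq_bigr => s _; rewrite cfunE; congr (_ * _).
rewrite /shifted_words; case: ifPn => [/forallP sl|/forallPn[i nsl]].
  rewrite cfWordsE; congr (_%:R); apply: eq_card => f; rewrite !inE; congr (_ && _).
  by apply: eq_forallb => i; rewrite -[in RHS](subnK (sl i)) eqn_add2r.
rewrite cfunE [X in X%:R](_ : _ = 0%N) //; apply/eqP; rewrite cards_eq0.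
apply/eqP/setP => f; rewrite !inE; apply/negP => /andP[_ /forallP/(_ i)/eqP e].
by case/negP: nsl; rewrite -e leq_addl.
Qed.

Lemma frobenius_cf1 L n (l : 'I_L -> nat) :
  frobenius_cf n l 1%g = ratr (signed_words n l).
Proof.
rewrite frobenius_cfE rmorph_sum; apply: eq_bigr => s _.
rewrite rmorphM /= rmorph_sign rmorph_nat; congr (_ * _%:R); apply: eq_card => f.
rewrite !inE; have -> // : fixed_word 1%g f.
by apply/fixed_wordP => i; rewrite perm1.
Qed.

(** Removing k from one beta-number is the removal of a rim hook of length k. *)
Definition lower_at L k (l : 'I_L -> nat) (c i : 'I_L) : nat := (l i - k * (c == i))%N.

(** The Murnaghan-Nakayama rule, with the shapes of the right side not yet sorted. *)
Lemma frobenius_cf_long_cycle L k m (l : 'I_L -> nat) : (0 < k)%N ->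
  frobenius_cf (k + m) l (long_cycle k m) =
  ratr (\sum_(c | (k <= l c)%N) signed_words m (lower_at k l c)).
Proof.
move=> k_gt0; rewrite frobenius_cfE rmorph_sum.
transitivity (\sum_(s : 'S_L) \sum_(c | (k <= l c)%N) (-1) ^+ s *
   (#|[set f : {ffun 'I_m -> 'I_L} | [forall i, content f i + s i == lower_at k l c i]%N]|%:R : algC)).
  apply: eq_bigr => s _; rewrite -mulr_sumr; congr (_ * _).
  rewrite (@card_fixed_long_cycle k m k_gt0 _ (fun a => [forall i, a i + s i == l i]%N)); last first.
    by move=> a b ab; apply: eq_forallb => i; rewrite ab.
  rewrite natr_sum [RHS]big_mkcond; apply: eq_bigr => c _.
  case: ifPn => [le_k|]; last first.
    rewrite -ltnNge => lt_l; rewrite [X in X%:R](_ : _ = 0%N) //; apply/eqP.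
    rewrite cards_eq0; apply/eqP/setP => f; rewrite !inE; apply/negP => /forallP/(_ c).
    by rewrite eqxx muln1 => /eqP; lia.
  congr (_%:R); apply: eq_card => f; rewrite !inE; apply: eq_forallb => i.
  rewrite /lower_at addnAC; case: (c =P i) => [<-|_]; last by rewrite muln0 addn0 subn0.
  by rewrite muln1 -[in LHS](subnK le_k) eqn_add2r.
rewrite exchange_big; apply: eq_bigr => c _ /=; rewrite rmorph_sum; apply: eq_bigr => s _.
by rewrite rmorphM /= rmorph_sign rmorph_nat.
Qed.

(** The factors that involve the entry c are set apart, because lowering l_c changes
    only these. *)
Lemma vdm_split (R : comNzRingType) L (c : 'I_L) (x : 'I_L -> R) :
  vdm x = (\prod_(j < L | (c < j)%N) -1) * \prod_(j < L | j != c) (x c - x j) *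
     \prod_(i < L | i != c) \prod_(j < L | (i < j)%N && (j != c)) (x j - x i).
Proof.
have step (i : 'I_L) : i != c ->
    \prod_(j < L | (i < j)%N) (x j - x i) =
    (if (i < c)%N then x c - x i else 1) *
    \prod_(j < L | (i < j)%N && (j != c)) (x j - x i).
  move=> ic; case: ifPn => lt_ic; first by rewrite (bigD1 c).
  rewrite mul1r; apply: eq_bigl => j; case: (j =P c) => [->|]; last by rewrite andbT.
  by rewrite (negPf lt_ic).
rewrite /vdm (bigD1 c) //= (eq_bigr _ step) big_split /= !mulrA; congr (_ * _).
rewrite (eq_bigr (fun j => (-1) * (x c - x j))); last by move=> j _; rewrite mulN1r opprB.
rewrite big_split /= -mulrA; congr (_ * _).
rewrite [RHS](bigID (fun j : 'I_L => (c < j)%N)) /=; congr (_ * _).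
  by apply: eq_bigl => j; rewrite -val_eqE /=; lia.
rewrite -big_mkcondr; apply: eq_bigl => j; rewrite -val_eqE /=; lia.
Qed.

Definition frobenius_sum L k (l : 'I_L -> nat) : rat :=
  \sum_c (l c ^_ k)%:R *
     \prod_(j < L | j != c) (((l c)%:R - k%:R - (l j)%:R) / ((l c)%:R - (l j)%:R)).

(** Each lowering of a beta-number multiplies the dimension, which is a Vandermonde
    determinant over factorials, by a product of ratios of differences.  The terms
    with l_c < k, absent on the character side, vanish in the sum through the falling
    factorial. *)
Lemma frobenius_long_cycle L k m (l : 'I_L -> nat) : (0 < k)%N -> injective l ->
    (\sum_i l i = k + m + \sum_(i < L) i)%N ->
  [/\ frobenius_cf (k + m) l 1%g != 0 &
   ((k + m) ^_ k)%:R * frobenius_cf (k + m) l (long_cycle k m) /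
      frobenius_cf (k + m) l 1%g = ratr (frobenius_sum k l)].
Proof.
move=> k_gt0 inj_l sum_l; rewrite frobenius_cf1 frobenius_cf_long_cycle //.
set V := vdm (fun i => (l i)%:R : rat).
have V0 : V != 0.
  apply/prodf_neq0 => i _; apply/prodf_neq0 => j ij; rewrite subr_eq0 eqr_nat.
  by apply: contraTneq ij => /inj_l->; rewrite ltnn.
have fact0 a : (a`!)%:R != 0 :> rat by rewrite pnatr_eq0 -lt0n fact_gt0.
have P0 : \prod_i (l i)`!%:R != 0 :> rat by apply/prodf_neq0.
have dim := signed_wordsE sum_l; rewrite -/V in dim.
have dim0 : signed_words (k + m) l != 0.
  by apply: contraTneq (mulf_neq0 (fact0 (k + m)%N) V0) => d0; rewrite -dim d0 mulr0 eqxx.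
split; first by rewrite fmorph_eq0.
rewrite -(rmorph_nat (@ratr algC)) -rmorphM -fmorph_div; congr (ratr _).
apply: (canLR (mulfK dim0)); apply: (mulfI P0).
pose T c := (l c ^_ k)%:R *
  \prod_(j < L | j != c) (((l c)%:R - k%:R - (l j)%:R) / ((l c)%:R - (l j)%:R)) : rat.
have term c : (k <= l c)%N ->
    \prod_i (l i)`!%:R * signed_words m (lower_at k l c) = m`!%:R * V * T c.
  move=> le_k.
  have -> : \prod_i (l i)`!%:R =
      (l c ^_ k)%:R * \prod_i (lower_at k l c i)`!%:R :> rat.
    rewrite (bigD1 c) //= [in RHS](bigD1 c) //= mulrA -natrM.
    rewrite {1}/lower_at eqxx muln1 ffact_fact //; congr (_ * _).
    by apply: eq_bigr => i ic; rewrite /lower_at eq_sym (negPf ic) muln0 subn0.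
  rewrite -mulrA signed_wordsE; last first.
    apply: (@addnI k); rewrite addnA -sum_l (bigD1 c) //= [in RHS](bigD1 c) //=.
    rewrite {1}/lower_at eqxx muln1 addnA subnKC //; congr addn.
    by apply: eq_bigr => i ic; rewrite /lower_at eq_sym (negPf ic) muln0 subn0.
  rewrite /T mulrCA -mulrA; congr (_ * _); rewrite [RHS]mulrCA; congr (_ * _).
  have lower_c : lower_at k l c c = (l c - k)%N by rewrite /lower_at eqxx muln1.
  rewrite /V !(@vdm_split _ _ c) /= lower_c natrB // prodf_div.
  have D0 : \prod_(j < L | j != c) ((l c)%:R - (l j)%:R) != 0 :> rat.
    apply/prodf_neq0 => j jc; rewrite subr_eq0 eqr_nat.
    by apply: contra jc => /eqP/inj_l->.
  have lowerD i : i != c -> lower_at k l c i = l i.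
    by move=> ic; rewrite /lower_at eq_sym (negPf ic) muln0 subn0.
  have -> : \prod_(j < L | j != c) ((l c)%:R - k%:R - (lower_at k l c j)%:R) =
      \prod_(j < L | j != c) ((l c)%:R - k%:R - (l j)%:R) :> rat.
    by apply: eq_bigr => j jc; rewrite lowerD.
  have -> : \prod_(i < L | i != c) \prod_(j < L | (i < j)%N && (j != c))
        ((lower_at k l c j)%:R - (lower_at k l c i)%:R) =
      \prod_(i < L | i != c) \prod_(j < L | (i < j)%N && (j != c))
        ((l j)%:R - (l i)%:R) :> rat.
    by apply: eq_bigr => i ic; apply: eq_bigr => j /andP[_ jc]; rewrite !lowerD.
  by field.
have -> : \prod_i (l i)`!%:R * (((k + m) ^_ k)%:R *
    (\sum_(c | (k <= l c)%N) signed_words m (lower_at k l c))) =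
    ((k + m) ^_ k)%:R * \sum_c m`!%:R * V * T c.
  rewrite mulrCA; congr (_ * _); rewrite mulr_sumr [LHS]big_mkcond; apply: eq_bigr => c _.
  by case: ifPn => [/term//|]; rewrite -ltnNge => lt_l; rewrite /T ffact_small // mul0r mulr0.
rewrite -mulr_sumr [RHS]mulrCA dim -(@ffact_fact (k + m) k) ?leq_addr // addKn natrM.
rewrite /frobenius_sum -/T; ring.
Qed.

(** * Congruences of power series and formal flows *)

Section EqMod.

Variables (R : comNzRingType) (N : nat).
Implicit Types p q : {poly R}.

(** Power series are handled as polynomials modulo X^N. *)
Definition eqmodX p q : Prop := exists r : {poly R}, p = q + r * 'X^N.

Lemma eqmodX_refl p : eqmodX p p.
Proof. by exists 0; rewrite mul0r addr0. Qed.

Lemma eqmodX_sym p q : eqmodX p q -> eqmodX q p.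
Proof. by move=> [r ->]; exists (- r); rewrite mulNr addrK. Qed.

Lemma eqmodX_trans p q r : eqmodX p q -> eqmodX q r -> eqmodX p r.
Proof. by move=> [a ->] [b ->]; exists (a + b); ring. Qed.

Lemma eqmodXD p p' q q' : eqmodX p p' -> eqmodX q q' -> eqmodX (p + q) (p' + q').
Proof. by move=> [a ->] [b ->]; exists (a + b); ring. Qed.

Lemma eqmodXM p p' q q' : eqmodX p p' -> eqmodX q q' -> eqmodX (p * q) (p' * q').
Proof. by move=> [a ->] [b ->]; exists (a * q' + p' * b + a * b * 'X^N); ring. Qed.

Lemma eqmodXZ c p q : eqmodX p q -> eqmodX (c *: p) (c *: q).
Proof. by move=> [a ->]; exists (c *: a); rewrite scalerDr scalerAl. Qed.

Lemma eqmodX_sum I (s : seq I) (P : pred I) (F G : I -> {poly R}) :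
  (forall i, P i -> eqmodX (F i) (G i)) ->
  eqmodX (\sum_(i <- s | P i) F i) (\sum_(i <- s | P i) G i).
Proof.
move=> FG; elim/big_rec2: _ => [|i p q Pi pq]; first exact: eqmodX_refl.
by apply: eqmodXD pq; apply: FG.
Qed.

Lemma eqmodX_sum0 I (s : seq I) (P : pred I) (F : I -> {poly R}) :
  (forall i, P i -> eqmodX (F i) 0) -> eqmodX (\sum_(i <- s | P i) F i) 0.
Proof.
move=> F0; elim/big_rec: _ => [|i p Pi p0]; first exact: eqmodX_refl.
by rewrite -[X in eqmodX _ X]addr0; apply: eqmodXD p0; apply: F0.
Qed.

Lemma eqmodX_prod I (s : seq I) (P : pred I) (F G : I -> {poly R}) :
  (forall i, P i -> eqmodX (F i) (G i)) ->
  eqmodX (\prod_(i <- s | P i) F i) (\prod_(i <- s | P i) G i).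
Proof.
move=> FG; elim/big_rec2: _ => [|i p q Pi pq]; first exact: eqmodX_refl.
by apply: eqmodXM pq; apply: FG.
Qed.

Lemma eqmodX_coef p q i : eqmodX p q -> (i < N)%N -> p`_i = q`_i.
Proof. by move=> [r ->] lt_iN; rewrite coefD coefMXn lt_iN addr0. Qed.

Lemma coef_eqmodX p q : (forall i, (i < N)%N -> p`_i = q`_i) -> eqmodX p q.
Proof.
move=> pq; exists (drop_poly N p - drop_poly N q).
have ep := poly_take_drop N p; have eq := poly_take_drop N q.
have et : take_poly N p = take_poly N q.
  by apply/polyP => i; rewrite !coef_take_poly; case: ifP => // /pq.
rewrite et in ep; move: (drop_poly N p) (drop_poly N q) (take_poly N q) ep eq.
by move=> a b c <- <-; ring.
Qed.

Lemma eqmodX_inv p : p`_0 = 1 -> exists q, eqmodX (p * q) 1.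
Proof.
move=> p0; have [r pr] : exists r, 1 - p = r * 'X.
  exists (drop_poly 1 (1 - p)); rewrite -[LHS](poly_take_drop 1) expr1.
  rewrite [take_poly _ _](_ : _ = 0) ?add0r //; apply/polyP => -[|i].
    by rewrite coef_take_poly /= coefB coef1 p0 subrr coef0.
  by rewrite coef_take_poly coef0.
exists (\sum_(i < N) (1 - p) ^+ i); exists (- r ^+ N).
have := subrX1 (1 - p) N; rewrite {1}pr exprMn => e.
have -> : p * \sum_(i < N) (1 - p) ^+ i = - ((1 - p - 1) * \sum_(i < N) (1 - p) ^+ i) by ring.
by rewrite -e; ring.
Qed.

End EqMod.

Definition euler (R : comNzRingType) (p : {poly R}) : {poly R} := 'X * p^`().

Lemma coef_euler (R : comNzRingType) (p : {poly R}) n : (euler p)`_n = p`_n * n%:R.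
Proof. by rewrite /euler coefXM coef_deriv; case: n => [|n]; rewrite ?mulr0 // mulr_natr. Qed.

Section FormalFlow.

Variables (F : numFieldType) (N : nat) (C : {poly F}).
Implicit Types (f g : {poly F}) (a b t : F).

(** The derivation z C D, with D = z d/dz, conjugated by z^a; the exponent a is
    additive under products. *)
Definition flow_gen a f : {poly F} := 'X * C * (euler f + a *: f).

Lemma flow_genD a f g : flow_gen a (f + g) = flow_gen a f + flow_gen a g.
Proof. by rewrite /flow_gen /euler derivD scalerDr; ring. Qed.

Lemma flow_genM a b f g :
  flow_gen (a + b) (f * g) = flow_gen a f * g + f * flow_gen b g.
Proof.
by rewrite /flow_gen /euler derivM scalerDl -!mul_polyC; ring.
Qed.

Lemma flow_genZ a c f : flow_gen a (c *: f) = c *: flow_gen a f.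
Proof. by rewrite /flow_gen /euler derivZ -!mul_polyC; ring. Qed.

Lemma flow_gen_sum a I (s : seq I) (P : pred I) (G : I -> {poly F}) :
  flow_gen a (\sum_(i <- s | P i) G i) = \sum_(i <- s | P i) flow_gen a (G i).
Proof.
apply: (big_morph _ (flow_genD a)).
by rewrite /flow_gen /euler deriv0 scaler0 mulr0 addr0 mulr0.
Qed.

Lemma euler_Xn n : euler ('X^n : {poly F}) = n%:R *: 'X^n.
Proof.
case: n => [|n]; first by rewrite /euler derivXn mulr0n mulr0 scale0r.
by rewrite /euler derivXn mulrnAr -exprS scaler_nat.
Qed.

Lemma flow_gen_eqmodX a f g : eqmodX N f g -> eqmodX N (flow_gen a f) (flow_gen a g).
Proof.
move=> [r ->]; exists (flow_gen a r + r * (N%:R *: ('X * C))).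
rewrite flow_genD -[in LHS](addr0 a) flow_genM addr0; congr (_ + _).
by rewrite /flow_gen euler_Xn scale0r addr0 -!mul_polyC; ring.
Qed.

Definition flow_term t a f m : {poly F} :=
  (t ^+ m / m`!%:R) *: iter m (flow_gen a) f.

Lemma flow_term0 t a f : flow_term t a f 0 = f.
Proof. by rewrite /flow_term expr0 fact0 divr1 scale1r. Qed.

Lemma flow_termS t a f m :
  (m.+1)%:R *: flow_term t a f m.+1 = t *: flow_gen a (flow_term t a f m).
Proof.
rewrite /flow_term flow_genZ !scalerA; congr (_ *: _).
have f0 : m`!%:R != 0 :> F by rewrite pnatr_eq0 -lt0n fact_gt0.
have m0 : m.+1%:R != 0 :> F by rewrite pnatr_eq0.
by rewrite exprS factS natrM invfM mulrCA mulVKf // mulrA.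
Qed.

(** Leibniz' rule for the derivation, iterated m times and divided by m!. *)
Lemma flow_termM t a b f g m :
  flow_term t (a + b) (f * g) m =
  \sum_(i < m.+1) flow_term t a f i * flow_term t b g (m - i).
Proof.
elim: m => [|m IHm]; first by rewrite big_ord1 subnn !flow_term0.
have m0 : m.+1%:R != 0 :> F by rewrite pnatr_eq0.
apply: (scalerI m0); rewrite flow_termS IHm flow_gen_sum !scaler_sumr.
transitivity (\sum_(i < m.+2) (i%:R *: flow_term t a f i * flow_term t b g (m.+1 - i))
   + \sum_(i < m.+2) (flow_term t a f i * ((m.+1 - i)%:R *: flow_term t b g (m.+1 - i)))).
  rewrite [X in _ = X + _]big_ord_recl scale0r mul0r add0r.
  rewrite [X in _ = _ + X]big_ord_recr /= subnn scale0r mulr0 addr0 -big_split /=.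
  apply: eq_bigr => i _; rewrite flow_genM scalerDr.
  have bumpE : bump 0 i = i.+1 by [].
  have subSi : (m.+1 - i = (m - i).+1)%N by rewrite subSn // -ltnS.
  rewrite bumpE subSS subSi !flow_termS.
  by congr (_ + _); [exact: scalerAl | exact: scalerAr].
rewrite -big_split; apply: eq_bigr => i _ /=.
have le_im : (i <= m.+1)%N by rewrite -ltnS.
move: (flow_term t a f i) (flow_term t b g _) => x y.
by rewrite -scalerAl -scalerAr -scalerDl -natrD subnKC.
Qed.

Lemma flow_term_div t a f m : exists r : {poly F}, flow_term t a f m = r * 'X^m.
Proof.
elim: m => [|m [r rE]]; first by exists f; rewrite flow_term0 expr0 mulr1.
have m0 : m.+1%:R != 0 :> F by rewrite pnatr_eq0.
have genE : flow_gen a (r * 'X^m) = (C * (euler r + m%:R *: r + a *: r)) * 'X^(m.+1).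
  rewrite -[a in LHS]addr0 flow_genM /flow_gen euler_Xn scale0r addr0 exprS -!mul_polyC.
  by ring.
exists ((t / m.+1%:R) *: (C * (euler r + m%:R *: r + a *: r))).
by apply: (scalerI m0); rewrite flow_termS rE genE -scalerAl scalerA [m.+1%:R * _]mulrC divfK.
Qed.

(** The exponential of t z C D, conjugated by z^a: its m-th term is a multiple of z^m,
    so N terms are enough modulo z^N. *)
Definition flow t a f : {poly F} := \sum_(m < N) flow_term t a f m.

Lemma flow_horner t a f :
  flow t a f = (\poly_(m < N) flow_term t a f m).[1].
Proof. by rewrite horner_poly; apply: eq_bigr => m _; rewrite expr1n mulr1. Qed.

(** By Leibniz' rule the terms of the product of two exponential series are
    convolutions.  Evaluating polynomials in an auxiliary variable at 1 sums them; the
    terms of total degree at least N vanish modulo z^N. *)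
Lemma flowM t a b f g : eqmodX N (flow t (a + b) (f * g)) (flow t a f * flow t b g).
Proof.
set P := \poly_(m < N) flow_term t a f m; set Q := \poly_(m < N) flow_term t b g m.
have size_PQ : (size (P * Q)%R <= N + N)%N.
  apply: leq_trans (size_polyMleq _ _) _; apply: leq_trans (leq_pred _) _.
  by rewrite leq_add // size_poly.
rewrite !flow_horner -hornerM (horner_coef_wide _ size_PQ) big_split_ord /=.
rewrite horner_poly -[X in eqmodX N X _]addr0; apply: eqmodXD.
  rewrite [X in eqmodX N X _](_ : _ = \sum_(i < N) (P * Q)`_i * 1 ^+ i); first exact: eqmodX_refl.
  apply: eq_bigr => m _; rewrite flow_termM coefM; congr (_ * _); apply: eq_bigr => i _.
  have iN : (i < N)%N by apply: leq_ltn_trans (ltn_ord m); rewrite -ltnS.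
  have miN : (m - i < N)%N by apply: leq_ltn_trans (leq_subr _ _) (ltn_ord m).
  by rewrite !coef_poly iN miN.
apply/eqmodX_sym/eqmodX_sum0 => m _; rewrite expr1n mulr1 coefM.
apply: eqmodX_sum0 => i _; rewrite !coef_poly.
case: ifP => _; last by rewrite mul0r; apply: eqmodX_refl.
case: ifP => _; last by rewrite mulr0; apply: eqmodX_refl.
have [r ->] := flow_term_div t a f i; have [r' ->] := flow_term_div t b g (N + m - i).
exists (r * r' * 'X^m); have le_i : (i <= N + m)%N by rewrite -ltnS.
rewrite add0r mulrACA -exprD subnKC //.
by rewrite addnC exprD mulrA.
Qed.

Lemma iter_flow_gen_eqmodX a f g m :
  eqmodX N f g -> eqmodX N (iter m (flow_gen a) f) (iter m (flow_gen a) g).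
Proof. by move=> fg; elim: m => //= m; apply: flow_gen_eqmodX. Qed.

Lemma iter_flow_gen0 a m : iter m (flow_gen a) 0 = 0.
Proof. by elim: m => //= m ->; rewrite /flow_gen /euler deriv0 scaler0 mulr0 addr0 mulr0. Qed.

Lemma flow_term_eqmodX t a f g m :
  eqmodX N f g -> eqmodX N (flow_term t a f m) (flow_term t a g m).
Proof. by move=> fg; apply/eqmodXZ/iter_flow_gen_eqmodX. Qed.

Lemma flow_eqmodX t a f g : eqmodX N f g -> eqmodX N (flow t a f) (flow t a g).
Proof. by move=> fg; apply: eqmodX_sum => m _; apply: flow_term_eqmodX. Qed.

Hypothesis N_ge2 : (2 <= N)%N.

Lemma flow_one t : flow t 0 1 = 1.
Proof.
rewrite /flow; case: (N) N_ge2 => // n _; rewrite big_ord_recl flow_term0 big1 ?addr0 // => m _.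
rewrite /flow_term lift0 iterSr /flow_gen /euler -/(flow_gen 0) derivC mulr0 scale0r addr0 mulr0.
by rewrite iter_flow_gen0 scaler0.
Qed.

Variable v : {poly F}.
Hypothesis Cv : eqmodX N (C * (v - euler v)) 1.

(** Since C (v - D v) = 1, the operator z C (D - 1) sends v to - z, and it kills z. *)
Lemma flow_root t b : eqmodX N (flow t (-1) (v - b *: 'X)) (v - (b + t) *: 'X).
Proof.
have genX : flow_gen (-1) 'X = 0.
  by rewrite /flow_gen -['X]expr1 euler_Xn -scalerDl subrr scale0r mulr0.
have genv : eqmodX N (flow_gen (-1) (v - b *: 'X)) (- 'X).
  rewrite flow_genD -scaleNr flow_genZ genX scaler0 addr0.
  have -> : flow_gen (-1) v = (- 'X) * (C * (v - euler v)).
    by rewrite /flow_gen scaleN1r; ring.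
  rewrite -[X in eqmodX N _ X]mulr1; apply: eqmodXM Cv; exact: eqmodX_refl.
rewrite /flow -(big_mkord xpredT (flow_term t (-1) (v - b *: 'X))).
rewrite big_ltn ?(ltnW N_ge2) // big_ltn // flow_term0 addrA.
rewrite -[X in eqmodX _ _ X]addr0; apply: eqmodXD.
  rewrite scalerDl opprD addrA; apply: eqmodXD; first exact: eqmodX_refl.
  by rewrite /flow_term /= expr1 divr1 -[X in eqmodX _ _ X]scalerN; apply: eqmodXZ.
rewrite big_nat; apply: eqmodX_sum0 => -[|[|m]] // _.
rewrite /flow_term !iterSr -[X in eqmodX _ _ X](scaler0 _ (t ^+ m.+2 / (m.+2)`!%:R)).
apply: eqmodXZ; have gen2 : eqmodX N (flow_gen (-1) (flow_gen (-1) (v - b *: 'X))) 0.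
  apply: eqmodX_trans (flow_gen_eqmodX (-1) genv) _.
  by rewrite -scaleN1r flow_genZ genX scaler0; apply: eqmodX_refl.
by apply: eqmodX_trans (iter_flow_gen_eqmodX (-1) m gen2) _; rewrite iter_flow_gen0; apply: eqmodX_refl.
Qed.

Lemma flow_prod_roots t (s : seq F) :
  eqmodX N (flow t (- (size s)%:R) (\prod_(b <- s) (v - b *: 'X)))
           (\prod_(b <- s) (v - (b + t) *: 'X)).
Proof.
elim: s => [|b s IHs]; first by rewrite !big_nil oppr0 flow_one; apply: eqmodX_refl.
rewrite !big_cons /= -natr1 opprD addrC; apply: eqmodX_trans (flowM _ _ _ _ _) _.
by apply: eqmodXM IHs; apply: flow_root.
Qed.

Definition shifted_prod (s : seq F) t : {poly F} := \prod_(b <- s) (v - (b + t) *: 'X).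

Lemma flow_shifted_prod (s : seq F) t t' :
  eqmodX N (flow t (- (size s)%:R) (shifted_prod s t')) (shifted_prod s (t' + t)).
Proof.
have := flow_prod_roots t [seq b + t' | b <- s].
rewrite size_map !big_map /shifted_prod.
by under [X in eqmodX N _ X -> _]eq_bigr do rewrite -addrA.
Qed.

(** Both sides are the image under the flow of time t of the functional equation
    A_0 = v A_1, where A_t is [shifted_prod s t]. *)
Lemma shifted_prod_step (s : seq F) t :
    eqmodX N (shifted_prod s 0) (v * shifted_prod s 1) ->
  eqmodX N (flow t (-1) 1 * shifted_prod s t) ((v - t *: 'X) * shifted_prod s (1 + t)).
Proof.
move=> eq0; pose a := -1 - (size s)%:R : F.
apply: (@eqmodX_trans _ _ _ (flow t a (shifted_prod s 0))).
  apply: eqmodX_sym; rewrite -[shifted_prod s 0 in X in eqmodX N X _]mul1r.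
  apply: eqmodX_trans (flowM _ _ _ _ _) _; apply: eqmodXM; first exact: eqmodX_refl.
  by rewrite -[t in X in eqmodX N _ X]add0r; apply: flow_shifted_prod.
apply: eqmodX_trans (flow_eqmodX _ _ eq0) _; apply: eqmodX_trans (flowM _ _ _ _ _) _.
apply: eqmodXM; last exact: flow_shifted_prod.
by have := flow_root t 0; rewrite scale0r subr0 add0r.
Qed.

(** The equations for t = 0, ..., k - 1 telescope. *)
Lemma prod_flow_shifted_prod (s : seq F) k :
    eqmodX N (shifted_prod s 0) (v * shifted_prod s 1) ->
  eqmodX N ((\prod_(j < k) flow j%:R (-1) 1) * shifted_prod s 0)
           ((\prod_(j < k) (v - j%:R *: 'X)) * shifted_prod s k%:R).
Proof.
move=> eq0; elim: k => [|k IHk]; first by rewrite !big_ord0 !mul1r; apply: eqmodX_refl.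
rewrite !big_ord_recr /= mulrAC; apply: eqmodX_trans (eqmodXM IHk (eqmodX_refl _ _)) _.
rewrite -!mulrA; apply: eqmodXM; first exact: eqmodX_refl.
by rewrite mulrC -natr1 [_ + 1]addrC; apply: shifted_prod_step.
Qed.

End FormalFlow.

(** * Residues at infinity *)

Lemma size_index_ord n : size (index_enum 'I_n) = n.
Proof. by rewrite /index_enum -enumT size_enum_ord. Qed.

Section Residue.

Variables (F : numFieldType) (v : {poly F}).

(** The value z^d p(v / z) of a polynomial p of degree at most d at x = v/z. *)
Definition homogenize d (p : {poly F}) : {poly F} :=
  \sum_(i < d.+1) p`_i *: (v ^+ i * 'X^(d - i)).

Lemma homogenizeD d p q : homogenize d (p + q) = homogenize d p + homogenize d q.
Proof. by rewrite -big_split; apply: eq_bigr => i _; rewrite coefD scalerDl. Qed.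

Lemma homogenizeZ d c p : homogenize d (c *: p) = c *: homogenize d p.
Proof. by rewrite scaler_sumr; apply: eq_bigr => i _; rewrite coefZ scalerA. Qed.

Lemma homogenize_sum d I (r : seq I) (G : I -> {poly F}) :
  homogenize d (\sum_(i <- r) G i) = \sum_(i <- r) homogenize d (G i).
Proof.
apply: (big_morph _ (homogenizeD d)).
by apply: big1 => i _; rewrite coef0 scale0r.
Qed.

Lemma homogenize1 d : homogenize d 1 = 'X^d.
Proof.
rewrite /homogenize big_ord_recl coef1 scale1r mul1r subn0 big1 ?addr0 // => i _.
by rewrite coef1 scale0r.
Qed.

Lemma homogenizeMXsubC d (p : {poly F}) b : (size p <= d.+1)%N ->
  homogenize d.+1 (p * ('X - b%:P)) = homogenize d p * (v - b *: 'X).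
Proof.
move=> size_p; rewrite mulrBr [p * b%:P]mulrC mul_polyC -scaleNr homogenizeD homogenizeZ.
have -> : homogenize d.+1 (p * 'X) = \sum_(i < d.+1) p`_i *: (v ^+ i.+1 * 'X^(d - i)).
  by rewrite /homogenize big_ord_recl coefMX scale0r add0r; apply: eq_bigr => i _; rewrite coefMX.
have -> : homogenize d.+1 p = \sum_(i < d.+1) p`_i *: (v ^+ i * 'X^((d - i).+1)).
  rewrite /homogenize big_ord_recr /= [X in X *: _]nth_default // scale0r addr0.
  by apply: eq_bigr => i _; rewrite subSn // -ltnS.
rewrite mulrBr /homogenize !mulr_suml scaleNr scaler_sumr -!sumrB.
by apply: eq_bigr => i _; rewrite !exprS -!mul_polyC; ring.
Qed.

Lemma homogenizeM_prod I (r : seq I) (b : I -> F) (p : {poly F}) d : (size p <= d.+1)%N ->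
  homogenize (d + size r) (p * \prod_(i <- r) ('X - (b i)%:P)) =
  homogenize d p * \prod_(i <- r) (v - b i *: 'X).
Proof.
elim: r d p => [|i r IHr] d p size_p; first by rewrite !big_nil !mulr1 addn0.
rewrite !big_cons !mulrA -homogenizeMXsubC // -IHr /= ?addSnnS //.
apply: leq_trans (size_polyMleq _ _) _; rewrite size_XsubC addn2 /= ltnS.
exact: size_p.
Qed.

Lemma eulerXn (p : {poly F}) n : euler (p ^+ n.+1) = n.+1%:R *: (euler p * p ^+ n).
Proof. by rewrite /euler deriv_exp scaler_nat mulrnAr mulrA. Qed.

(** With x = v/z one has dx = - (v - D v) z^-2 dz, so this is a residue of x^n dx, the
    derivative of x^(n+1)/(n+1). *)
Lemma residue_pow n : ((v - euler v) * v ^+ n)`_(n.+1) = 0.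
Proof.
have n0 : n.+1%:R != 0 :> F by rewrite pnatr_eq0.
apply: (mulfI n0); rewrite mulr0 mulrBl -exprS coefB mulrBr.
have -> : n.+1%:R * (euler v * v ^+ n)`_(n.+1) = (euler (v ^+ n.+1))`_(n.+1).
  by rewrite eulerXn coefZ.
by rewrite coef_euler mulrC subrr.
Qed.

Lemma residue_homogenize k (p : {poly F}) : ((v - euler v) * homogenize k p)`_(k.+1) = 0.
Proof.
rewrite /homogenize mulr_sumr coef_sum big1 // => i _.
rewrite -scalerAr coefZ mulrA coefMXn.
have le_ik : (i <= k)%N by rewrite -ltnS.
case: ifP => _; first by rewrite mulr0.
by rewrite subSn ?leq_subr // subKn // residue_pow mulr0.
Qed.

Variables (L k : nat) (b : 'I_L -> F).
Hypothesis inj_b : injective b.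

Let q : {poly F} := \prod_i ('X - (b i)%:P).
Let P : {poly F} := \prod_(j < k) ('X - j%:R%:P) * \prod_i ('X - (b i + k%:R)%:P).

Let others c := [seq i <- index_enum 'I_L | i != c].

Lemma size_others c : (size (others c)).+1 = L.
Proof.
by rewrite size_filter -sum1_count sum1_card cardC1 card_ord prednK // (leq_ltn_trans _ (ltn_ord c)).
Qed.

Definition pole c : F := P.[b c] / \prod_(i < L | i != c) (b c - b i).

(** Partial fractions of P / q: the remainder of P is found by Lagrange interpolation
    at the roots of q. *)
Lemma partial_fractions : exists2 S : {poly F}, (size S <= k.+1)%N &
  P = S * q + \sum_c pole c *: \prod_(i <- others c) ('X - (b i)%:P).
Proof.
have size_q : size q = L.+1 by rewrite size_prod_XsubC size_index_ord.
have size_P : size P = (k + L).+1.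
  rewrite size_Mmonic ?monic_prod_XsubC ?monic_neq0 ?monic_prod_XsubC //.
  by rewrite !size_prod_XsubC addnS /= addSn !size_index_ord.
have q0 : q != 0 by rewrite monic_neq0 ?monic_prod_XsubC.
exists (P %/ q); first by rewrite size_divp // size_q size_P; lia.
rewrite [LHS](divp_eq P q); congr (_ + _).
set T := (X in _ = X); apply/eqP; rewrite -subr_eq0; apply/eqP.
have prod_others c d : (\prod_(i <- others d) ('X - (b i)%:P)).[b c] =
    (c == d)%:R * \prod_(i < L | i != c) (b c - b i).
  rewrite big_filter horner_prod; under eq_bigr do rewrite hornerXsubC.
  case: eqP => [<-|/eqP cd]; first by rewrite mul1r.
  by rewrite (bigD1 c) //= subrr !mul0r.
apply: (@roots_geq_poly_eq0 _ _ [seq b i | i <- enum 'I_L]).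
- apply/allP => x /mapP[c _ ->]; rewrite rootE hornerD hornerN subr_eq0; apply/eqP.
  have -> : (P %% q).[b c] = P.[b c].
    rewrite [in RHS](divp_eq P q) hornerD hornerM [q.[_]](_ : _ = 0) ?mulr0 ?add0r //.
    by rewrite horner_prod (bigD1 c) //= hornerXsubC subrr mul0r.
  have -> : T.[b c] = \sum_d pole d * ((c == d)%:R * \prod_(i < L | i != c) (b c - b i)).
    by rewrite horner_sum; apply: eq_bigr => d _; rewrite hornerZ prod_others.
  rewrite [RHS](bigD1 c) //= [X in _ = _ + X]big1 ?addr0 => [|d /negPf dc]; last by rewrite eq_sym dc mul0r mulr0.
  rewrite eqxx mul1r /pole divfK //.
  apply/prodf_neq0 => i ic; rewrite subr_eq0; apply: contra ic => /eqP/inj_b->.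
  exact: eqxx.
- by rewrite map_inj_uniq ?enum_uniq.
rewrite size_map size_enum_ord; apply: leq_trans (size_polyD _ _) _.
rewrite size_polyN geq_max; apply/andP; split; first by rewrite -ltnS -size_q ltn_modp.
apply: leq_trans (size_sum _ _ _) _; apply/bigmax_leqP => c _.
apply: leq_trans (size_scale_leq _ _) _.
by rewrite size_prod_XsubC size_others.
Qed.

(** The coefficient of x^-1 at infinity is the sum of the residues at the finite
    poles: the polynomial part S has no residue, and each 1/(x - b_c) has residue 1. *)
Lemma residue_sum (G : {poly F}) : v`_0 = 1 ->
    eqmodX k.+2 (G * \prod_i (v - b i *: 'X))
       (\prod_(j < k) (v - j%:R *: 'X) * \prod_i (v - (b i + k%:R) *: 'X)) ->
  ((v - euler v) * G)`_(k.+1) = \sum_c pole c.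
Proof.
move=> v0 eqG; set A0 := \prod_i (v - b i *: 'X) in eqG.
have [S size_S PE] := partial_fractions.
have homP : homogenize (k + L) P =
    \prod_(j < k) (v - j%:R *: 'X) * \prod_i (v - (b i + k%:R) *: 'X).
  have := @homogenizeM_prod _ (index_enum 'I_L) (fun i => b i + k%:R) (\prod_(j < k) ('X - j%:R%:P)) k.
  rewrite size_prod_XsubC !size_index_ord => -> //; congr (_ * _).
  have := @homogenizeM_prod _ (index_enum 'I_k) (fun i => (i : nat)%:R) 1 0.
  rewrite size_poly1 mul1r add0n size_index_ord => -> //.
  by rewrite homogenize1 expr0 mul1r.
have A0_0 : A0`_0 = 1.
  rewrite -horner_coef0 horner_prod big1 // => i _.
  by rewrite hornerD hornerN hornerZ hornerX mulr0 subr0 horner_coef0.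
have [B AB] := eqmodX_inv k.+2 A0_0.
have homS : homogenize (k + L) (S * q) = homogenize k S * A0.
  have := @homogenizeM_prod _ (index_enum 'I_L) b S k.
  by rewrite size_index_ord => ->.
pose Y := \sum_c pole c *: \prod_(i <- others c) (v - b i *: 'X).
have homT : homogenize (k + L) (\sum_c pole c *: \prod_(i <- others c) ('X - (b i)%:P)) = 'X^(k.+1) * Y.
  rewrite homogenize_sum mulr_sumr; apply: eq_bigr => c _.
  rewrite homogenizeZ -scalerAr; congr (_ *: _).
  have := @homogenizeM_prod _ (others c) b 1 k.+1.
  rewrite size_poly1 mul1r homogenize1 => <- //.
  by congr homogenize; rewrite addSnnS size_others.
rewrite -homP PE homogenizeD homS homT in eqG.
have {}eqG : eqmodX k.+2 G (homogenize k S + 'X^(k.+1) * (Y * B)).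
  apply: (@eqmodX_trans _ _ _ (G * A0 * B)).
    rewrite -[X in eqmodX _ X _]mulr1 -mulrA; apply: eqmodXM (eqmodX_refl _ _) _.
    exact: eqmodX_sym.
  apply: eqmodX_trans (eqmodXM eqG (eqmodX_refl _ B)) _.
  rewrite mulrDl -!mulrA; apply: eqmodXD (eqmodX_refl _ _).
  by rewrite -[X in eqmodX _ _ X]mulr1; apply: eqmodXM AB; apply: eqmodX_refl.
(* The poles contribute to the order z^(k+1) only through the constant terms. *)
rewrite (eqmodX_coef (eqmodXM (eqmodX_refl _ _) eqG)) // mulrDr coefD residue_homogenize add0r.
rewrite mulrCA coefXnM ltnn subnn !coef0M coefB coef_euler v0 mulr0 subr0 mul1r.
have B0 : B`_0 = 1 by have := eqmodX_coef AB (ltn0Sn _); rewrite coef0M A0_0 mul1r coef1.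
rewrite B0 mulr1 coef_sum; apply: eq_bigr => c _; rewrite coefZ.
rewrite -horner_coef0 horner_prod big1 ?mulr1 // => i _.
by rewrite hornerD hornerN hornerZ hornerX mulr0 subr0 horner_coef0.
Qed.

End Residue.

(** The factor x - b_c - k of the numerator at x = b_c gives - k, and the factors
    x - j give the falling factorial of l_c. *)
Lemma pole_frobenius L k (l : 'I_L -> nat) (c : 'I_L) :
  pole k (fun i => (l i)%:R) c =
  - k%:R * ((l c ^_ k)%:R *
     \prod_(j < L | j != c) (((l c)%:R - k%:R - (l j)%:R) / ((l c)%:R - (l j)%:R))) :> rat.
Proof.
rewrite /pole hornerM -/(ffact_poly rat k) horner_ffact_poly horner_prod (bigD1 c) //=.
rewrite hornerXsubC prodf_div opprD addNKr -!mulrA mulrCA; congr (_ * (_ * (_ / _))).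
by apply: eq_bigr => i _; rewrite hornerXsubC; ring.
Qed.

(** * Free cumulants and beta-numbers *)

Definition cumulant_series (A : comNzRingType) (R : nat -> A) N : {poly A} :=
  1 + \sum_(1 <= i < N.+1) R i *: 'X^i.

Lemma eqmodX_cancel (A : comNzRingType) N (p q r : {poly A}) : r`_0 = 1 ->
  eqmodX N (p * r) (q * r) -> eqmodX N p q.
Proof.
move=> r0 eq_pq; have [r' rr'] := eqmodX_inv N r0.
have cancel s : eqmodX N s (s * r * r').
  rewrite -[X in eqmodX _ X _]mulr1 -mulrA; apply: eqmodXM; first exact: eqmodX_refl.
  exact: eqmodX_sym.
apply: eqmodX_trans (cancel p) _; apply: eqmodX_trans (eqmodX_sym (cancel q)).
by apply: eqmodXM eq_pq _; apply: eqmodX_refl.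
Qed.

Section PartitionCumulants.

Variables (n : nat) (w : seq nat) (R : nat -> rat).
Hypothesis w_part : is_partition n w.

(** Subtracting L turns l_i into the content of the last box of its row, and l_i + 1
    into the content of the place after it; the factor v is the first place of the row
    after the last. *)
Lemma prod_beta_contents N (u := cumulant_series R N) (v := u + (size w)%:R *: 'X)
    (s := [seq (row_beta i)%:R | i : 'I_(size w)]) :
  shifted_prod v s 0 =
    \prod_(r < size w) (u - ((nth 0%N w r)%:Z - 1 - r%:Z)%:~R *: 'X) /\
  v * shifted_prod v s 1 =
    \prod_(r < (size w).+1) (u - ((nth 0%N w r)%:Z - r%:Z)%:~R *: 'X).
Proof.
have sE t : shifted_prod v s t = \prod_(i < size w) (v - ((row_beta i)%:R + t) *: 'X).
  by rewrite /shifted_prod big_image.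
have rowE (i : 'I_(size w)) :
    ((nth 0%N w (size w - i.+1))%:Z - (size w - i.+1)%:Z)%:~R = (row_beta i)%:R + 1 - (size w)%:R :> rat.
  have -> : (nth 0%N w (size w - i.+1))%:Z - (size w - i.+1)%:Z = (row_beta i)%:Z + 1 - (size w)%:Z.
    by rewrite /row_beta /=; have := ltn_ord i; lia.
  by rewrite rmorphB rmorphD.
have rowE' (i : 'I_(size w)) :
    ((nth 0%N w (size w - i.+1))%:Z - 1 - (size w - i.+1)%:Z)%:~R = (row_beta i)%:R - (size w)%:R :> rat.
  have -> : (nth 0%N w (size w - i.+1))%:Z - 1 - (size w - i.+1)%:Z = (row_beta i)%:Z - (size w)%:Z.
    by rewrite /row_beta /=; have := ltn_ord i; lia.
  by rewrite rmorphB.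
rewrite !sE; split.
  rewrite [RHS](reindex_inj rev_ord_inj) /=.
  apply: eq_bigr => i _; rewrite rowE' /v -!mul_polyC !rmorphB !rmorphD rmorph0 /=.
  by ring.
rewrite [RHS]big_ord_recr /= nth_default // mulrC [in RHS](reindex_inj rev_ord_inj) /=.
congr (_ * _); last by rewrite /v sub0r rmorphN scaleNr opprK.
apply: eq_bigr => i _; rewrite rowE /v -!mul_polyC !rmorphB !rmorphD rmorph1 /=.
by ring.
Qed.

(** A row that ends level with the next one contributes the same content to both
    sides, so that only the corners remain. *)
Lemma free_cumulants_beta (s := [seq (row_beta i)%:R | i : 'I_(size w)]) :
    (forall N (v := cumulant_series R N + (size w)%:R *: 'X),
       eqmodX N.+1 (shifted_prod v s 0) (v * shifted_prod v s 1)) ->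
  free_cumulants w R.
Proof.
move=> eq_v N; apply: (@eqmodX_coef _ N.+1) => //; have [e0 e1] := prod_beta_contents N.
have := eq_v N; cbv zeta; rewrite /s e0 e1 -/(cumulant_series R N).
set u := cumulant_series R N; pose f (z : int) := u - z%:~R *: 'X.
pose corner r := (nth 0%N w r.+1 < nth 0%N w r)%N.
pose flat := \prod_(r < size w | ~~ corner r) f ((nth 0%N w r)%:Z - 1 - r%:Z).
have big_iota m (P : pred nat) (F : nat -> {poly rat}) :
    \prod_(r <- iota 0 m | P r) F r = \prod_(r < m | P r) F r.
  by rewrite -(big_mkord P) /index_iota subn0.
have -> : \prod_(r < size w) f ((nth 0%N w r)%:Z - 1 - r%:Z) =
    \prod_(y <- removable_contents w) f y * flat.
  by rewrite big_map big_filter big_iota (bigID (fun r : 'I_ _ => corner r)).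
have -> : \prod_(r < (size w).+1) f ((nth 0%N w r)%:Z - r%:Z) =
    \prod_(x <- addable_contents w) f x * flat.
  rewrite big_ord_recl big_map big_filter /= big_cons /= (iotaDl 1 0) big_map big_iota -mulrA.
  congr (_ * _); rewrite (bigID (fun r : 'I_ _ => corner r)) /=; congr (_ * _).
  apply: eq_bigr => r; rewrite /corner -leqNgt => le_r.
  have -> : nth 0%N w (bump 0 r) = nth 0%N w r.
    by apply/eqP; rewrite eqn_leq [(nth 0%N w r <= _)%N]le_r (part_nonincreasing w_part).
  by rewrite /f /bump; congr (_ - _%:~R *: _); lia.
apply: eqmodX_cancel; rewrite -horner_coef0 horner_prod big1 // => i _.
rewrite hornerD hornerN hornerZ hornerX mulr0 subr0 horner_coef0 /u /cumulant_series coefD coef1.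
rewrite coef_sum big_nat big1 ?addr0 // => j /andP[j0 _].
by rewrite coefZ coefXn; case: j j0 => // j _; rewrite mulr0.
Qed.

End PartitionCumulants.

(** * The Kerov series *)

Section KerovSeries.

Variables (A : comNzRingType) (iota : rat -> A).

(** The sum of the (i - 1) R_i z^i: the series 1 - 1/C. *)
Definition cumulant_poly k (R : nat -> A) : {poly A} :=
  \sum_(i < k) (i.+1%:R * R i.+2) *: 'X^(i.+2).

(** A truncation of 1/(1 - B). *)
Definition geometric N (B : {poly A}) : {poly A} := \sum_(s < N) B ^+ s.

(** The series P_m = C (D + m - 1) ... (D + 1) C D C, in which the power of z that the
    flow produces is factored out. *)
Fixpoint ladder (C : {poly A}) m : {poly A} :=
  if m is m'.+1 then C * (euler (ladder C m') + m'%:R * ladder C m') else C.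

Definition flow_coef (j m : nat) : rat := j%:R ^+ m.+1 / (m.+1)`!%:R.

(** The series g_j, the image of 1/z under the flow of time j, times z; the map iota
    embeds the rational coefficients in the ring of the cumulants. *)
Definition flow_series N C j : {poly A} :=
  1 - \sum_(m < N) iota (flow_coef j m) *: ('X^(m.+1) * ladder C m).

(** The formula of Okounkov, Biane and Stanley, - 1/k [x^-1] prod_j G(x - j), in the
    variable z = 1/G(x): then G(x - j) = g_j / z and dx = - dz / (C z^2). *)
Definition kerov_series k (R : nat -> A) : A :=
  iota (- k%:R^-1) *
  ((1 - cumulant_poly k R) *
   \prod_(j < k) flow_series k.+1 (geometric k.+2 (cumulant_poly k R)) j)`_k.+1.

Lemma geometricP N B : (exists r : {poly A}, B = r * 'X) ->
  eqmodX N ((1 - B) * geometric N B) 1.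
Proof.
case=> r BE; exists (- r ^+ N).
have := subrX1 B N; rewrite {1}BE exprMn => e.
have -> : (1 - B) * geometric N B = - ((B - 1) * \sum_(i < N) B ^+ i) by rewrite /geometric; ring.
by rewrite -e; ring.
Qed.

Lemma cumulant_poly_divX k R : exists r : {poly A}, cumulant_poly k R = r * 'X.
Proof.
exists (\sum_(i < k) (i.+1%:R * R i.+2) *: 'X^(i.+1)); rewrite mulr_suml.
by apply: eq_bigr => i _; rewrite -scalerAl -exprSr.
Qed.

End KerovSeries.

Section Morphism.

Variables (A A' : comNzRingType) (iota : rat -> A) (iota' : rat -> A').
Variable f : {rmorphism A -> A'}.
Hypothesis f_iota : forall c, f (iota c) = iota' c.

Lemma euler_map (p : {poly A}) : map_poly f (euler p) = euler (map_poly f p).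
Proof. by rewrite /euler rmorphM /= map_polyX deriv_map. Qed.

Lemma ladder_map C m : map_poly f (ladder C m) = ladder (map_poly f C) m.
Proof.
elim: m => //= m IHm; rewrite rmorphM rmorphD rmorphM /= euler_map IHm.
by rewrite rmorph_nat.
Qed.

Lemma flow_series_map N C j :
  map_poly f (flow_series iota N C j) = flow_series iota' N (map_poly f C) j.
Proof.
rewrite rmorphB rmorph1 rmorph_sum; congr (_ - _); apply: eq_bigr => m _ /=.
by rewrite map_polyZ f_iota rmorphM /= map_polyXn ladder_map.
Qed.

Lemma cumulant_poly_map k R :
  map_poly f (cumulant_poly k R) = cumulant_poly k (fun i => f (R i)).
Proof.
rewrite rmorph_sum; apply: eq_bigr => i _ /=.
by rewrite map_polyZ map_polyXn rmorphM rmorph_nat.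
Qed.

Lemma geometric_map N B : map_poly f (geometric N B) = geometric N (map_poly f B).
Proof. by rewrite rmorph_sum; apply: eq_bigr => i _; rewrite /= rmorphXn. Qed.

Lemma kerov_series_map k R :
  f (kerov_series iota k R) = kerov_series iota' k (fun i => f (R i)).
Proof.
rewrite /kerov_series rmorphM f_iota; congr (_ * _); rewrite -coef_map.
rewrite rmorphM rmorphB rmorph1 /= cumulant_poly_map rmorph_prod.
apply: (congr1 (fun p => nth 0 (polyseq ((1 - cumulant_poly k (fun i => f (R i))) * p)) k.+1)).
apply: eq_bigr => j _ /=.
by rewrite flow_series_map geometric_map cumulant_poly_map.
Qed.

End Morphism.

(** Moving a power of z through z C (D - 1) turns D - 1 into D + m. *)
Lemma flow_term_ladder (F : numFieldType) (C : {poly F}) t m :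
  flow_term C t (-1) 1 m.+1 =
  - ((t ^+ m.+1 / (m.+1)`!%:R) *: ('X^(m.+1) * ladder C m)).
Proof.
rewrite /flow_term -scalerN; congr (_ *: _); elim: m => [|m IHm].
  by rewrite /= /flow_gen /euler derivC mulr0 add0r scaleN1r expr1; ring.
rewrite iterS IHm -scaleN1r flow_genZ !scaleN1r; congr (- _).
rewrite /flow_gen /euler derivM derivXn /= exprS -mulr_natl -!scaler_nat -!mul_polyC.
rewrite rmorphN rmorph1 ?rmorph_nat ?exprS /euler -(natr1 m).
by ring.
Qed.

Lemma flow_flow_series (F : numFieldType) (iota : rat -> F) N (C : {poly F}) j :
  (forall m, iota (flow_coef j m) = j%:R ^+ m.+1 / (m.+1)`!%:R) ->
  flow N.+1 C j%:R (-1) 1 = flow_series iota N C j.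
Proof.
move=> iotaE; rewrite /flow /flow_series big_ord_recl flow_term0 -sumrN; congr (_ + _).
apply: eq_bigr => m _; rewrite lift0 flow_term_ladder iotaE.
by [].
Qed.

Lemma cumulant_seriesE (A : comNzRingType) (R : nat -> A) k :
  cumulant_series R k.+1 = 1 + R 1%N *: 'X + \sum_(i < k) R i.+2 *: 'X^(i.+2).
Proof.
rewrite /cumulant_series big_ltn // expr1 -addrA; congr (_ + (_ + _)).
by rewrite !big_add1 /= big_mkord.
Qed.

Lemma sub_euler_cumulants (A : comNzRingType) (R : nat -> A) k (c : A)
    (v := cumulant_series R k.+1 + c *: 'X) :
  v - euler v = 1 - cumulant_poly k R.
Proof.
have eulerD (p q : {poly A}) : euler (p + q) = euler p + euler q.
  by rewrite /euler derivD mulrDr.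
have eulerZ a (p : {poly A}) : euler (a *: p) = a *: euler p.
  by rewrite /euler derivZ scalerAr.
have eulerX n : euler ('X^(n.+1) : {poly A}) = n.+1%:R *: 'X^(n.+1).
  by rewrite /euler derivXn mulrnAr -exprS scaler_nat.
have euler_sum : euler (\sum_(i < k) R i.+2 *: 'X^(i.+2)) =
    \sum_(i < k) (i.+2%:R * R i.+2) *: 'X^(i.+2).
  rewrite (big_morph _ eulerD (_ : euler 0 = 0)) ?/euler ?deriv0 ?mulr0 //.
  apply: eq_bigr => i _; rewrite -/(euler _) eulerZ eulerX scalerA.
  by rewrite mulrC.
have euler1 : euler (1 : {poly A}) = 0 by rewrite /euler derivC mulr0.
rewrite /v cumulant_seriesE !eulerD !eulerZ euler_sum euler1 -['X]expr1 eulerX !scale1r expr1 add0r.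
have -> : \sum_(i < k) (i.+2%:R * R i.+2) *: 'X^(i.+2) =
   \sum_(i < k) R i.+2 *: 'X^(i.+2) + cumulant_poly k R.
  rewrite -big_split; apply: eq_bigr => i _ /=.
  by rewrite -scalerDl -[X in X + _]mul1r -mulrDl -natr1 addrC.
by ring.
Qed.

(** Frobenius' sum is a sum of residues; its value at infinity only depends on the
    free cumulants. *)
Lemma frobenius_sum_cumulants L k (l : 'I_L -> nat) (R : nat -> rat)
    (v := cumulant_series R k.+1 + L%:R *: 'X) (s := [seq (l i)%:R | i : 'I_L]) :
    (0 < k)%N -> injective l ->
    eqmodX k.+2 (shifted_prod v s 0) (v * shifted_prod v s 1) ->
  frobenius_sum k l = kerov_series id k R.
Proof.
move=> k_gt0 inj_l eq_v.
have k0 : k%:R != 0 :> rat by rewrite pnatr_eq0 -lt0n.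
set C := geometric k.+2 (cumulant_poly k R).
have Cv : eqmodX k.+2 (C * (v - euler v)) 1.
  by rewrite sub_euler_cumulants mulrC; apply/geometricP/cumulant_poly_divX.
have inj_b : injective (fun i => (l i)%:R : rat).
  by move=> i j /eqP; rewrite eqr_nat => /eqP/inj_l.
have v0 : v`_0 = 1.
  rewrite /v cumulant_seriesE !coefD coef1 !coefZ coefX !mulr0 !addr0 coef_sum big1 ?addr0 // => i _.
  by rewrite coefZ coefXn mulr0.
have sE t : shifted_prod v s t = \prod_(i < L) (v - ((l i)%:R + t) *: 'X).
  by rewrite /shifted_prod big_image.
have := prod_flow_shifted_prod (isT : 2 <= k.+2)%N Cv k eq_v.
rewrite !sE; under [X in eqmodX _ (_ * X) _]eq_bigr do rewrite addr0.
move=> eqG; have resE := residue_sum inj_b v0 eqG; rewrite sub_euler_cumulants in resE.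
have -> : kerov_series id k R = - k%:R^-1 * \sum_c pole k (fun i => (l i)%:R) c.
  rewrite -resE /kerov_series -/C; congr (_ * _).
  rewrite [in RHS](eq_bigr (fun j : 'I_k => flow_series id k.+1 C j)) // => j _.
  exact: flow_flow_series.
by rewrite (eq_bigr _ (fun c _ => pole_frobenius k l c)) -mulr_sumr mulrA mulrNN mulVf // mul1r.
Qed.

(** * Free cumulants of arbitrary beta-numbers *)

Section UniversalCumulants.

Variables (A : comNzRingType) (L : nat) (b : 'I_L -> A).
Implicit Types v : {poly A}.

Definition root_prod v (t : A) : {poly A} := \prod_(i < L) (v - (b i + t) *: 'X).

(** The free cumulants are determined by defect (R(z) + L z) = 0; here the beta-numbers
    are arbitrary elements of a ring. *)
Definition defect v : {poly A} := root_prod v 0 - v * root_prod v 1.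

Lemma defect_eqmodX N v v' : eqmodX N v v' -> eqmodX N (defect v) (defect v').
Proof.
move=> vv'; have prodE t : eqmodX N (root_prod v t) (root_prod v' t).
  by apply: eqmodX_prod => i _; apply: eqmodXD vv' _; apply: eqmodX_refl.
apply: eqmodXD; first exact: prodE.
by rewrite -!mulNr; apply: eqmodXM (prodE 1); case: vv' => r ->; exists (- r); ring.
Qed.

Lemma eqmodX_mulXn N (q : {poly A}) (c : A) :
  q`_0 = 1 -> eqmodX N.+1 (c *: 'X^N * q) (c *: 'X^N).
Proof.
move=> q0; apply: coef_eqmodX => n; rewrite ltnS => le_nN.
rewrite -scalerAl !coefZ coefXnM coefXn; case: ltngtP le_nN => // -> _.
by rewrite subnn q0.
Qed.

Lemma root_prod0 v t : v`_0 = 1 -> (root_prod v t)`_0 = 1.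
Proof.
move=> v0; rewrite -horner_coef0 horner_prod big1 // => i _.
by rewrite hornerD hornerN hornerZ hornerX mulr0 subr0 horner_coef0.
Qed.

Lemma root_prodD N v t (c : A) : (0 < N)%N -> v`_0 = 1 ->
  eqmodX N.+1 (root_prod (v + c *: 'X^N) t) (root_prod v t + (L%:R * c) *: 'X^N).
Proof.
move=> N_gt0 v0; rewrite /root_prod -[X in (X%:R * c) *: _](size_index_ord L).
elim: (index_enum _) => [|i r IHr].
  by rewrite !big_nil mul0r scale0r addr0; apply: eqmodX_refl.
rewrite !big_cons; apply: eqmodX_trans (eqmodXM (eqmodX_refl _ _) IHr) _.
set p := v - _; set q := \prod_(_ <- r) _.
have p0 : p`_0 = 1 by rewrite coefB coefZ coefX mulr0 subr0.
have q0 : q`_0 = 1.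
  rewrite -horner_coef0 horner_prod big1 // => j _.
  by rewrite hornerD hornerN hornerZ hornerX mulr0 subr0 horner_coef0.
have pN0 : (p + c *: 'X^N)`_0 = 1.
  by rewrite coefD p0 coefZ coefXn; case: (N) N_gt0 => // N' _; rewrite mulr0 addr0.
rewrite addrAC -/p mulrDr mulrDl -addrA; apply: eqmodXD; first exact: eqmodX_refl.
rewrite /= -natr1 [(_ + 1) * c]mulrDl mul1r scalerDl [X in eqmodX _ _ X]addrC.
apply: eqmodXD; first exact: eqmodX_mulXn.
by rewrite mulrC; apply: eqmodX_mulXn.
Qed.

(** The coefficient of z^N in the defect determines R_N: raising R_N lowers it by
    the same amount. *)
Lemma defectD N v (c : A) : (0 < N)%N -> v`_0 = 1 ->
  eqmodX N.+1 (defect (v + c *: 'X^N)) (defect v - c *: 'X^N).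
Proof.
move=> N_gt0 v0; rewrite /defect.
set d := (L%:R * c) *: 'X^N; set r0 := root_prod v 0; set r1 := root_prod v 1.
have vN0 : (v + c *: 'X^N)`_0 = 1.
  by rewrite coefD v0 coefZ coefXn; case: (N) N_gt0 => // N' _; rewrite mulr0 addr0.
have negM p q : eqmodX N.+1 p q -> eqmodX N.+1 (- p) (- q).
  by case=> r ->; exists (- r); ring.
apply: (@eqmodX_trans _ _ _ (r0 + d - (v + c *: 'X^N) * (r1 + d))).
  apply: eqmodXD; first exact: root_prodD.
  by apply/negM/eqmodXM; [apply: eqmodX_refl | apply: root_prodD].
rewrite mulrDr mulrDl.
have e1 : eqmodX N.+1 ((v + c *: 'X^N) * d) d by rewrite mulrC; apply: eqmodX_mulXn.
have e2 : eqmodX N.+1 (c *: 'X^N * r1) (c *: 'X^N) by apply/eqmodX_mulXn/root_prod0.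
apply: (@eqmodX_trans _ _ _ (r0 + d - (v * r1 + c *: 'X^N + d))).
  apply: eqmodXD; first exact: eqmodX_refl.
  by apply: negM; apply: eqmodXD e1; apply: eqmodXD e2; apply: eqmodX_refl.
have -> : r0 + d - (v * r1 + c *: 'X^N + d) = r0 - v * r1 - c *: 'X^N by ring.
exact: eqmodX_refl.
Qed.

(** The unique solution of the defect equation modulo z^(N+1), by successive
    approximation: each step adds the term that cancels the leading error. *)
Fixpoint beta_series N : {poly A} :=
  if N is N'.+1 then beta_series N' + (defect (beta_series N'))`_N *: 'X^N
  else 1 + L%:R *: 'X.

Definition beta_cumulant N : A := (defect (beta_series N.-1))`_N.

Lemma beta_seriesE N : beta_series N = cumulant_series beta_cumulant N + L%:R *: 'X.
Proof.
elim: N => [|N IHN]; first by rewrite /cumulant_series big_geq // addr0.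
have -> : cumulant_series beta_cumulant N.+1 =
    cumulant_series beta_cumulant N + beta_cumulant N.+1 *: 'X^(N.+1).
  by rewrite /cumulant_series big_nat_recr //= addrA.
by rewrite addrAC -IHN.
Qed.

Lemma beta_series0 N : (beta_series N)`_0 = 1.
Proof.
elim: N => [|N IHN] /=; rewrite coefD coefZ ?coefX ?coefXn mulr0 addr0 //.
by rewrite coef1.
Qed.

Lemma eqmodX_next N (p q : {poly A}) c : eqmodX N p q -> p`_N = q`_N + c ->
  eqmodX N.+1 p (q + c *: 'X^N).
Proof.
move=> pq pN; apply: coef_eqmodX => n; rewrite ltnS leq_eqVlt coefD coefZ coefXn.
case/orP=> [/eqP->|lt_nN]; first by rewrite eqxx mulr1.
by rewrite (eqmodX_coef pq) // (ltn_eqF lt_nN) mulr0 addr0.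
Qed.

Lemma defect_beta_series N : eqmodX N.+1 (defect (beta_series N)) 0.
Proof.
elim: N => [|N IHN].
  apply: coef_eqmodX => -[] // _; rewrite coefB coef0M !root_prod0 ?beta_series0 //.
  by rewrite coef0 mul1r subrr.
apply: eqmodX_trans (defectD _ _ (beta_series0 N)) _ => //.
have dN : (defect (beta_series N))`_N.+1 =
    (0 : {poly A})`_N.+1 + (defect (beta_series N))`_N.+1 by rewrite coef0 add0r.
have := eqmodX_next IHN dN; rewrite add0r => -[r e].
by exists r; apply/eqP; rewrite add0r subr_eq addrC; apply/eqP.
Qed.

(** By induction on the order: two solutions that agree below z^N agree at z^N,
    because the defect depends on that coefficient with slope - 1. *)
Lemma beta_series_uniq M v : v`_0 = 1 -> eqmodX M.+1 (defect v) 0 ->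
  forall N, (N <= M)%N -> eqmodX N.+1 v (beta_series N).
Proof.
move=> v0 dv; elim=> [_|N IHN lt_NM].
  by apply: coef_eqmodX => -[] // _; rewrite v0 beta_series0.
set c := v`_N.+1 - (beta_series N)`_N.+1.
have vE : eqmodX N.+2 v (beta_series N + c *: 'X^(N.+1)).
  by apply: eqmodX_next (IHN (ltnW lt_NM)) _; rewrite /c addrC subrK.
suff cE : c = (defect (beta_series N))`_N.+1 by rewrite cE in vE.
have := eqmodX_trans (defect_eqmodX vE) (defectD _ _ (beta_series0 N)) => /(_ isT) e.
have := eqmodX_coef e (ltnSn _); rewrite (eqmodX_coef dv) ?ltnS //.
by rewrite coef0 coefB coefZ coefXn eqxx mulr1 => /esym/eqP; rewrite subr_eq0 => /eqP.
Qed.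

End UniversalCumulants.

Lemma defect_ext (A : comNzRingType) L (b b' : 'I_L -> A) v :
  b =1 b' -> defect b v = defect b' v.
Proof.
move=> bb'; rewrite /defect; congr (_ - _ * _); apply: eq_bigr => i _; by rewrite bb'.
Qed.

Lemma beta_cumulant_ext (A : comNzRingType) L (b b' : 'I_L -> A) N :
  b =1 b' -> beta_cumulant b N = beta_cumulant b' N.
Proof.
move=> bb'; have seriesE M : beta_series b M = beta_series b' M.
  by elim: M => //= M ->; rewrite (defect_ext _ bb').
by rewrite /beta_cumulant seriesE (defect_ext _ bb').
Qed.

Section UniversalMorphism.

Variables (A A' : comNzRingType) (f : {rmorphism A -> A'}) (L : nat) (b : 'I_L -> A).

Lemma defect_map v : map_poly f (defect b v) = defect (fun i => f (b i)) (map_poly f v).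
Proof.
have prodE t : map_poly f (root_prod b v t) = root_prod (fun i => f (b i)) (map_poly f v) (f t).
  rewrite rmorph_prod; apply: eq_bigr => i _ /=.
  by rewrite rmorphB /= map_polyZ map_polyX rmorphD.
by rewrite /defect rmorphB rmorphM /= !prodE rmorph0 rmorph1.
Qed.

Lemma beta_series_map N : map_poly f (beta_series b N) = beta_series (fun i => f (b i)) N.
Proof.
elim: N => [|N IHN] /=.
  by rewrite rmorphD rmorph1 /= map_polyZ map_polyX rmorph_nat.
by rewrite rmorphD /= map_polyZ map_polyXn -IHN -defect_map coef_map.
Qed.

Lemma beta_cumulant_map N : f (beta_cumulant b N) = beta_cumulant (fun i => f (b i)) N.
Proof. by rewrite /beta_cumulant -coef_map defect_map beta_series_map. Qed.

End UniversalMorphism.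

(** * Every sequence of cumulants comes from beta-numbers *)

Section Surjectivity.

Variables (F : numClosedFieldType) (L : nat) (v : {poly F}).
Hypotheses (v0 : v`_0 = 1) (v1 : v`_1 = L%:R).

(** The defect as a function of the polynomial q(x) with roots the beta-numbers, since
    q(x - 1) has roots the l_i + 1.  It is linear in q, unlike the dependence on the
    roots. *)
Definition poly_defect (p : {poly F}) : {poly F} :=
  homogenize v L p - v * homogenize v L (p \Po ('X - 1)).

Lemma poly_defectD p q : poly_defect (p + q) = poly_defect p + poly_defect q.
Proof. by rewrite /poly_defect comp_polyD !homogenizeD; ring. Qed.

Lemma poly_defectZ c p : poly_defect (c *: p) = c *: poly_defect p.
Proof. by rewrite /poly_defect comp_polyZ !homogenizeZ scalerBr scalerAr. Qed.

Lemma eqmodX2_exp (p : {poly F}) (c : F) a :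
  eqmodX 2 p (1 + c *: 'X) -> eqmodX 2 (p ^+ a) (1 + (a%:R * c) *: 'X).
Proof.
move=> pE; elim: a => [|a IHa].
  by rewrite expr0 mul0r scale0r addr0; apply: eqmodX_refl.
rewrite exprS; apply: eqmodX_trans (eqmodXM pE IHa) _.
exists ((c * (a%:R * c))%:P); rewrite -natr1 -!mul_polyC !rmorphM rmorphD rmorph1 /=.
by ring.
Qed.

Lemma homogenize_exp a (b : F) : (a <= L)%N ->
  homogenize v L (('X - b%:P) ^+ a) = 'X^(L - a) * (v - b *: 'X) ^+ a.
Proof.
move=> le_aL; have size1 : (size (1%R : {poly F}) <= (L - a).+1)%N by rewrite size_poly1.
have := homogenizeM_prod v (index_enum 'I_a) (fun=> b) size1.
by rewrite homogenize1 size_index_ord subnK // mul1r !prodr_const card_ord.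
Qed.

(** The coefficient of x^(L-j), an elementary symmetric function of the roots, enters
    the equation at the order z^(j+1), with the factor - j. *)
Lemma poly_defect_Xn j : (j <= L)%N ->
  eqmodX j.+2 (poly_defect 'X^(L - j)) (- j%:R *: 'X^(j.+1)).
Proof.
move=> le_jL; set a := (L - j)%N.
have vE : eqmodX 2 v (1 + L%:R *: 'X).
  apply: coef_eqmodX => -[|[|n]] // _; rewrite coefD coef1 coefZ coefX ?v0 ?v1 /=.
    by rewrite mulr0 addr0.
  by rewrite mulr1 add0r.
have v'E : eqmodX 2 (v - 1 *: 'X) (1 + (L%:R - 1) *: 'X).
  apply: eqmodX_trans (eqmodXD vE (eqmodX_refl _ _)) _.
  by rewrite scalerBl addrA; apply: eqmodX_refl.
have -> : poly_defect 'X^a = 'X^j * (v ^+ a - v * (v - 1 *: 'X) ^+ a).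
  have h0 := homogenize_exp 0 (leq_subr j L); have h1 := homogenize_exp 1 (leq_subr j L).
  rewrite polyC0 subr0 scale0r subr0 -/a in h0; rewrite -/a in h1.
  by rewrite /poly_defect comp_Xn_poly h0 h1 subKn //; ring.
have [r rE] : eqmodX 2 (v ^+ a - v * (v - 1 *: 'X) ^+ a) (- j%:R *: 'X).
  have e1 := eqmodX2_exp a vE; have e2 := eqmodXM vE (eqmodX2_exp a v'E).
  have e3 := eqmodXD e1 (eqmodXM (eqmodX_refl _ (-1)) e2).
  rewrite mulN1r in e3; apply: eqmodX_trans e3 _.
  have jE : j%:R = L%:R - a%:R :> F by rewrite -natrB ?leq_subr // subKn.
  exists (- (L%:R * (a%:R * (L%:R - 1)))%:P).
  rewrite jE -!mul_polyC !(rmorphN, rmorphM, rmorphB) rmorph1 /=.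
  by ring.
exists r; rewrite rE mulrDr -scalerAr -exprSr mulrA [_ * r]mulrC -mulrA -exprD addn2.
by [].
Qed.

(** The coefficients of q are determined one after the other, because j is invertible
    for j >= 1. *)
Lemma poly_defect_solve J : (J <= L)%N ->
  exists2 q : {poly F}, (size (q - 'X^L)%R <= L)%N & eqmodX J.+2 (poly_defect q) 0.
Proof.
elim: J => [_|J IHJ lt_JL].
  exists 'X^L; first by rewrite subrr size_poly0.
  by have := poly_defect_Xn (leq0n L); rewrite subn0 oppr0 scale0r.
have [q size_q dq] := IHJ (ltnW lt_JL).
have J0 : J.+1%:R != 0 :> F by rewrite pnatr_eq0.
pose c := (poly_defect q)`_J.+2 / J.+1%:R.
exists (q + c *: 'X^(L - J.+1)).
  rewrite addrAC; apply: leq_trans (size_polyD _ _) _; rewrite geq_max size_q.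
  by apply: leq_trans (size_scale_leq _ _) _; rewrite size_polyXn; lia.
have dE : (poly_defect q)`_J.+2 = (0 : {poly F})`_J.+2 + c * J.+1%:R.
  by rewrite coef0 add0r /c divfK.
rewrite poly_defectD poly_defectZ.
apply: eqmodX_trans (eqmodXD (eqmodX_next dq dE) (eqmodXZ c (poly_defect_Xn lt_JL))) _.
by rewrite scalerA mulrN scaleNr add0r subrr; apply: eqmodX_refl.
Qed.

(** Over an algebraically closed field the polynomial found above splits, and its
    roots are the beta-numbers. *)
Lemma defect_solve : exists b : 'I_L -> F, eqmodX L.+2 (defect b v) 0.
Proof.
have [q size_q dq] := poly_defect_solve (leqnn L).
have size_qL : size q = L.+1.
  rewrite -[q](subrK 'X^L) addrC size_polyDl size_polyXn //.
have q_monic : q \is monic.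
  rewrite monicE lead_coefE size_qL /= -[q](subrK 'X^L) coefD coefXn eqxx.
  by rewrite nth_default ?add0r.
have [r qE] := closed_field_poly_normal q; rewrite (monicP q_monic) scale1r in qE.
have size_r : size r = L by apply: succn_inj; rewrite -size_qL qE size_prod_XsubC.
exists (fun i => r`_i); move: dq; rewrite /poly_defect.
have qE' : q = \prod_(i < L) ('X - (r`_i)%:P) by rewrite qE (big_nth 0) big_mkord size_r.
have homE (b : 'I_L -> F) :
    homogenize v L (\prod_(i < L) ('X - (b i)%:P)) = \prod_(i < L) (v - b i *: 'X).
  have size1 : (size (1%R : {poly F}) <= 1)%N by rewrite size_poly1.
  have := homogenizeM_prod v (index_enum 'I_L) b size1.
  by rewrite add0n size_index_ord mul1r homogenize1 expr0 mul1r.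
have -> : q \Po ('X - 1) = \prod_(i < L) ('X - (r`_i + 1)%:P).
  rewrite qE' rmorph_prod; apply: eq_bigr => i _ /=.
  by rewrite comp_polyB comp_polyX comp_polyC polyCD; ring.
rewrite qE' !homE; apply: eqmodX_trans; rewrite /defect /root_prod.
under [X in eqmodX _ (X - _) _]eq_bigr do rewrite addr0.
exact: eqmodX_refl.
Qed.

End Surjectivity.

(** * Zariski density of the cumulants *)

Lemma digits_inj d n (f g : 'I_n -> nat) :
  (forall i, f i < d)%N -> (forall i, g i < d)%N ->
  (\sum_(i < n) f i * d ^ i = \sum_(i < n) g i * d ^ i)%N -> f =1 g.
Proof.
elim: n f g => [|n IHn] f g f_lt g_lt; first by move=> _ [].
rewrite !big_ord_recl /= !expn0 !muln1.
have tail (h : 'I_n.+1 -> nat) : (\sum_(i < n) h (lift ord0 i) * d ^ bump 0 i =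
    d * \sum_(i < n) h (lift ord0 i) * d ^ i)%N.
  by rewrite big_distrr; apply: eq_bigr => i _ /=; rewrite expnS mulnCA.
rewrite !tail => eq_fg.
have eq0 : f ord0 = g ord0.
  by have := congr1 (modn^~ d) eq_fg; rewrite /= ![(_ + d * _)%N]addnC ![(d * _)%N]mulnC !modnMDl !modn_small.
have d_gt0 : (0 < d)%N by apply: leq_ltn_trans (f_lt ord0).
have eqS := IHn _ _ (fun i => f_lt (lift ord0 i)) (fun i => g_lt (lift ord0 i)).
move: eq_fg; rewrite eq0 => /addnI/eqP; rewrite eqn_pmul2l // => /eqP/eqS {}eqS i.
by case: (unliftP ord0 i) => [j|] ->.
Qed.

Lemma poly_eq0_nat (p : {poly rat}) : (forall t : nat, p.[t%:R] = 0) -> p = 0.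
Proof.
move=> p0; apply: (@roots_geq_poly_eq0 _ _ [seq t%:R | t <- iota 0 (size p)]).
- by apply/allP => x /mapP[t _ ->]; rewrite rootE p0.
- by rewrite map_inj_uniq ?iota_uniq // => x y /eqP; rewrite eqr_nat => /eqP.
by rewrite size_map size_iota.
Qed.

(** Kronecker's substitution reduces the claim to one variable. *)
Lemma mpoly_eq0_nat n (p : {mpoly rat[n]}) :
  (forall m : 'I_n -> nat, p.@[fun i => (m i)%:R] = 0) -> p = 0.
Proof.
move=> p0; pose d := msize p; pose key (m : 'X_{1..n}) := (\sum_(i < n) m i * d ^ i)%N.
have lt_d m (i : 'I_n) : m \in msupp p -> (m i < d)%N.
  move=> /msize_mdeg_lt; apply: leq_ltn_trans.
  by rewrite mdegE (bigD1 i) //= leq_addr.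
pose P : {poly rat} := \sum_(m <- msupp p) p@_m *: 'X^(key m).
have P0 : P = 0.
  apply: poly_eq0_nat => t; rewrite -[RHS](p0 (fun i => t ^ (d ^ i))%N) mevalE.
  rewrite horner_sum; apply: eq_bigr => m _; rewrite hornerZ hornerXn; congr (_ * _).
  rewrite /key expr_sum; apply: eq_bigr => i _.
  by rewrite natrX -exprM mulnC.
apply/mpolyP => m; rewrite mcoeff0.
have [m_supp|/memN_msupp_eq0//] := boolP (m \in msupp p).
have := congr1 (fun q : {poly rat} => q`_(key m)) P0; rewrite coef0 coef_sum.
rewrite (bigD1_seq m) ?msupp_uniq //= coefZ coefXn eqxx mulr1.
rewrite [X in _ + X]big_seq_cond big1 ?addr0 // => m' /andP[m'_supp neq_m'].
rewrite coefZ coefXn; case: eqP => [eq_key|_]; last by rewrite mulr0.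
case/eqP: neq_m'; apply/mnmP; apply: (@digits_inj d); last exact: esym.
  by move=> i; apply: lt_d.
by move=> i; apply: lt_d.
Qed.

Section Density.

Variable k : nat.

(** For natural numbers m, these are the strictly increasing sequences of positive
    integers, parametrized freely by the gaps. *)
Definition beta_of_gaps (A : comNzRingType) (m : 'I_k -> A) (i : 'I_k) : A :=
  \sum_(j < k | (j <= i)%N) (m j + 1).

Definition generic_cumulant (j : nat) : {mpoly rat[k]} :=
  beta_cumulant (beta_of_gaps (fun j => 'X_j)) j.

Lemma beta_of_gaps_map (A A' : comNzRingType) (f : {rmorphism A -> A'}) m i :
  f (beta_of_gaps m i) = beta_of_gaps (fun j => f (m j)) i.
Proof. by rewrite rmorph_sum; apply: eq_bigr => j _; rewrite rmorphD rmorph1. Qed.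

Lemma beta_of_gaps_surj (A : comNzRingType) (b : 'I_k -> A) :
  exists m, beta_of_gaps m =1 b.
Proof.
pose bb j := if j is j'.+1 then (if insub j' is Some i then b i else 0) else 0.
exists (fun j => bb j.+1 - bb j - 1) => i; rewrite /beta_of_gaps.
rewrite (eq_bigr (fun j : 'I_k => bb j.+1 - bb j)); last by move=> j _; rewrite subrK.
transitivity (\sum_(j < i.+1) (bb j.+1 - bb j)).
  by rewrite (big_ord_widen k (fun j => bb j.+1 - bb j)).
rewrite -(big_mkord xpredT (fun j => bb j.+1 - bb j)) telescope_sumr // subr0.
by rewrite /= valK.
Qed.

Lemma generic_cumulant_map (A : comNzRingType) (f : {rmorphism {mpoly rat[k]} -> A}) j :
  f (generic_cumulant j) = beta_cumulant (beta_of_gaps (fun j => f 'X_j)) j.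
Proof.
rewrite /generic_cumulant beta_cumulant_map; apply: beta_cumulant_ext => i.
exact: beta_of_gaps_map.
Qed.

Lemma mmap_comp_mpoly (A : comNzRingType) (f : {rmorphism rat -> A}) (h : 'I_k -> A)
    (T : {mpoly rat[k]}) (lq : k.-tuple {mpoly rat[k]}) :
  mmap f h (T \mPo lq) = mmap f (fun j => mmap f h (tnth lq j)) T.
Proof.
rewrite comp_mpolyE rmorph_sum [RHS]/mmap; apply: eq_bigr => m _ /=.
rewrite mmapZ rmorph_prod; congr (_ * _); apply: eq_bigr => j _.
by rewrite rmorphXn.
Qed.

Lemma mmap_ratr (T : {mpoly rat[k]}) (r : 'I_k -> rat) :
  mmap (ratr : rat -> algC) (fun j => ratr (r j)) T = ratr T.@[r].
Proof.
rewrite mevalE rmorph_sum; apply: eq_bigr => m _ /=.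
rewrite rmorphM rmorph_prod; congr (_ * _); apply: eq_bigr => j _.
by rewrite rmorphXn.
Qed.

(** The composite of T with the polynomials giving the cumulants vanishes at all
    natural gaps, hence identically, hence over the algebraic numbers, where the
    cumulants take all values. *)
Lemma cumulants_dense (T : {mpoly rat[k]}) :
    (forall m : 'I_k -> nat,
       T.@[fun j => beta_cumulant (beta_of_gaps (fun i => (m i)%:R)) j.+2] = 0) ->
  T = 0.
Proof.
move=> T0; pose lq : k.-tuple {mpoly rat[k]} := [tuple generic_cumulant j.+2 | j < k].
have Tq0 : T \mPo lq = 0.
  apply: mpoly_eq0_nat => m; rewrite comp_mpoly_meval -[RHS](T0 m).
  apply: meval_eq => j; rewrite tnth_mktuple generic_cumulant_map.
  apply: beta_cumulant_ext => i; apply: eq_bigr => j' _ /=; congr (_ + _).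
  exact: mevalXU.
apply: mpoly_eq0_nat => r; set R := fun i => (r i)%:R : rat.
(* The cumulants R_(j+2) = r_j are attained by beta-numbers b over algC, and the
   vanishing polynomial identity can be evaluated at the gaps of b. *)
suff: ratr T.@[R] = 0 :> algC by move/eqP; rewrite fmorph_eq0 => /eqP.
rewrite -mmap_ratr.
pose v : {poly algC} := 1 + k%:R *: 'X + \sum_(j < k) ratr (R j) *: 'X^(j.+2).
have coef_v j : v`_j.+2 = if insub j is Some i then ratr (R i) else 0.
  rewrite !coefD coef1 coefZ coefX mulr0 !add0r coef_sum.
  case: insubP => [i _ <-|nlt_j].
    rewrite (bigD1 i) //= coefZ coefXn eqxx mulr1 big1 ?addr0 // => i' /negPf ii'.
    by rewrite coefZ coefXn !eqSS eq_sym -val_eqE /= in ii' *; rewrite ii' mulr0.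
  rewrite big1 // => i _; rewrite coefZ coefXn !eqSS; case: eqP => [e|_]; last by rewrite mulr0.
  by case/negP: nlt_j; rewrite e.
have v0 : v`_0 = 1.
  rewrite !coefD coef1 coefZ coefX mulr0 addr0 coef_sum big1 ?addr0 // => i _.
  by rewrite coefZ coefXn mulr0.
have v1 : v`_1 = k%:R.
  rewrite !coefD coef1 coefZ coefX mulr1 add0r coef_sum big1 ?addr0 // => i _.
  by rewrite coefZ coefXn mulr0.
have [b bv] := defect_solve v0 v1.
have [m mb] := beta_of_gaps_surj b.
have cumE (j : 'I_k) : beta_cumulant b j.+2 = ratr (R j).
  have -> : beta_cumulant b j.+2 = (beta_series b k.+1)`_j.+2.
    rewrite beta_seriesE cumulant_seriesE !coefD coef1 !coefZ coefX !mulr0 addr0 !add0r.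
    rewrite coef_sum (bigD1 j) //= coefZ coefXn eqxx mulr1 big1 ?addr0 // => i /negPf ij.
    by rewrite coefZ coefXn !eqSS eq_sym -val_eqE /= in ij *; rewrite ij mulr0.
  rewrite -(eqmodX_coef (beta_series_uniq v0 bv (leqnn _))) ?ltnS //.
  by rewrite coef_v valK.
have := mmap_comp_mpoly (ratr : {rmorphism rat -> algC}) m T lq.
rewrite Tq0 mmap0 => /esym <-; apply: eq_bigr => mm _; congr (_ * _).
apply: eq_bigr => j _; congr (_ ^+ _); rewrite tnth_mktuple generic_cumulant_map -cumE.
apply: beta_cumulant_ext => i; rewrite -mb; apply: eq_bigr => j' _; congr (_ + _).
by rewrite /= mmapX mmap1U.
Qed.

End Density.

(** * Kerov's polynomial is the Kerov series *)

Lemma increasing_inj L (l : 'I_L -> nat) : increasing l -> injective l.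
Proof.
move=> inc_l i j lij; apply: ord_inj; have [/inc_l|/inc_l|//] := ltngtP i j.
  by rewrite lij ltnn.
by rewrite lij ltnn.
Qed.

(** Frobenius' formula holds for the character of the partition, since the sign
    relating it to the Frobenius class function cancels in the quotient. *)
Lemma kerov_at_partition k (S : {mpoly int[k]}) m w
    (R := beta_cumulant (fun i : 'I_(size w) => (row_beta i)%:R : rat)) :
    (0 < k)%N -> kerov_polynomial S -> is_partition (k + m) w ->
  (map_mpoly intr S).@[fun j : 'I_k => R j.+2] = kerov_series id k R.
Proof.
move=> k_gt0 kerS w_part.
have eq_v N (s := [seq ((row_beta i)%:R : rat) | i : 'I_(size w)])
    (v := cumulant_series R N + (size w)%:R *: 'X) :
    eqmodX N.+1 (shifted_prod v s 0) (v * shifted_prod v s 1).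
  have sE t : shifted_prod v s t = root_prod (fun i : 'I_(size w) => (row_beta i)%:R) v t.
    by rewrite /shifted_prod big_image.
  rewrite !sE; have [r] := defect_beta_series (fun i : 'I_(size w) => (row_beta i)%:R : rat) N.
  rewrite beta_seriesE -/R -/v /defect add0r => e; exists r.
  by rewrite -e addrC subrK.
have inj_l := increasing_inj (row_beta_increasing w_part).
rewrite -(frobenius_sum_cumulants k_gt0 inj_l (eq_v k.+1)).
have sum_l := sum_row_beta w_part.
have [i [e [iP chiE]]] := frobenius_cf_partition w_part.
have [dim0 valE] := frobenius_long_cycle k_gt0 inj_l sum_l.
have := kerS _ w R i (long_cycle k m) (leq_addr m k) w_part
  (free_cumulants_beta w_part eq_v) iP (long_cycle_type m k_gt0).
have e0 : (-1) ^+ e != 0 :> algC by rewrite signr_eq0.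
have -> : ((k + m) ^_ k)%:R * 'chi_i (long_cycle k m) / 'chi_i 1%g =
    ratr (frobenius_sum k (row_beta (w := w))) :> algC.
  rewrite -valE chiE !cfunE; rewrite chiE cfunE mulf_eq0 negb_or in dim0.
  have /andP[_ chi0] := dim0; field.
  by rewrite ?e0 ?chi0.
by move/fmorph_inj.
Qed.

Lemma beta_cumulant_cast (A : comNzRingType) L L' (e : L = L') (b : 'I_L -> A) (b' : 'I_L' -> A) N :
  (forall i, b i = b' (cast_ord e i)) -> beta_cumulant b N = beta_cumulant b' N.
Proof.
by case: _ / e b' => b' bb'; apply: beta_cumulant_ext => i; rewrite bb' cast_ord_id.
Qed.

Lemma kerov_series_ext (A : comNzRingType) (iota : rat -> A) k R R' :
  (forall i, (i < k)%N -> R i.+2 = R' i.+2) -> kerov_series iota k R = kerov_series iota k R'.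
Proof.
move=> RR'; have polyE : cumulant_poly k R = cumulant_poly k R'.
  by apply: eq_bigr => i _; rewrite RR'.
by rewrite /kerov_series polyE.
Qed.

Section Partitions.

Variables (k : nat) (m : 'I_k -> nat).

Definition gap_part (i : nat) : nat := (\sum_(j < k | (j <= i)%N) m j).+1.

Definition gap_partition : seq nat := mkseq (fun r => gap_part (k - r.+1)) k.

Lemma size_gap_partition : size gap_partition = k.
Proof. exact: size_mkseq. Qed.

Lemma gap_partitionP : is_partition (sumn gap_partition) gap_partition.
Proof.
apply/and3P; split=> //; last by apply/mapP => -[].
have geq_trans : transitive geq by move=> x y z xy yz; apply: leq_trans yz xy.
apply/(sortedP 0%N) => i; rewrite size_mkseq => lt_ik.
rewrite !nth_mkseq ?(ltnW lt_ik) //= ltnS [leqLHS]big_mkcond [leqRHS]big_mkcond.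
by apply: leq_sum => j _; case: ifP; case: ifP => //; lia.
Qed.

Lemma size_le_gap_partition : (k <= sumn gap_partition)%N.
Proof.
by rewrite sumnE big_map -[leqLHS](size_iota 0 k) -sum1_size leq_sum.
Qed.

Lemma row_beta_gap_partition (i : 'I_(size gap_partition)) :
  (row_beta i)%:R = beta_of_gaps (fun j => (m j)%:R) (cast_ord size_gap_partition i) :> rat.
Proof.
have lt_ik : (i < k)%N by have := ltn_ord i; rewrite {2}size_gap_partition.
have rv : rev_ord i = (k - i.+1)%N :> nat by congr (_ - _)%N; apply: size_gap_partition.
rewrite /row_beta rv nth_mkseq; last by lia.
rewrite (_ : (k - (k - i.+1).+1 = i)%N); last by lia.
rewrite /beta_of_gaps big_split /= -natr_sum /gap_part addSnnS natrD; congr (_ + _).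
rewrite sumr_const; congr (_ *+ _); rewrite -sum1_card -[LHS]card_ord -sum1_card.
exact: (big_ord_widen _ (fun=> 1%N)).
Qed.

End Partitions.

(** Both polynomials agree at the cumulants of all partitions with k rows, which are
    dense. *)
Lemma kerov_polynomialE k (S : {mpoly int[k]}) : (0 < k)%N -> kerov_polynomial S ->
  map_mpoly intr S = kerov_series (@mpolyC k rat) k (mpoly_R k).
Proof.
move=> k_gt0 kerS; apply/eqP; rewrite -subr_eq0; apply/eqP; apply: cumulants_dense => m.
have le_k := size_le_gap_partition m; have w_part := gap_partitionP m.
rewrite -(subnKC le_k) in w_part; have := kerov_at_partition k_gt0 kerS w_part.
have cumE j : beta_cumulant (fun i : 'I_(size (gap_partition m)) => (row_beta i)%:R : rat) j =
    beta_cumulant (beta_of_gaps (fun i => (m i)%:R)) j.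
  by apply: (beta_cumulant_cast (e := size_gap_partition m)) => i; apply: row_beta_gap_partition.
set x := fun j : 'I_k => beta_cumulant (beta_of_gaps _) j.+2.
rewrite (meval_eq (v2 := x)) => [|j]; last exact: cumE.
rewrite mevalB => ->; rewrite (kerov_series_map (f := meval x) (iota' := id)); last exact: mevalC.
apply/eqP; rewrite subr_eq0; apply/eqP/kerov_series_ext => i lt_ik.
by rewrite cumE /mpoly_R insubT /= mevalXU.
Qed.

(** * The weight grading *)

Section Grading.

Variables (A : comNzRingType) (iota : rat -> A) (k : nat) (R : nat -> A).

(** The substitution of h z for z; in {poly {poly A}} the outer variable is z and the
    inner one is h.  It multiplies R_i by h^i in series where R_i only occurs with
    z^i. *)
Definition dilate : {poly A} -> {poly {poly A}} :=
  comp_poly ('X%:P * 'X) \o map_poly polyC.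

HB.instance Definition _ :=
  GRing.RMorphism.copy dilate (comp_poly ('X%:P * 'X) \o map_poly polyC).

Lemma dilate_euler p : dilate (euler p) = euler (dilate p).
Proof.
rewrite /dilate /euler /= rmorphM /= map_polyX comp_polyM comp_polyX deriv_comp deriv_map.
by rewrite derivM derivC mul0r add0r derivX mulr1; ring.
Qed.

Lemma coef_dilate p i : (dilate p)`_i = p`_i *: 'X^i.
Proof.
rewrite /dilate /= coef_comp_poly -mul_polyC.
have coefE (j : nat) : (('X%:P * 'X : {poly {poly A}}) ^+ j)`_i = (i == j)%:R * 'X^j.
  by rewrite exprMn -polyC_exp coefCM coefXn mulrC.
have [lt_ip|le_pi] := ltnP i (size (map_poly polyC p)).
  rewrite (bigD1 (Ordinal lt_ip)) //= coefE eqxx mul1r big1 ?addr0 ?coef_map // => j.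
  by rewrite -val_eqE /= eq_sym coefE => /negPf->; rewrite mul0r mulr0.
rewrite big1 => [|j _]; last first.
  by rewrite coefE (gtn_eqF (leq_trans (ltn_ord j) le_pi)) mul0r mulr0.
by rewrite -coef_map nth_default ?mul0r.
Qed.

Lemma dilateX : dilate 'X = 'X%:P * 'X.
Proof. by rewrite /dilate /= map_polyX comp_polyX. Qed.

Lemma dilateC c : dilate c%:P = c%:P%:P.
Proof. by rewrite /dilate /= map_polyC comp_polyC. Qed.

Lemma dilate_ladder C m : dilate (ladder C m) = ladder (dilate C) m.
Proof.
elim: m => //= m IHm.
by rewrite rmorphM rmorphD rmorphM /= dilate_euler IHm rmorph_nat.
Qed.

Lemma dilate_geometric N B : dilate (geometric N B) = geometric N (dilate B).
Proof. by rewrite rmorph_sum; apply: eq_bigr => s _; rewrite rmorphXn. Qed.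

Definition graded_cumulant i : {poly A} := R i *: 'X^i.

Lemma dilate_cumulant_poly :
  dilate (cumulant_poly k R) = cumulant_poly k graded_cumulant.
Proof.
rewrite rmorph_sum; apply: eq_bigr => i _ /=.
rewrite -!mul_polyC rmorphM rmorphXn /= dilateX dilateC /graded_cumulant exprMn mulrA.
congr (_ * _); rewrite -polyC_exp -polyCM; congr polyC.
by rewrite !mul_polyC -scalerA !scaler_nat mulr_natl.
Qed.

(** The series g_j with a separate variable y, the outer one, in place of the powers
    of z produced by the flow. *)
Definition flow_symbol N (C : {poly A}) j : {poly {poly A}} :=
  1 - \sum_(m < N) (iota (flow_coef j m) *: ladder C m) *: 'X^(m.+1).

(** The substitution of h z for z followed by that of z for y: a power of z carries
    the same power of h, except for the powers that the flow produces. *)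
Definition regrade : {poly {poly A}} -> {poly {poly A}} :=
  horner_eval 'X \o map_poly dilate.

HB.instance Definition _ :=
  GRing.RMorphism.copy regrade (horner_eval 'X \o map_poly dilate).

Lemma regradeC p : regrade p%:P = dilate p.
Proof. by rewrite /regrade /= map_polyC /horner_eval hornerC. Qed.

Lemma regradeX : regrade 'X = 'X.
Proof. by rewrite /regrade /= map_polyX /horner_eval hornerX. Qed.

(** In a term of degree n in z and n - d in h, exactly d factors z come from y. *)
Lemma coef_regrade (P : {poly {poly A}}) n d : (d <= n)%N ->
  ((regrade P)`_n)`_(n - d) = (P`_d)`_(n - d).
Proof.
move=> le_dn; rewrite /regrade /= /horner_eval horner_coef coef_sum coef_sum.
have coefE (i : nat) : (((map_poly dilate P)`_i * 'X^i)`_n)`_(n - d) =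
    if i == d then (P`_d)`_(n - d) else 0.
  rewrite coefMXn coef_map /=; case: ltnP => [lt_ni|le_in]; first by rewrite coef0; case: eqP => // e; lia.
  rewrite coef_dilate coefZ coefXn; case: (i =P d) => [->|ne]; first by rewrite eqxx mulr1.
  by case: eqP => [e|_]; rewrite ?mulr0 //; lia.
have [lt_d|le_d] := ltnP d (size (map_poly dilate P)).
  rewrite (bigD1 (Ordinal lt_d)) //= coefE eqxx big1 ?addr0 // => j.
  by rewrite -val_eqE /= coefE => /negPf->.
rewrite big1 => [|j _]; last by rewrite coefE (ltn_eqF (leq_trans (ltn_ord j) le_d)).
have Pd0 : P`_d = 0.
  apply/polyP => i; have := congr1 (fun q : {poly {poly A}} => q`_i`_i) (nth_default 0 le_d).
  by rewrite coef_map /= coef_dilate coefZ coefXn eqxx mulr1 !coef0.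
by rewrite Pd0 coef0.
Qed.

Lemma regrade_flow_symbol N C j :
  regrade (flow_symbol N C j) = flow_series (fun c => (iota c)%:P) N (dilate C) j.
Proof.
rewrite /flow_symbol /flow_series rmorphB rmorph1 rmorph_sum; congr (_ - _).
apply: eq_bigr => m _ /=; rewrite -mul_polyC rmorphM rmorphXn /= regradeX regradeC.
rewrite -!mul_polyC rmorphM /= dilateC dilate_ladder.
by ring.
Qed.

(** The part of weight k + 1 - d is the part of degree d in the flow. *)
Lemma kerov_series_graded d : (d <= k.+1)%N ->
  (kerov_series (fun c => (iota c)%:P) k graded_cumulant)`_(k.+1 - d) =
  iota (- k%:R^-1) *
  ((1 - cumulant_poly k R) *
   (\prod_(j < k) flow_symbol k.+1 (geometric k.+2 (cumulant_poly k R)) j)`_d)`_(k.+1 - d).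
Proof.
move=> le_dk; rewrite /kerov_series coefCM; congr (_ * _).
set B := cumulant_poly k R; set C := geometric k.+2 B.
rewrite -dilate_cumulant_poly -/B -dilate_geometric -/C.
have -> : (1 - dilate B) * \prod_(j < k) flow_series (fun c => (iota c)%:P) k.+1 (dilate C) j =
    regrade ((1 - B)%:P * \prod_(j < k) flow_symbol k.+1 C j).
  rewrite rmorphM rmorph_prod /= regradeC rmorphB rmorph1; congr (_ * _).
  by apply: eq_bigr => j _; rewrite regrade_flow_symbol.
by rewrite coef_regrade // coefCM.
Qed.

End Grading.

(** * The component of weight k - 3 *)

Section WeightFour.

(** The power sums of 0, ..., x - 1, as polynomials in x. *)
Definition pow1 (x : rat) := x * (x - 1) / 2%:R.
Definition pow2 (x : rat) := x * (x - 1) * (2%:R * x - 1) / 6%:R.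
Definition pow3 (x : rat) := x ^+ 2 * (x - 1) ^+ 2 / 4%:R.
Definition pow4 (x : rat) :=
  x * (x - 1) * (2%:R * x - 1) * (3%:R * x ^+ 2 - 3%:R * x - 1) / 30%:R.

(** The monomial symmetric functions of 0, ..., x - 1, divided by the factorials of
    the parts of the partition. *)
Definition mon11 x := (pow1 x ^+ 2 - pow2 x) / 2%:R.
Definition mon21 x := (pow2 x * pow1 x - pow3 x) / 2%:R.
Definition mon111 x := (pow1 x ^+ 3 - 3%:R * pow1 x * pow2 x + 2%:R * pow3 x) / 6%:R.
Definition mon31 x := (pow3 x * pow1 x - pow4 x) / 6%:R.
Definition mon22 x := (pow2 x ^+ 2 - pow4 x) / 8%:R.
Definition mon211 x :=
  (pow2 x * pow1 x ^+ 2 - 2%:R * pow3 x * pow1 x - pow2 x ^+ 2 + 2%:R * pow4 x) / 4%:R.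
Definition mon1111 x :=
  (pow1 x ^+ 4 - 6%:R * pow1 x ^+ 2 * pow2 x + 3%:R * pow2 x ^+ 2
   + 8%:R * pow1 x * pow3 x - 6%:R * pow4 x) / 24%:R.

Variables (A : comNzRingType) (iota : {rmorphism rat -> A}).
Variables (N : nat) (C : {poly A}).
Hypothesis N_ge4 : (4 <= N)%N.

Let kappa : rat -> {poly A} := polyC \o iota.

HB.instance Definition _ := GRing.RMorphism.copy kappa (polyC \o iota).

Local Notation a_ := (ladder C).

Let flow_prod n := \prod_(j < n) flow_symbol iota N C j.

Lemma coef_flow_symbol j m : (m < 4)%N ->
  (flow_symbol iota N C j)`_m.+1 = - (kappa (flow_coef j m) * a_ m).
Proof.
move=> lt_m4; have lt_mN := leq_trans lt_m4 N_ge4.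
rewrite /flow_symbol coefB coef1 sub0r coef_sum (bigD1 (Ordinal lt_mN)) //=.
rewrite coefZ coefXn eqxx mulr1 big1 ?addr0 => [|i]; first by rewrite -mul_polyC.
by rewrite -val_eqE /= coefZ coefXn eqSS eq_sym => /negPf->; rewrite mulr0.
Qed.

Lemma coef0_flow_symbol j : (flow_symbol iota N C j)`_0 = 1.
Proof.
rewrite /flow_symbol coefB coef1 coef_sum big1 ?subr0 // => i _.
by rewrite coefZ coefXn mulr0.
Qed.

(** By induction on the number of factors.  The signs come from g_j = 1 - sum_m
    j^(m+1)/(m+1)! y^(m+1) P_m, and the coefficient of a product of P_m is a monomial
    symmetric function of 0, ..., n - 1. *)
Lemma flow_prod_coefs n (x := n%:R : rat) :
  [/\ (flow_prod n)`_0 = 1,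
      (flow_prod n)`_1 = - (kappa (pow1 x) * a_ 0),
      (flow_prod n)`_2 = kappa (mon11 x) * a_ 0 ^+ 2 - kappa (pow2 x / 2%:R) * a_ 1,
      (flow_prod n)`_3 = - (kappa (pow3 x / 6%:R) * a_ 2)
        + kappa (mon21 x) * (a_ 0 * a_ 1) - kappa (mon111 x) * a_ 0 ^+ 3
    & (flow_prod n)`_4 = - (kappa (pow4 x / 24%:R) * a_ 3)
        + kappa (mon31 x) * (a_ 0 * a_ 2) + kappa (mon22 x) * a_ 1 ^+ 2
        - kappa (mon211 x) * (a_ 0 ^+ 2 * a_ 1) + kappa (mon1111 x) * a_ 0 ^+ 4].
Proof.
rewrite /x {x}; elim: n => [|n [IH0 IH1 IH2 IH3 IH4]].
  have k0 (c : rat) : c = 0 -> kappa c = 0 by move=> ->; exact: rmorph0.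
  rewrite /flow_prod big_ord0 !coef1 /=.
  by rewrite !(k0 (_ 0)) ?(k0 (_ 0 / _)) ?mul0r ?oppr0 ?subr0 ?addr0.
have [e0 e1 e2 e3] : [/\ flow_coef n 0 = n%:R, flow_coef n 1 = n%:R ^+ 2 / 2%:R,
    flow_coef n 2 = n%:R ^+ 3 / 6%:R & flow_coef n 3 = n%:R ^+ 4 / 24%:R].
  by split; rewrite /flow_coef // expr1 divr1.
(* The recurrences in n of the power sums and of the monomial symmetric functions. *)
have [m1 m2 m3 m4] : [/\ pow1 n.+1%:R = pow1 n%:R + flow_coef n 0,
    pow2 n.+1%:R / 2%:R = pow2 n%:R / 2%:R + flow_coef n 1,
    pow3 n.+1%:R / 6%:R = pow3 n%:R / 6%:R + flow_coef n 2 &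
    pow4 n.+1%:R / 24%:R = pow4 n%:R / 24%:R + flow_coef n 3].
  by rewrite -!natr1 ?(e0, e1, e2, e3); move: (n%:R : rat) => x; split;
     rewrite /pow1 /pow2 /pow3 /pow4; field.
have [m11 m21 m111] : [/\ mon11 n.+1%:R = mon11 n%:R + flow_coef n 0 * pow1 n%:R,
    mon21 n.+1%:R = mon21 n%:R + flow_coef n 0 * (pow2 n%:R / 2%:R) + flow_coef n 1 * pow1 n%:R &
    mon111 n.+1%:R = mon111 n%:R + flow_coef n 0 * mon11 n%:R].
  by rewrite -!natr1 ?(e0, e1, e2, e3); move: (n%:R : rat) => x; split;
     rewrite /mon11 /mon21 /mon111 /pow1 /pow2 /pow3 /pow4; field.
have [m31 m22 m211 m1111] : [/\
    mon31 n.+1%:R = mon31 n%:R + flow_coef n 0 * (pow3 n%:R / 6%:R) + flow_coef n 2 * pow1 n%:R,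
    mon22 n.+1%:R = mon22 n%:R + flow_coef n 1 * (pow2 n%:R / 2%:R),
    mon211 n.+1%:R = mon211 n%:R + flow_coef n 0 * mon21 n%:R + flow_coef n 1 * mon11 n%:R &
    mon1111 n.+1%:R = mon1111 n%:R + flow_coef n 0 * mon111 n%:R].
  by rewrite -!natr1 ?(e0, e1, e2, e3); move: (n%:R : rat) => x; split;
     rewrite /mon31 /mon22 /mon211 /mon1111 /mon11 /mon21 /mon111 /pow1 /pow2 /pow3 /pow4; field.
have -> : flow_prod n.+1 = flow_prod n * flow_symbol iota N C n by rewrite /flow_prod big_ord_recr.
rewrite m1 m2 m3 m4 m11 m21 m111 m31 m22 m211 m1111.
have q0 := coef0_flow_symbol n.
have q1 := @coef_flow_symbol n 0 isT; have q2 := @coef_flow_symbol n 1 isT.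
have q3 := @coef_flow_symbol n 2 isT; have q4 := @coef_flow_symbol n 3 isT.
move: (a_ 0) (a_ 1) (a_ 2) (a_ 3) IH1 IH2 IH3 IH4 q1 q2 q3 q4.
move=> l0 l1 l2 l3 IH1 IH2 IH3 IH4 q1 q2 q3 q4.
have coefM_ i : (flow_prod n * flow_symbol iota N C n)`_i =
    \sum_(j < i.+1) (flow_prod n)`_j * (flow_symbol iota N C n)`_(i - j) by exact: coefM.
rewrite !coefM_ !big_ord_recr !big_ord0 /= !subnn !subn0 ?subSS ?subn0.
rewrite q0 q1 q2 q3 q4 IH0 IH1 IH2 IH3 IH4.
have kD x y : kappa (x + y) = kappa x + kappa y by exact: rmorphD.
have kM x y : kappa (x * y) = kappa x * kappa y by exact: rmorphM.
move: (flow_coef n 0) (flow_coef n 1) (flow_coef n 2) (flow_coef n 3) => f0 f1 f2 f3.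
move: (pow1 _) (pow2 _ / _) (pow3 _ / _) (pow4 _ / _) => p1 p2 p3 p4.
move: (mon11 _) (mon21 _) (mon111 _) (mon31 _) (mon22 _) (mon211 _) (mon1111 _).
move=> c11 c21 c111 c31 c22 c211 c1111; rewrite !kD !kM.
by split; ring.
Qed.

Definition triple_sum n (f : nat -> nat -> nat -> rat) : A :=
  \sum_(a < n.+1) \sum_(b < n.+1) \sum_(c < n.+1 | (a + b + c == n)%N)
     iota (f a b c) * (C`_a * C`_b * C`_c).

Lemma triple_sum_cyc n f : triple_sum n f = triple_sum n (fun a b c => f b c a).
Proof.
rewrite /triple_sum.
under [LHS]eq_bigr do under eq_bigr do rewrite big_mkcond.
under [RHS]eq_bigr do under eq_bigr do rewrite big_mkcond.
rewrite [RHS]exchange_big; apply: eq_bigr => a _; rewrite [RHS]exchange_big.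
apply: eq_bigr => b _; apply: eq_bigr => c _ /=.
rewrite (_ : (c + a + b = a + b + c)%N); last by rewrite addnC addnA addnAC [(b + a)%N]addnC.
by case: eqP => // _; rewrite mulrC [X in _ = _ * X]mulrC; ring.
Qed.

Lemma triple_sumD n f g :
  triple_sum n (fun a b c => f a b c + g a b c) = triple_sum n f + triple_sum n g.
Proof.
rewrite -!big_split; apply: eq_bigr => a _; rewrite -!big_split; apply: eq_bigr => b _.
by rewrite -!big_split; apply: eq_bigr => c _; rewrite rmorphD mulrDl.
Qed.

Lemma triple_sumZ n x f :
  triple_sum n (fun a b c => x * f a b c) = iota x * triple_sum n f.
Proof.
rewrite mulr_sumr; apply: eq_bigr => a _; rewrite mulr_sumr; apply: eq_bigr => b _.
by rewrite mulr_sumr; apply: eq_bigr => c _; rewrite rmorphM mulrA.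
Qed.

Lemma eq_triple_sum n f g :
  (forall a b c, (a + b + c = n)%N -> f a b c = g a b c) ->
  triple_sum n f = triple_sum n g.
Proof.
move=> fg; apply: eq_bigr => a _; apply: eq_bigr => b _; apply: eq_bigr => c /eqP abc.
by rewrite fg.
Qed.

(** The monomial attached to a triple is symmetric, so its coefficient may be averaged
    over the cyclic permutations. *)
Lemma triple_sum_symmetrize n f :
  iota 3%:R * triple_sum n f =
  triple_sum n (fun a b c => f a b c + f b c a + f c a b).
Proof.
rewrite !triple_sumD -(triple_sum_cyc n f).
have -> : triple_sum n (fun a b c => f c a b) = triple_sum n f.
  by rewrite (triple_sum_cyc n f) (triple_sum_cyc n (fun a b c => f b c a)).
by rewrite rmorph_nat; ring.
Qed.

Lemma coef_mul3 (p q r : {poly A}) n :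
  (p * q * r)`_n = \sum_(a < n.+1) \sum_(b < n.+1) \sum_(c < n.+1 | (a + b + c == n)%N)
     p`_a * q`_b * r`_c.
Proof.
have coefM_sum (s t : {poly A}) i : (i < n.+1)%N ->
    (s * t)`_i = \sum_(a < n.+1) \sum_(b < n.+1 | (a + b == i)%N) s`_a * t`_b.
  move=> lt_in; rewrite coefM (big_ord_widen n.+1 (fun j => s`_j * t`_(i - j))) //.
  rewrite big_mkcond; apply: eq_bigr => a _; case: ltnP => [le_ai|lt_ia].
    have lt_bn : (i - a < n.+1)%N by apply: leq_ltn_trans (leq_subr _ _) lt_in.
    rewrite (big_pred1 (Ordinal lt_bn)) // => b.
    by rewrite /= -val_eqE /= -[in RHS](eqn_add2l a) subnKC.
  by rewrite big_pred0 // => b; apply/eqP; lia.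
rewrite -mulrA coefM_sum //; apply: eq_bigr => a _.
transitivity (\sum_(d < n.+1 | (a + d == n)%N)
    \sum_(b < n.+1) \sum_(c < n.+1 | (b + c == d)%N) p`_a * q`_b * r`_c).
  apply: eq_bigr => d _; rewrite coefM_sum // mulr_sumr; apply: eq_bigr => b _.
  by rewrite mulr_sumr; apply: eq_bigr => c _; rewrite mulrA.
rewrite exchange_big; apply: eq_bigr => b _ /=.
rewrite (exchange_big_dep predT) //= [RHS]big_mkcond; apply: eq_bigr => c _.
case: eqP => [abc|nabc].
  have lt_d : (b + c < n.+1)%N by lia.
  rewrite (big_pred1 (Ordinal lt_d)) // => d.
  by rewrite /= -val_eqE /=; apply/andP/eqP => [[_ /eqP->]|->] //; split=> //; apply/eqP; lia.
by rewrite big_pred0 // => d; apply/andP => -[/eqP ? /eqP ?]; apply: nabc; lia.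
Qed.

Lemma eulerM (p q : {poly A}) : euler (p * q) = euler p * q + p * euler q.
Proof. by rewrite /euler derivM; ring. Qed.

(** In P_2 = C (D + 1) (C D C) the inner D contributes c and the outer D + 1
    contributes b + c + 1. *)
Definition second_moment (a b c : nat) : rat := (b * c + c ^ 2 + c)%:R.

Lemma coef_ladder2 n : (a_ 2)`_n = triple_sum n second_moment.
Proof.
have -> : a_ 2 = C * euler C * euler C + C * C * euler (euler C) + C * C * euler C.
  by rewrite /= mul0r addr0 eulerM; ring.
rewrite !coefD !coef_mul3 -!big_split; apply: eq_bigr => a _ /=.
rewrite -!big_split; apply: eq_bigr => b _ /=; rewrite -!big_split; apply: eq_bigr => c _ /=.
by rewrite !coef_euler /second_moment rmorph_nat !natrD natrM natrX; ring.
Qed.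

Definition weight4_term (n : nat) (x : rat) (a b c : nat) : rat :=
  (mon31 x - pow4 x / 24%:R * (n + 2)%:R) * second_moment a b c
  + (mon22 x * (b * c)%:R - mon211 x * c%:R + mon1111 x).

(** Since P_3 = C (D + 2) P_2, every term of degree 4 has a factor C, and
    (1 - B) C = 1.  The remaining factor is a cubic form in C and its derivatives; on triples of
    indices the D acting on one factor is its index, and the D acting on P_2 is n. *)
Lemma coef_weight4 (B : {poly A}) M n k : (n < M)%N -> eqmodX M ((1 - B) * C) 1 ->
  ((1 - B) * (flow_prod k)`_4)`_n = triple_sum n (weight4_term n k%:R).
Proof.
move=> lt_nM BC; have [_ _ _ _ ->] := flow_prod_coefs k; set x := k%:R.
pose Y := - (kappa (pow4 x / 24%:R) * (euler (a_ 2) + 2%:R * a_ 2)) + kappa (mon31 x) * a_ 2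
  + (kappa (mon22 x) * (C * euler C * euler C) - kappa (mon211 x) * (C * C * euler C)
  + kappa (mon1111 x) * (C * C * C)).
set E := (X in (1 - B) * X); have -> : (1 - B) * E = (1 - B) * C * Y.
  rewrite -mulrA; congr (_ * _); rewrite /E /Y.
  by move: (kappa _) (kappa _) (kappa _) (kappa _) (kappa _) => /= *; ring.
have /eqmodX_coef-> // : eqmodX M ((1 - B) * C * Y) Y.
  by rewrite -[X in eqmodX _ _ X]mul1r; apply: eqmodXM BC _; apply: eqmodX_refl.
have kappaM c (p : {poly A}) : (kappa c * p)`_n = iota c * p`_n by rewrite coefCM.
have tripleE f (p q r : {poly A}) :
    (forall a b c, p`_a * q`_b * r`_c = iota (f a b c) * (C`_a * C`_b * C`_c)) ->
    (p * q * r)`_n = triple_sum n f.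
  move=> fE; rewrite coef_mul3; apply: eq_bigr => a _; apply: eq_bigr => b _.
  by apply: eq_bigr => c _; rewrite fE.
have e0 : (C * C * C)`_n = triple_sum n (fun _ _ _ => 1).
  by apply: tripleE => a b c /=; rewrite rmorph1 mul1r.
have e1 : (C * C * euler C)`_n = triple_sum n (fun _ _ c => c%:R).
  by apply: tripleE => a b c; cbv beta; rewrite rmorph_nat coef_euler; ring.
have e2 : (C * euler C * euler C)`_n = triple_sum n (fun _ b c => (b * c)%:R).
  by apply: tripleE => a b c; cbv beta; rewrite rmorph_nat !coef_euler natrM; ring.
have -> : Y`_n = - (iota (pow4 x / 24%:R) * ((n + 2)%:R * (a_ 2)`_n)) + iota (mon31 x) * (a_ 2)`_n
  + (iota (mon22 x) * (C * euler C * euler C)`_n - iota (mon211 x) * (C * C * euler C)`_n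
  + iota (mon1111 x) * (C * C * C)`_n).
  rewrite /Y !coefD !coefN !kappaM coefD coef_euler mulr_natl coefMn natrD.
  by congr (- (_ * _) + _ + _); rewrite -mulr_natl; ring.
rewrite /weight4_term triple_sumD triple_sumZ -coef_ladder2 !triple_sumD triple_sumZ -e2.
have -> : triple_sum n (fun _ _ c => - (mon211 x * c%:R)) = - (iota (mon211 x) * (C * C * euler C)`_n).
  rewrite -mulNr -rmorphN e1 -triple_sumZ; apply: eq_triple_sum => a b c _.
  by rewrite mulNr.
have -> : triple_sum n (fun _ _ _ => mon1111 x) = iota (mon1111 x) * (C * C * C)`_n.
  by rewrite e0 -triple_sumZ; apply: eq_triple_sum => a b c _; rewrite mulr1.
rewrite (rmorphB _ (mon31 x)) (rmorphM _ (pow4 x / 24%:R)) rmorph_nat.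
move: (iota _) (iota _) (iota _) (iota _) (iota _) => *; ring.
Qed.

(** Nonnegativity is visible in this form: the last factor is half a sum of squares of
    differences. *)
Definition weight4_coef (a b c : nat) : rat :=
  let k := (a + b + c + 3)%:R in let x := a%:R in let y := b%:R in let z := c%:R in
  (k - 1) * k * (k + 1) / 51840%:R *
  (k ^+ 2 * (k ^+ 2 - 9%:R) + 4%:R * (2%:R * k ^+ 2 - 3%:R) *
     (x ^+ 2 + y ^+ 2 + z ^+ 2 - (x * y + y * z + z * x))).

(** A polynomial identity in a, b, c once k = a + b + c + 3; before symmetrization the
    coefficients can be negative. *)
Lemma weight4_symmetrize a b c n k : (a + b + c = n)%N -> k = (n + 3)%N ->
  - k%:R^-1 * (weight4_term n k%:R a b c + weight4_term n k%:R b c a + weight4_term n k%:R c a b)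
  = 3%:R * weight4_coef a b c.
Proof.
move=> <- -> {n k}; have k0 : a%:R + b%:R + c%:R + 3%:R != 0 :> rat.
  by rewrite -!natrD pnatr_eq0 addnC.
rewrite /weight4_term /weight4_coef /second_moment !natrD ![(_ * _)%:R]natrM.
move: (a%:R : rat) (b%:R : rat) (c%:R : rat) k0 => x y z k0.
rewrite /mon1111 /mon211 /mon22 /mon31 /pow1 /pow2 /pow3 /pow4.
by field.
Qed.

End WeightFour.

(** * Positivity in the C_m *)

Lemma prod_content (A : comNzRingType) (I T : finType) (x : T -> A) (f : {ffun I -> T}) :
  \prod_i x (f i) = \prod_t x t ^+ content f t.
Proof.
under [RHS]eq_bigr do rewrite /content -prodrXr.
rewrite exchange_big; apply: eq_bigr => i _ /=.
rewrite (bigD1 (f i)) //= eqxx expr1 big1 ?mulr1 // => t /negPf.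
by rewrite eq_sym => ->; rewrite expr0.
Qed.

Lemma sum_weight_content (I T : finType) (x : T -> nat) (f : {ffun I -> T}) :
  (\sum_i x (f i) = \sum_t x t * content f t)%N.
Proof.
under [RHS]eq_bigr do rewrite /content big_distrr.
rewrite exchange_big; apply: eq_bigr => i _ /=.
rewrite (bigD1 (f i)) //= eqxx muln1 big1 ?addn0 // => t /negPf.
by rewrite eq_sym => ->; rewrite muln0.
Qed.

Lemma coef_cumulant_poly_exp (A : comNzRingType) p (R : nat -> A) s m :
  (cumulant_poly p R ^+ s)`_m =
  \sum_(f : {ffun 'I_s -> 'I_p} | (\sum_(i < p) i.+2 * content f i == m)%N)
     \prod_(i < p) (i.+1%:R * R i.+2) ^+ content f i.
Proof.
have -> : cumulant_poly p R ^+ s = \prod_(t < s) cumulant_poly p R.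
  by rewrite prodr_const card_ord.
rewrite bigA_distr_bigA /= coef_sum [RHS]big_mkcond; apply: eq_bigr => f _.
rewrite -(sum_weight_content (fun i : 'I_p => i.+2)) -(prod_content (fun i : 'I_p => i.+1%:R * R i.+2)).
have -> : \prod_(t < s) (((f t).+1%:R * R (f t).+2) *: 'X^((f t).+2)) =
    (\prod_(t < s) ((f t).+1%:R * R (f t).+2)) *: 'X^(\sum_(t < s) (f t).+2).
  by rewrite scaler_prod prodrXr.
by rewrite coefZ coefXn eq_sym; case: eqP => _; rewrite ?mulr1 ?mulr0.
Qed.

(** The words with letters of weights 2, 3, ... are grouped by their content; the
    multinomial coefficient counts each group. *)
Lemma kerov_C_geometric (A : comAlgType rat) (R : nat -> A) m N : (m < N)%N ->
  kerov_C R m = (geometric N (cumulant_poly m.-1 R))`_m.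
Proof.
move=> lt_mN; rewrite /kerov_C /geometric coef_sum.
under [RHS]eq_bigr do rewrite coef_cumulant_poly_exp.
set p := m.-1; pose x (i : 'I_p) := i.+1%:R * R i.+2.
pose W (j : 'I_p -> nat) := (\sum_(i < p) i.+2 * j i == m)%N.
pose hits s (f : {ffun 'I_s -> 'I_p}) (j : {ffun 'I_p -> 'I_m.+1}) := has_content (fun i => j i) f.
(* The bound m on the exponents loses no word, since i j_i <= m. *)
have le_m (j : 'I_p -> nat) i : W j -> (j i <= m)%N.
  by move=> /eqP <-; rewrite (bigD1 i) //=; nia.
transitivity (\sum_(j : {ffun 'I_p -> 'I_m.+1} | W (fun i => j i)) \sum_(s < N)
    \sum_(f : {ffun 'I_s -> 'I_p} | hits s f j) \prod_i x i ^+ content f i); last first.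
  rewrite exchange_big; apply: eq_bigr => s _ /=; rewrite (exchange_big_dep predT) //=.
  rewrite [RHS]big_mkcond; apply: eq_bigr => f _; rewrite -/(W (content f)).
  case: ifPn => [Wf|nWf]; last first.
    rewrite big_pred0 // => j; apply/negP => /andP[Wj /has_contentP fj]; case/negP: nWf.
    by rewrite /W (eq_bigr (fun i : 'I_p => i.+2 * j i)%N) // => i _; rewrite fj.
  rewrite (big_pred1 [ffun i => inord (content f i)]) // => j /=.
  have inE i : (inord (content f i) : 'I_m.+1) = content f i :> nat by rewrite inordK // ltnS le_m.
  apply/andP/eqP => [[_ /has_contentP fj]|->].
    by apply/ffunP => i; apply: ord_inj; rewrite ffunE inE fj.
  split; last by apply/has_contentP => i; rewrite ffunE inE.
  by rewrite /W; under eq_bigr do rewrite ffunE inE.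
apply: eq_bigr => j Wj; pose S := (\sum_i j i)%N.
have lt_SN : (S < N)%N.
  apply: leq_ltn_trans lt_mN; rewrite -(eqP Wj) leq_sum // => i _.
  by rewrite mulSn leq_addr.
rewrite (bigD1 (Ordinal lt_SN)) //= [X in _ = _ + X]big1 ?addr0 => [|s neq_s]; last first.
  apply: big_pred0 => f; apply: contraNF neq_s => /has_contentP fj.
  rewrite -val_eqE /= -[X in X == _]card_ord -(sum_content f) /S.
  by apply/eqP/eq_bigr => i _; rewrite fj.
rewrite [RHS](eq_bigr (fun=> \prod_i x i ^+ j i)) => [|f /has_contentP fj]; last first.
  by apply: eq_bigr => i _; rewrite fj.
rewrite sumr_const scaler_prod -scalerAr mulr_natl -!scaler_nat scalerA; congr (_ *: _).
have := @multinomial_count _ S (fun i => j i) (erefl S); rewrite cardsE => cnt.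
rewrite prodfV -cnt natrM natr_prod mulrC mulfK //.
by apply/prodf_neq0 => i _; rewrite pnatr_eq0 -lt0n fact_gt0.
Qed.

Lemma cumulant_poly_eqmodX (A : comNzRingType) (R : nat -> A) m k : (m <= k.+1)%N ->
  eqmodX m.+1 (cumulant_poly m.-1 R) (cumulant_poly k R).
Proof.
move=> le_mk; apply: coef_eqmodX => n; rewrite ltnS => le_nm; rewrite !coef_sum.
have le_pk : (m.-1 <= k)%N by lia.
rewrite (big_ord_widen k (fun i => ((i.+1%:R * R i.+2) *: 'X^(i.+2))`_n)) // big_mkcond.
apply: eq_bigr => i _; case: ltnP => // le_mi; rewrite coefZ coefXn.
by case: eqP => [e|_]; rewrite ?mulr0 //; lia.
Qed.

Lemma kerov_C_coef (A : comAlgType rat) (R : nat -> A) k m : (m <= k.+1)%N ->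
  kerov_C R m = (geometric k.+2 (cumulant_poly k R))`_m.
Proof.
move=> le_mk; rewrite (@kerov_C_geometric _ _ _ k.+2) //.
apply: (@eqmodX_coef _ m.+1) => //; apply: eqmodX_sum => s _.
elim: (s : nat) => [|i IHi]; first by rewrite !expr0; apply: eqmodX_refl.
by rewrite !exprS; apply: eqmodXM IHi; apply: cumulant_poly_eqmodX.
Qed.

Lemma coef_geometric_small (A : comNzRingType) k (R : nat -> A) m : (m < 2)%N ->
  (geometric k.+2 (cumulant_poly k R))`_m = (m == 0)%N%:R.
Proof.
move=> lt_m2; have B0 : eqmodX 2 (cumulant_poly k R) 0.
  by apply: eqmodX_sum0 => i _; exists ((i.+1%:R * R i.+2) *: 'X^i);
     rewrite add0r -scalerAl -exprD addn2.
have : eqmodX 2 (geometric k.+2 (cumulant_poly k R)) 1.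
  rewrite /geometric big_ord_recl expr0 -[X in eqmodX _ _ X]addr0.
  apply: eqmodXD; first exact: eqmodX_refl.
  apply: eqmodX_sum0 => i _; rewrite lift0 exprS -(mul0r (cumulant_poly k R ^+ i)).
  by apply: eqmodXM B0 _; apply: eqmodX_refl.
by move/eqmodX_coef => -> //; rewrite coef1.
Qed.

Lemma weight4_coef_ge0 a b c : 0 <= weight4_coef a b c.
Proof.
rewrite /weight4_coef; set k := (_ + 3)%:R.
have k_ge3 : 3%:R <= k by rewrite ler_nat leq_addl.
move: (a%:R : rat) (b%:R : rat) (c%:R : rat) k k_ge3 => x y z k k_ge3.
have spread : 0 <= x ^+ 2 + y ^+ 2 + z ^+ 2 - (x * y + y * z + z * x).
  by have := sqr_ge0 (x - y); have := sqr_ge0 (y - z); have := sqr_ge0 (z - x); lra.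
have k2 : 9%:R <= k ^+ 2 by nra.
have k_ge0 : 0 <= k by lra.
have [k_m1 k_p1] : 0 <= k - 1 /\ 0 <= k + 1 by split; lra.
have [q1 q2] : 0 <= k ^+ 2 - 9%:R /\ 0 <= 2%:R * k ^+ 2 - 3%:R by split; lra.
apply: mulr_ge0; first exact: divr_ge0 (mulr_ge0 (mulr_ge0 k_m1 k_ge0) k_p1) (ler0n _ _).
apply: addr_ge0; first exact: mulr_ge0 (sqr_ge0 _) q1.
exact: mulr_ge0 (mulr_ge0 (ler0n _ _) q2) spread.
Qed.

Definition nonneg_coefs n (p : {mpoly rat[n]}) : Prop := forall m, 0 <= p@_m.

Lemma nonneg_coefsM n (p q : {mpoly rat[n]}) :
  nonneg_coefs p -> nonneg_coefs q -> nonneg_coefs (p * q).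
Proof. by move=> p0 q0 m; rewrite mcoeffM sumr_ge0 // => i _; rewrite mulr_ge0. Qed.

Lemma nonneg_coefs_sum n I (r : seq I) (P : pred I) (F : I -> {mpoly rat[n]}) :
  (forall i, P i -> nonneg_coefs (F i)) -> nonneg_coefs (\sum_(i <- r | P i) F i).
Proof.
move=> F0 m; rewrite (big_morph _ (mcoeffD m) (mcoeff0 _ m)).
by apply: sumr_ge0 => i /F0.
Qed.

(** The first two are the constants C_0 = 1 and C_1 = 0, so that a sum over all triples
    of indices is a polynomial in C_2, C_3, ... *)
Definition C_var k a : {mpoly rat[k]} :=
  if a is a'.+2 then oapp (fun i : 'I_k => 'X_i) 0 (insub a') else (a == 0)%N%:R.

Lemma C_var_ge0 k a : nonneg_coefs (C_var k a).
Proof.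
case: a => [|[|a]] m; rewrite /C_var /=.
- by rewrite mcoeff1 ler0n.
- by rewrite mcoeff0.
by case: insubP => [i _ _|_] /=; rewrite ?mcoeffX ?ler0n ?mcoeff0.
Qed.

Definition weight4_C_poly k : {mpoly rat[k]} :=
  \sum_(a < (k - 3).+1) \sum_(b < (k - 3).+1) \sum_(c < (k - 3).+1 | (a + b + c == k - 3)%N)
     weight4_coef a b c *: (C_var k a * C_var k b * C_var k c).

Lemma weight4_C_poly_ge0 k : nonneg_coefs (weight4_C_poly k).
Proof.
apply: nonneg_coefs_sum => a _; apply: nonneg_coefs_sum => b _.
apply: nonneg_coefs_sum => c _ m; rewrite mcoeffZ mulr_ge0 ?weight4_coef_ge0 //.
apply: nonneg_coefsM; last exact: C_var_ge0.
by apply: nonneg_coefsM; apply: C_var_ge0.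
Qed.

Lemma comp_C_var k a (lq := [tuple kerov_C (mpoly_R k) i.+2 | i < k]) : (a <= k.+1)%N ->
  C_var k a \mPo lq = kerov_C (mpoly_R k) a.
Proof.
case: a => [|[|a]] le_ak; rewrite /C_var.
- by rewrite comp_mpoly1 (kerov_C_coef _ le_ak) coef_geometric_small.
- by rewrite comp_mpoly0 (kerov_C_coef _ le_ak) coef_geometric_small.
by rewrite insubT /= comp_mpolyXU -tnth_nth tnth_mktuple.
Qed.

Lemma mmap_map_mpoly k (A : comNzRingType) (f : {rmorphism rat -> A}) (h : 'I_k -> A)
    (g : int -> A) (S : {mpoly int[k]}) : (forall c, g c = f c%:~R) ->
  mmap g h S = mmap f h (map_mpoly intr S).
Proof.
move=> gE; rewrite [map_mpoly _ _]/mmap rmorph_sum; apply: eq_bigr => m _ /=.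
rewrite gE rmorphM /= mmapC; congr (_ * _); rewrite rmorph_prod; apply: eq_bigr => i _.
by rewrite rmorphXn /= mmapX mmap1U.
Qed.

(** Kerov's polynomial is the Kerov series, whose component of weight k - 3 has flow
    degree 4; the factor - 1/k is absorbed by the symmetrization. *)
Lemma kerov_part4E k (S : {mpoly int[k]}) : (3 <= k)%N -> kerov_polynomial S ->
  kerov_part 4 S = triple_sum (@mpolyC k rat) (geometric k.+2 (cumulant_poly k (mpoly_R k)))
     (k - 3) weight4_coef.
Proof.
move=> k_ge3 kerS; have k_gt0 : (0 < k)%N by apply: leq_trans k_ge3.
set C := geometric _ _; pose iota := @mpolyC k rat.
have -> : kerov_part 4 S = (kerov_series (fun c => (iota c)%:P) k (graded_cumulant (mpoly_R k)))`_(k.+1 - 4).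
  rewrite /kerov_part (mmap_map_mpoly (f := polyC \o iota)) => [|c]; last by rewrite /= !rmorph_int.
  rewrite (kerov_polynomialE k_gt0 kerS).
  rewrite (kerov_series_map (f := mmap (polyC \o iota) _) (iota' := fun c => (iota c)%:P)); last first.
    by move=> c; apply: mmapC.
  rewrite (kerov_series_ext _ (R' := graded_cumulant (mpoly_R k))) // => i lt_ik.
  rewrite /mpoly_R /graded_cumulant insubT /=.
  by rewrite mmapX mmap1U.
rewrite kerov_series_graded; last by lia.
have -> : (k.+1 - 4 = k - 3)%N by lia.
rewrite (@coef_weight4 _ iota k.+1 C k_ge3 _ k.+2); last first.
- exact/geometricP/cumulant_poly_divX.
- by lia.
have iota3 : iota 3%:R^-1 * iota 3%:R = 1 by rewrite -rmorphM mulVf // rmorph1.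
rewrite -[LHS]mul1r -[RHS]mul1r -iota3 -!mulrA; congr (_ * _).
rewrite mulrCA triple_sum_symmetrize -!triple_sumZ; apply: eq_triple_sum => a b c abc.
by apply: weight4_symmetrize abc _; rewrite subnK.
Qed.

Theorem corollary3p4 (k : nat) (k_ge3 : (3 <= k)%N) (S : {mpoly int[k]})
    (kerovS : kerov_polynomial S) :
  C_positive (kerov_part 4 S).
Proof.
exists (weight4_C_poly k); last first.
  by move=> m nz_m; rewrite lt_def nz_m weight4_C_poly_ge0.
rewrite kerov_part4E // /triple_sum /weight4_C_poly.
rewrite rmorph_sum; apply: eq_bigr => a _; rewrite rmorph_sum; apply: eq_bigr => b _.
rewrite rmorph_sum; apply: eq_bigr => c _ /=.
have le_k (i : 'I_(k - 3).+1) : (i <= k.+1)%N by have := ltn_ord i; lia.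
rewrite [RHS]comp_mpolyZ -mul_mpolyC; congr (_ * _).
rewrite [RHS]rmorphM [X in _ = X * _]rmorphM /= !comp_C_var ?le_k //.
by rewrite (kerov_C_coef _ (le_k a)) (kerov_C_coef _ (le_k b)) (kerov_C_coef _ (le_k c)).
Qed.
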